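(* Let $\mathcal{D}$ be a bounded domain in a complex Banach space $X$ equipped with a hyperbolic metric. Let $\mathcal{F}=\{F_t\}_{t\ge0}$ be a semigroup of holomorphic self-mappings of $\mathcal{D}$ satisfying condition ( * ) below with limit point $x_0$, and let $\{\Gamma_t\}_{t\ge0}$ be a $T$-continuous semicocycle over $\mathcal{F}$ with values in a complex unital Banach algebra $\mathcal{A}$, generated by a holomorphic $B:\mathcal{D}\to\mathcal{A}$, with $B_0=B(x_0)$. If $$\lim_{x\to x_0}\frac{\|B(x)-B_0\|_{\mathcal A}}{\|x-x_0\|_X^{\ell}}=0,\qquad \ell:=\frac{\kappa_+(B_0)-\kappa_-(B_0)}{|\kappa_+(A)|},\ A=f'(x_0),$$ then the limit $M(x)=\lim_{t\to\infty}e^{-tB_0}\Gamma_t(x)$ exists and defines a holomorphic $M:\mathcal{D}\to\mathcal{A}_*$ with $\Gamma_t(x)=M(F_t(x))^{-1}e^{tB_0}M(x)$ for all $t\ge0$, $x\in\mathcal{D}$.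
   Context: Condition ( * ): $F_t(x)\to x_0\in\mathcal{D}$ as $t\to\infty$ uniformly on subsets strictly inside $\mathcal{D}$, and $\mathcal{F}$ is generated by a holomorphic $f:\mathcal{D}\to X$ (i.e. $f(x)=\lim_{t\to0^+}\frac1t(F_t(x)-x)$, uniformly on subsets strictly inside $\mathcal{D}$) such that $\kappa_+(A)<0$ for $A=f'(x_0)\in L(X)$. For an element $a$ of a Banach algebra, $\kappa_+(a)=\limsup_{t\to\infty}\frac1t\log\|e^{ta}\|$ and $\kappa_-(a)=-\limsup_{t\to\infty}\frac1t\log\|e^{-ta}\|$ (for $A$, in $L(X)$ with operator norm). A subset lies strictly inside $\mathcal{D}$ if bounded and at positive distance from $\partial\mathcal{D}$. A semigroup: holomorphic self-maps $F_t$ of $\mathcal{D}$ with $F_{t+s}=F_t\circ F_s$, $F_t(x)\to x$ as $t\to0^+$. $\mathcal{A}$ has unit $1_{\mathcal A}$, $\|1_{\mathcal A}\|=1$; $\mathcal{A}_*$ = invertible elements. A semicocycle over $\mathcal{F}$: holomorphic $\Gamma_t:\mathcal{D}\to\mathcal{A}$ with $\Gamma_t(F_s(x))\Gamma_s(x)=\Gamma_{t+s}(x)$, $\Gamma_t(x)\to1_{\mathcal A}$ as $t\to0^+$; it is $T$-continuous if $\Gamma_t\to\Gamma_{t_0}$ as $t\to t_0$ uniformly on each subset strictly inside $\mathcal{D}$, for every $t_0\ge0$; it is generated by $B$ if $t\mapsto\Gamma_t(x)$ solves $\frac{dv}{dt}=B(F_t(x))v$, $v(0)=1_{\mathcal A}$.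 A hyperbolic metric on $\mathcal{D}$ is a metric $\rho$ for which holomorphic self-maps are $\rho$-nonexpansive and a set lies strictly inside $\mathcal{D}$ iff it lies in a $\rho$-ball of finite radius. *)

(* Defs.v *)
From HB Require Import structures.
From mathcomp Require Import all_boot all_order all_algebra.
From mathcomp Require Import all_classical all_reals all_analysis.
From mathcomp Require Import complex.
Import Order.TTheory GRing.Theory Num.Theory.
Import numFieldNormedType.Exports.
Set Implicit Arguments. Unset Strict Implicit. Unset Printing Implicit Defensive.
Local Open Scope ring_scope.
Local Open Scope classical_set_scope.

Section Defs.
Variable R : realType.
Local Notation C := R[i].

Definition rC (t : R) : C := (t%:C)%C.

(* the (real) norm of a complex normed space: in MathComp-Analysis the norm of
   a normedModType over C is C-valued (with zero imaginary part); take Re. *)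
Definition nrm (V : normedModType C) (v : V) : R := complex.Re `|v|.


Definition unital_banach_algebra (A : completeNormedModType C)
    (mul : A -> A -> A) (one : A) : Prop :=
  [/\ (forall a b c, mul a (mul b c) = mul (mul a b) c),
      (forall a, mul one a = a /\ mul a one = a),
      (forall a b c, mul (a + b) c = mul a c + mul b c
                     /\ mul a (b + c) = mul a b + mul a c),
      (forall (k : C) a b, mul (k *: a) b = k *: mul a b
                           /\ mul a (k *: b) = k *: mul a b)
    &
      (forall a b, nrm (mul a b) <= nrm (a) * nrm (b)) /\ nrm (one) = 1 ].

Definition is_inverse (A : completeNormedModType C) (mul : A -> A -> A)
  (one : A) (b a : A) : Prop := mul b a = one /\ mul a b = one.

Fixpoint apow (A : completeNormedModType C) (mul : A -> A -> A) (one : A)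
  (a : A) (n : nat) : A :=
  if n is n'.+1 then mul a (apow mul one a n') else one.

Definition aexp (A : completeNormedModType C) (mul : A -> A -> A) (one : A)
  (t : R) (a : A) : A :=
  lim (series (fun n => (n`!%:R)^-1 *: apow mul one (rC t *: a) n) @ \oo).

Definition opexp (X : completeNormedModType C) (L : X -> X) (t : R) (x : X) : X :=
  lim (series (fun n => (n`!%:R)^-1 *: iter n (fun y => rC t *: L y) x) @ \oo).

Definition opnorm (X : completeNormedModType C) (T : X -> X) : R :=
  sup [set nrm (T x) | x in [set x : X | nrm (x) <= 1]].

Definition limsup_pinfty (g : R -> R) : \bar R :=
  ereal_inf [set ereal_sup [set (g t)%:E | t in [set t | T <= t]] | T in setT].

Definition kappa_plus (A : completeNormedModType C) (mul : A -> A -> A)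
  (one : A) (a : A) : \bar R :=
  limsup_pinfty (fun t => t^-1 * ln (nrm (aexp mul one t a))).
Definition kappa_minus (A : completeNormedModType C) (mul : A -> A -> A)
  (one : A) (a : A) : \bar R :=
  (- limsup_pinfty (fun t => (t^-1 * ln (nrm (aexp mul one (- t) a)))%R))%E.
Definition kappa_plus_op (X : completeNormedModType C) (L : X -> X) : \bar R :=
  limsup_pinfty (fun t => t^-1 * ln (opnorm (opexp L t))).

Definition dbounded (X : completeNormedModType C) (S : set X) : Prop :=
  exists M : R, forall x, S x -> nrm (x) <= M.

Definition strictly_inside (X : completeNormedModType C) (D S : set X) : Prop :=
  S `<=` D /\ dbounded S /\
  exists d : R, 0 < d /\ forall x y, S x -> nrm (y - x) < d -> D y.

Definition holomorphic_on (X Y : completeNormedModType C) (D : set X)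
  (f : X -> Y) : Prop := forall x, D x -> differentiable f x.

Definition unif_cvg_on (X Y : completeNormedModType C) (F : set_system R)
  (S : set X) (g : R -> X -> Y) (h : X -> Y) : Prop :=
  forall e : R, 0 < e -> \forall t \near F, forall x, S x -> nrm (g t x - h x) < e.

Definition hyperbolic_metric (X : completeNormedModType C) (D : set X)
  (rho : X -> X -> R) : Prop :=
  [/\ (forall x y, D x -> D y -> 0 <= rho x y /\ (rho x y = 0 <-> x = y)),
      (forall x y, D x -> D y -> rho x y = rho y x),
      (forall x y z, D x -> D y -> D z -> rho x z <= rho x y + rho y z),
      (forall g : X -> X, holomorphic_on D g -> (forall x, D x -> D (g x)) ->
         forall x y, D x -> D y -> rho (g x) (g y) <= rho x y)
    & (forall S : set X, S `<=` D ->
         (strictly_inside D S <->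
          exists c r, D c /\ forall y, S y -> rho c y < r))].

Definition hol_semigroup (X : completeNormedModType C) (D : set X)
  (F : R -> X -> X) : Prop :=
  [/\ (forall t, 0 <= t -> holomorphic_on D (F t)),
      (forall t x, 0 <= t -> D x -> D (F t x)),
      (forall t s x, 0 <= t -> 0 <= s -> D x -> F (t + s) x = F t (F s x))
    & (forall x, D x -> F ^~ x @ at_right 0 --> x)].

Definition condition_star (X : completeNormedModType C) (D : set X)
  (F : R -> X -> X) (x0 : X) (f : X -> X) : Prop :=
  [/\ D x0,
      (forall S, strictly_inside D S -> unif_cvg_on +oo%R S F (fun _ => x0)),
      holomorphic_on D f,
      (forall S, strictly_inside D S ->
         unif_cvg_on (at_right 0) S (fun t x => rC t^-1 *: (F t x - x)) f)
    & (kappa_plus_op ('d f x0) < 0)%E].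

Definition T_cont_semicocycle (X A : completeNormedModType C) (mul : A -> A -> A)
  (one : A) (D : set X) (F : R -> X -> X) (Gamma : R -> X -> A) : Prop :=
  [/\ (forall t, 0 <= t -> holomorphic_on D (Gamma t)),
      (forall t s x, 0 <= t -> 0 <= s -> D x ->
         mul (Gamma t (F s x)) (Gamma s x) = Gamma (t + s) x),
      (forall x, D x -> Gamma ^~ x @ at_right 0 --> one)
    & (forall t0 : R, 0 <= t0 -> forall S, strictly_inside D S ->
         unif_cvg_on (within [set t | 0 <= t] (nbhs t0)) S Gamma (Gamma t0))].

(* t |-> Gamma_t x solves dv/dt = B(F_t x) v, v(0) = 1 (one-sided derivative at 0) *)
Definition generated_by (X A : completeNormedModType C) (mul : A -> A -> A)
  (one : A) (D : set X) (F : R -> X -> X) (Gamma : R -> X -> A) (B : X -> A)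
  : Prop :=
  forall x, D x ->
    Gamma 0 x = one /\
    forall t, 0 <= t ->
      (fun h : R => rC h^-1 *: (Gamma (t + h) x - Gamma t x))
        @ within [set h | h != 0 /\ 0 <= t + h] (nbhs 0)
      --> mul (B (F t x)) (Gamma t x).

End Defs.

(* Main.v *)
(* Put N_t(x) = e^(-t B0) Gamma_t(x). The cocycle equation becomes
   N' = e^(-t B0) (B(F_t x) - B0) e^(t B0) N, so the limit M exists, with locally uniform
   control, as soon as the operator in front of N decays exponentially along the orbit.
   Near x0 the flow contracts at every rate lam < |kappa_+(A)|: the linear flow e^(tA)
   contracts over a long enough time tau, and by Duhamel's formula F_tau is a perturbation of
   e^(tau A). The growth of the two exponentials is governed by
   kappa_+(B0) - kappa_-(B0) = ell |kappa_+(A)|, which the hypothesis B - B0 = o(|x - x0|^ell)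
   alone only just fails to beat; but B is holomorphic, so with k = floor(ell) it improves to
   B - B0 = O(|x - x0|^(k+1)), and k + 1 > ell. Holomorphy of M is Weierstrass' theorem,
   M(x0) = 1 gives invertibility near x0 (Neumann series), and both spread to the whole domain
   by M(x) = e^(-T B0) M(F_T x) Gamma_T(x).

   Frechet differentiability is assumed only pointwise, so Goursat's argument is needed for the
   Cauchy estimates; it is run on dyadic Riemann sums, which avoids vector-valued integrals. *)
Require Import Defs.
From HB Require Import structures.
From mathcomp Require Import all_boot all_order all_algebra.
From mathcomp Require Import all_classical all_reals all_analysis.
From mathcomp Require Import complex ring lra.
Import Order.TTheory GRing.Theory Num.Theory.
Import numFieldNormedType.Exports.
Local Open Scope ring_scope.
Local Open Scope classical_set_scope.
Set Implicit Arguments. Unset Strict Implicit. Unset Printing Implicit Defensive.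

(** * The real norm *)

(** Integrals are avoided everywhere, not only in Goursat's argument: the mean value inequality,
    Gronwall's inequality, Duhamel's estimate and the group law of the exponential all rest on one
    comparison principle for right derivatives, proved by real induction. Right derivatives are what
    the semigroup supplies, since its generator is a limit as t decreases to 0. The strict
    inequality k + 1 > ell leaves room for losses: kappa_+ and kappa_- are limits superior, so the
    exponentials are only bounded with rates slightly worse than these exponents, and the flow only
    contracts at a rate below |kappa_+(A)|. At the power ell itself there is no room for such
    losses. Two uniformities carry the estimates. Cauchy estimates are made on complex lines with
    constants independent of the direction, and the boundedness of D gives one Lipschitz constant at
    x0 for all F_t. The hyperbolic metric keeps a whole orbit strictly inside D. Hence T-continuity
    at time 0 is uniform along the orbit, and Gamma_t(x) is a finite product of elements near the
    unit, so it is invertible. *)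

Section RealNorm.
Variable R : realType.
Local Notation C := R[i].

Lemma subrACA (V : zmodType) (a b c d : V) : a - b - (c - d) = a - c - (b - d).
Proof. by rewrite !opprD addrACA. Qed.

Definition cabs (z : C) : R := complex.Re `|z|.

Lemma cabsE (z : C) : `|z| = rC (cabs z).
Proof. by rewrite /cabs normc_def. Qed.

Lemma cabs_ge0 (z : C) : 0 <= cabs z.
Proof. by have := normr_ge0 z; rewrite cabsE /rC ler0c. Qed.

Lemma cabsM (z w : C) : cabs (z * w) = cabs z * cabs w.
Proof.
by have := normrM z w; rewrite !cabsE /rC -rmorphM => /complexI.
Qed.

Lemma cabsD (z w : C) : cabs (z + w) <= cabs z + cabs w.
Proof. by have := ler_normD z w; rewrite !cabsE /rC -rmorphD lecR. Qed.

Lemma cabsN (z : C) : cabs (- z) = cabs z.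
Proof. by rewrite /cabs normrN. Qed.

Lemma cabsX (z : C) n : cabs (z ^+ n) = cabs z ^+ n.
Proof.
elim: n => [|n IH]; first by rewrite !expr0 /cabs normr1.
by rewrite !exprS cabsM IH.
Qed.

Lemma cabsR (t : R) : cabs (rC t) = `|t|.
Proof. by rewrite /cabs /rC normc_def /= expr0n addr0 sqrtr_sqr. Qed.

Lemma cabs0 : cabs 0 = 0.
Proof. by rewrite /cabs normr0. Qed.

Lemma cabs1 : cabs 1 = 1.
Proof. by rewrite /cabs normr1. Qed.

Lemma cabs_i : cabs 'i%C = 1.
Proof. by rewrite /cabs normc_def /= expr0n expr1n add0r sqrtr1. Qed.

Lemma cabs_eq0 (z : C) : (cabs z == 0) = (z == 0).
Proof.
apply/idP/idP => [/eqP h|/eqP ->]; last by rewrite cabs0.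
by rewrite -normr_eq0 cabsE h.
Qed.

Lemma cabs_gt0 (z : C) : (0 < cabs z) = (z != 0).
Proof. by rewrite lt_neqAle cabs_ge0 andbT eq_sym cabs_eq0. Qed.

Lemma cabsV (z : C) : cabs z^-1 = (cabs z)^-1.
Proof.
have [->|z0] := eqVneq z 0; first by rewrite invr0 cabs0 invr0.
apply: (@mulfI _ (cabs z)); first by rewrite cabs_eq0.
by rewrite -cabsM divff // cabs1 divff // cabs_eq0.
Qed.

Lemma rCD (s t : R) : rC (s + t) = rC s + rC t.
Proof. by rewrite /rC rmorphD. Qed.
Lemma rCN (s : R) : rC (- s) = - rC s.
Proof. by rewrite /rC rmorphN. Qed.
Lemma rCB (s t : R) : rC (s - t) = rC s - rC t.
Proof. by rewrite /rC rmorphB. Qed.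
Lemma rCM (s t : R) : rC (s * t) = rC s * rC t.
Proof. by rewrite /rC rmorphM. Qed.
Lemma rCV (s : R) : rC s^-1 = (rC s)^-1.
Proof. by rewrite /rC fmorphV. Qed.
Lemma rCX (s : R) n : rC (s ^+ n) = rC s ^+ n.
Proof. by rewrite /rC rmorphXn. Qed.
Lemma rC_nat n : rC (n%:R : R) = n%:R.
Proof. by rewrite /rC rmorph_nat. Qed.
Lemma rC0 : rC (0 : R) = 0. Proof. by []. Qed.
Lemma rC1 : rC (1 : R) = 1. Proof. by []. Qed.
Section OneSpace.
Variable V : normedModType C.
Implicit Types u v w : V.

Lemma nrmE v : `|v| = rC (nrm v).
Proof. by rewrite /nrm /rC RRe_real // ger0_real. Qed.

Lemma nrm_ge0 v : 0 <= nrm v.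
Proof. by have := normr_ge0 v; rewrite nrmE /rC ler0c. Qed.

Lemma nrmD u v : nrm (u + v) <= nrm u + nrm v.
Proof. by have := ler_normD u v; rewrite !nrmE /rC -rmorphD lecR. Qed.

Lemma nrmN v : nrm (- v) = nrm v.
Proof. by rewrite /nrm normrN. Qed.

Lemma nrmB u v : nrm (u - v) = nrm (v - u).
Proof. by rewrite -nrmN opprB. Qed.

Lemma nrm0 : nrm (0 : V) = 0.
Proof. by rewrite /nrm normr0. Qed.

Lemma nrm_eq0 v : (nrm v == 0) = (v == 0).
Proof.
apply/idP/idP => [/eqP h|/eqP ->]; last by rewrite nrm0.
by rewrite -normr_eq0 nrmE h.
Qed.

Lemma nrm_gt0 v : (0 < nrm v) = (v != 0).
Proof. by rewrite lt_neqAle nrm_ge0 andbT eq_sym nrm_eq0. Qed.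

Lemma nrmZ (k : C) v : nrm (k *: v) = cabs k * nrm v.
Proof.
by have := normrZ k v; rewrite !nrmE cabsE /rC -rmorphM => /complexI.
Qed.

Lemma nrmZR (t : R) v : nrm (rC t *: v) = `|t| * nrm v.
Proof. by rewrite nrmZ cabsR. Qed.

Lemma nrm_mid w u v : nrm (u - v) <= nrm (u - w) + nrm (w - v).
Proof. by rewrite (le_trans _ (nrmD _ _)) // addrA subrK. Qed.

Lemma nrm_le_add u v : nrm u <= nrm v + nrm (u - v).
Proof. by rewrite -{1}(subrKC v u) nrmD. Qed.

Lemma nrm_sum (I : Type) (r : seq I) (P : pred I) (f : I -> V) :
  nrm (\sum_(i <- r | P i) f i) <= \sum_(i <- r | P i) nrm (f i).
Proof.
elim/big_rec2: _ => [|i a b _ h]; first by rewrite nrm0.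
by rewrite (le_trans (nrmD _ _)) // lerD2l.
Qed.

Lemma nrm_small v : (forall e : R, 0 < e -> nrm v <= e) -> v = 0.
Proof.
move=> h; apply/eqP; rewrite -nrm_eq0 eq_le nrm_ge0 andbT.
by apply/ler_addgt0Pr => e e0; rewrite add0r h.
Qed.

Lemma nbhs_nrmP (x : V) (P : set V) :
  nbhs x P <-> exists2 e : R, 0 < e & forall y, nrm (y - x) < e -> P y.
Proof.
split.
  move/nbhs_normP => [e /= e0 h].
  (* A positive element of C has zero imaginary part, so its real part can serve as the radius. *)
  have e0' := e0; rewrite ltcE in e0'; case/andP: e0' => /eqP ei er.
  exists (complex.Re e); first by [].
  move=> y yx; apply: h; rewrite /ball_ /= distrC nrmE /rC ltcE /= ei eqxx.
  exact: yx.
move=> [e e0 h]; apply/nbhs_normP; exists (rC e); first by rewrite /= /rC ltcR.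
by move=> y; rewrite /ball_ /= distrC nrmE /rC ltcR; apply: h.
Qed.

Lemma cvg_nrmP (T : Type) (F : set_system T) (FF : Filter F) (f : T -> V) (l : V) :
  f @ F --> l <->
  forall e : R, 0 < e -> \forall t \near F, nrm (f t - l) < e.
Proof.
split.
  move=> fl e e0; apply: (fl (fun y => nrm (y - l) < e)).
  by apply/nbhs_nrmP; exists e.
move=> h P /nbhs_nrmP[e e0 eP].
by apply: filterS (h e e0) => t; apply: eP.
Qed.

Lemma cvg_nrm_seqP (f : nat -> V) (l : V) :
  f @ \oo --> l <->
  forall e : R, 0 < e -> exists N, forall n, (N <= n)%N -> nrm (f n - l) < e.
Proof.
split=> [/cvg_nrmP h e /h [N _ hN]|h]; first by exists N => n Nn; apply: hN.
by apply/cvg_nrmP => e /h [N hN]; exists N.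
Qed.

Lemma cvg_nrm_pinftyP (f : R -> V) (l : V) :
  f @ +oo%R --> l <->
  forall e : R, 0 < e -> exists N, forall t, N < t -> nrm (f t - l) < e.
Proof.
split=> [/cvg_nrmP h e /h [N [_ hN]]|h]; first by exists N => n Nn; apply: hN.
apply/cvg_nrmP => e /h [N hN]; exists N; split; first exact: num_real.
by move=> t; apply: hN.
Qed.

Lemma nrm_lim_le (f : nat -> V) (l : V) (K : R) :
  f @ \oo --> l -> (forall n, nrm (f n) <= K) -> nrm l <= K.
Proof.
move=> /cvg_nrm_seqP h b; apply/ler_addgt0Pr => e e0; have [N hN] := h e e0.
rewrite (le_trans (nrm_le_add _ (f N))) // lerD // nrmB ltW // hN //.
Qed.

End OneSpace.

(** Later estimates on derivatives start from this real epsilon form; [nrm_differentiable] is the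
    way back to filters. *)
Lemma differentiable_nrm (V W : normedModType C) (g : V -> W) (x : V) :
  differentiable g x ->
  (exists2 K : R, 0 <= K & forall h, nrm ('d g x h) <= K * nrm h) /\
  forall e : R, 0 < e -> exists2 d : R, 0 < d &
      forall h, nrm h < d -> nrm (g (x + h) - g x - 'd g x h) <= e * nrm h.
Proof.
move=> /diff_locallyP[dc de]; split.
  have /linear_boundedP[y [yreal yb]] := continuous_linear_bounded 0 (dc 0).
  have y1 : y < rC (Num.max 0 (complex.Re y) + 1).
    rewrite -(RRe_real yreal) /rC ltcR ltr_pwDr // le_max lexx orbT //.
  exists (Num.max 0 (complex.Re y) + 1); first by rewrite addr_ge0 // le_max lexx.
  by move=> h; have := yb _ y1 h; rewrite !nrmE /rC -rmorphM lecR.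
move=> e e0; move/eqaddoP: de => /(_ (rC e)).
rewrite {1}/rC ltcR => /(_ e0) /nbhs_nrmP[d d0 hd]; exists d => // h hhd.
have := hd h; rewrite subr0 => /(_ hhd) /=.
rewrite !nrmE /rC -rmorphM lecR /= !fctE.
by rewrite [h + x]addrC opprD addrA.
Qed.

Lemma nrm_differentiable (V W : normedModType C) (g : V -> W) (x : V)
    (L : {linear V -> W}) (K : R) :
  (forall h, nrm (L h) <= K * nrm h) ->
  (forall e : R, 0 < e -> exists2 d : R, 0 < d &
      forall h, nrm h < d -> nrm (g (x + h) - g x - L h) <= e * nrm h) ->
  differentiable g x.
Proof.
move=> Lb hd.
have Lc : continuous L.
  apply: bounded_linear_continuous; apply/linear_boundedP.
  exists (rC K); split; first by rewrite complex_real.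
  move=> r Kr h; rewrite !nrmE; apply: (@le_trans _ _ (rC K * rC (nrm h))).
    by rewrite /rC -rmorphM lecR.
  by apply: ler_wpM2r; [rewrite /rC ler0c nrm_ge0|exact: ltW].
have dL : g \o shift x = cst (g x) + L +o_ 0 id.
  apply/eqaddoP => e e0.
  have e0' := e0; rewrite ltcE in e0'; case/andP: e0' => /eqP ei er.
  have ee : e = rC (complex.Re e) by rewrite /rC RRe_real // gtr0_real.
  have [d d0 hdd] := hd _ er.
  apply/nbhs_nrmP; exists d => // y; rewrite subr0 => /hdd h.
  rewrite ee !nrmE /rC -rmorphM lecR /= !fctE.
  by rewrite [y + x]addrC opprD addrA.
have dE : 'd g x = L :> (V -> W) by apply: diff_unique.
by apply/diff_locallyP; rewrite dE.
Qed.

(** Derivatives obtained as a limit or from the product rule are bare functions; their linear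
    structure is packed here. *)
Lemma nrm_differentiable_fun (V W : normedModType C) (g : V -> W) (x : V)
    (L : V -> W) (K : R) :
  (forall (k : C) u v, L (k *: u + v) = k *: L u + L v) ->
  (forall h, nrm (L h) <= K * nrm h) ->
  (forall e : R, 0 < e -> exists2 d : R, 0 < d &
      forall h, nrm h < d -> nrm (g (x + h) - g x - L h) <= e * nrm h) ->
  differentiable g x.
Proof.
move=> Ll.
pose LL : {linear V -> W} :=
  HB.pack L (GRing.isLinear.Build C V W *:%R L Ll).
by apply: (@nrm_differentiable V W g x LL K).
Qed.

(** Differentiability concerns total functions, while the functional equation of the limit holds
    only on D. *)
Lemma differentiable_locally (V W : normedModType C) (g g' : V -> W) (x : V) (r : R) :
  0 < r -> (forall y, nrm (y - x) < r -> g y = g' y) ->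
  differentiable g' x -> differentiable g x.
Proof.
move=> r0 gg' /differentiable_nrm[[K K0 Kb] hd].
apply: (nrm_differentiable Kb) => e e0; have [d d0 hdd] := hd e e0.
exists (Num.min d r); first by rewrite lt_min d0.
move=> h; rewrite lt_min => /andP[hd1 hr].
by rewrite !gg' ?subrr ?nrm0 ?[x + h]addrC ?addrK // addrC hdd.
Qed.

Lemma differentiable_lip (V W : normedModType C) (g : V -> W) (x : V) :
  differentiable g x -> exists2 K : R, 0 < K & exists2 d : R, 0 < d &
      forall y, nrm (y - x) < d -> nrm (g y - g x) <= K * nrm (y - x).
Proof.
move=> /differentiable_nrm[[K K0 Kb] /(_ 1 ltr01)[d d0 hd]].
exists (K + 1); first by rewrite ltr_wpDl.
exists d => // y yd; have := hd _ yd; rewrite subrKC => h.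
rewrite (le_trans (nrm_le_add _ ('d g x (y - x)))) // mulrDl lerD //.
Qed.

(** The approximating [l] may change with [e] and need not be a value of [f]. In [weierstrass] it is
    a difference quotient of the limit function. *)
Lemma cauchy_cvg_nrm (V : completeNormedModType C) (T : Type) (F : set_system T)
    (FF : ProperFilter F) (f : T -> V) :
  (forall e : R, 0 < e -> exists l : V, \forall t \near F, nrm (f t - l) < e) ->
  exists l : V, f @ F --> l.
Proof.
move=> h; suff c : cvg (f @ F) by exists (lim (f @ F)).
apply: cauchy_cvg; apply: cauchy_exP => e /= e0.
have e0' := e0; rewrite ltcE in e0'; case/andP: e0' => /eqP ei er.
have ee : e = rC (complex.Re e) by rewrite /rC RRe_real // gtr0_real.
have [l hl] := h _ er; exists l.
have hl' : F [set t | nrm (f t - l) < complex.Re e] by exact: hl.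
change (F [set t | ball l e (f t)]).
apply: filterS hl' => t /= tl.
by rewrite -ball_normE /= distrC nrmE ee /rC ltcR.
Qed.

Lemma cauchy_seq_cvg (V : completeNormedModType C) (f : nat -> V) :
  (forall e : R, 0 < e -> exists N, forall n, (N <= n)%N -> nrm (f n - f N) < e) ->
  exists l : V, f @ \oo --> l.
Proof.
move=> h; apply: cauchy_cvg_nrm => e /h[N hN]; exists (f N).
by exists N => // n; apply: hN.
Qed.

End RealNorm.

(** * Functions of a real variable *)

Section RealVariable.
Variable R : realType.
Local Notation C := R[i].

(** Let c be the supremum of the t such that P holds on all of [a, t]. The limit hypothesis gives P
    at c, and if c < b the step hypothesis carries P past c. *)
Lemma real_induction (a b : R) (P : R -> Prop) :
  P a ->
  (forall t, a <= t -> t < b -> P t ->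
     exists2 d, 0 < d & forall h, 0 < h -> h < d -> P (t + h)) ->
  (forall t, a < t -> t <= b -> (forall s, a <= s -> s < t -> P s) -> P t) ->
  forall t, a <= t -> t <= b -> P t.
Proof.
move=> Pa Pr Pl t0 at0 t0b.
have ab : a <= b by exact: le_trans t0b.
pose S := [set t | [/\ a <= t, t <= b & forall s, a <= s -> s <= t -> P s]].
have Sa : S a.
  by split=> // s as1 sa; rewrite (_ : s = a) //; apply/le_anti/andP.
have hS : has_sup S by split; [exists a|exists b => t []].
pose c := sup S.
have ac : a <= c by apply: ub_le_sup => //; case: hS.
have cb : c <= b by apply: ge_sup; [exists a|move=> t []].
have Pc' s : a <= s -> s < c -> P s.
  move=> as1 sc; have [t [_ _ ht] st] := sup_gt hS.1 sc.
  by apply: ht => //; exact: ltW.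
have Pc : P c.
  by move: ac; rewrite le_eqVlt => /orP[/eqP <- //|ac]; apply: Pl.
have Pc'' s : a <= s -> s <= c -> P s.
  by move=> as1; rewrite le_eqVlt => /orP[/eqP -> //|]; apply: Pc'.
suff cb' : c = b by apply: Pc''; rewrite ?cb'.
apply/eqP; rewrite eq_le cb /= leNgt; apply/negP => cltb.
have [d d0 hd] := Pr c ac cltb Pc.
pose h := Num.min (d / 2) (b - c).
have h0 : 0 < h by rewrite /h lt_min subr_gt0 cltb andbT; lra.
have hd' : h < d by rewrite /h gt_min; apply/orP; left; lra.
have hb : c + h <= b by rewrite -lerBrDl /h ge_min lexx orbT.
have : S (c + h).
  split=> //; first by lra.
  move=> s as1 sch; have [sc|cs] := leP s c; first exact: Pc''.
  by rewrite -(subrKC c s); apply: hd; lra.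
move=> /ub_le_sup; rewrite -/c => /(_ hS.2); lra.
Qed.

Section Vector.
Variable V : normedModType C.
Implicit Types (u v : R -> V).

(** The right derivative without quotients. The generator gives no information from the left;
    [lcont] supplies the control from that side that the comparison needs. *)
Definition rder u (t : R) (w : V) : Prop := forall e : R, 0 < e ->
  exists2 d : R, 0 < d &
    forall h, 0 < h -> h < d -> nrm (u (t + h) - u t - rC h *: w) <= e * h.

Definition lcont u (t : R) : Prop := forall e : R, 0 < e ->
  exists2 d : R, 0 < d & forall h, 0 < h -> h < d -> nrm (u (t - h) - u t) <= e.

Lemma is_derive_eps (z : R -> R) (t dz : R) : is_derive t (1:R) z dz ->
  forall e : R, 0 < e -> exists2 d : R, 0 < d &
    forall h, `|h| < d -> `|z (t + h) - z t - h * dz| <= e * `|h|.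
Proof.
move=> [zd zE] e e0.
have : (fun h => h^-1 *: ((z \o shift t) (h *: (1:R)) - z t)) @ 0^' --> dz.
  by rewrite -zE; exact: zd.
move=> /cvgrPdist_lt /(_ e e0) [d /= d0 hd]; exists d => // h hhd.
have [->|h0] := eqVneq h 0.
  by rewrite addr0 mul0r !subrr normr0 mulr0.
have := hd h; rewrite /= sub0r normrN => /(_ hhd h0).
rewrite /= /shift /= /GRing.scale /= mulr1 [h + t]addrC => /ltW hle.
have -> : z (t + h) - z t - h * dz = - (dz - h^-1 * (z (t + h) - z t)) * h.
  by field.
by rewrite normrM normrN ler_wpM2r.
Qed.

(** A barrier argument: where [z] dominates, its slope is strictly larger, so it dominates a little
    longer, and left continuity closes the set of such times. The slope inequality is asked only
    under domination, which makes Gronwall's inequality a special case. *)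
Lemma rder_comparison u v (z dz : R -> R) (a b : R) :
  a <= b -> (forall t, is_derive t (1:R) z (dz t)) ->
  (forall t, a <= t -> t < b -> rder u t (v t)) ->
  (forall t, a < t -> t <= b -> lcont u t) ->
  nrm (u a) <= z a ->
  (forall t, a <= t -> t < b -> nrm (u t) <= z t -> nrm (v t) < dz t) ->
  nrm (u b) <= z b.
Proof.
move=> ab zd ud uc ua hv.
apply: (@real_induction a b (fun t => nrm (u t) <= z t)) => //.
- move=> t at1 tb ut; pose e := (dz t - nrm (v t)) / 2.
  have vt := hv t at1 tb ut.
  have e0 : 0 < e by rewrite /e; lra.
  have [d1 d10 h1] := ud t at1 tb e e0.
  have [d2 d20 h2] := is_derive_eps (zd t) e0.
  exists (Num.min d1 d2); first by rewrite lt_min d10.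
  move=> h h0; rewrite lt_min => /andP[hd1 hd2].
  have := h1 h h0 hd1; have := h2 h; rewrite gtr0_norm // => /(_ hd2).
  rewrite ler_norml => /andP[z1 _] u1.
  have := nrm_le_add (u (t + h)) (u t).
  have := nrm_le_add (u (t + h) - u t) (rC h *: v t).
  rewrite nrmZR gtr0_norm // => n1 n2.
  have : h * dz t = h * nrm (v t) + 2 * (e * h) by rewrite /e; field.
  by lra.
- move=> t at1 tb hP; apply/ler_addgt0Pr => e e0.
  have e20 : 0 < e / 2 by lra.
  have [d1 d10 h1] := uc t at1 tb _ e20.
  have [d2 d20 h2] := is_derive_eps (zd t) e20.
  (* For h < m, going from t - h to t costs e/2 for [u] and at most h (|dz t| + e/2) <= e/2 for
     [z]. *)
  pose m := Num.min (Num.min d1 d2) (Num.min (t - a) (e / 2 / (e / 2 + `|dz t| + 1))).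
  have q0 : 0 < e / 2 + `|dz t| + 1 by rewrite ltr_wpDl // addr_ge0 // ltW.
  have m0 : 0 < m by rewrite /m !lt_min d10 d20 subr_gt0 at1 divr_gt0.
  have : m <= m by []; rewrite {2}/m !le_min => /andP[/andP[m1 m2] /andP[m3]].
  rewrite ler_pdivlMr // => m4.
  pose h := m / 2.
  have h0 : 0 < h by rewrite /h; lra.
  have hm : h < m by rewrite /h; lra.
  have := h1 h h0 (lt_le_trans hm m1).
  have := h2 (- h); rewrite normrN gtr0_norm // => /(_ (lt_le_trans hm m2)).
  rewrite ler_norml => /andP[_ z1] u1.
  have Pth : nrm (u (t - h)) <= z (t - h) by apply: hP; lra.
  have := nrm_le_add (u t) (u (t - h)); rewrite [nrm (u t - _)]nrmB => n1.
  have : - h * dz t <= h * `|dz t|.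
    by rewrite mulNr -mulrN; apply: ler_wpM2l; [exact: ltW|rewrite -normrN ler_norm].
  have : h * (e / 2 + `|dz t| + 1) <= m * (e / 2 + `|dz t| + 1).
    by apply: ler_wpM2r; apply: ltW.
  by rewrite !mulrDr; have := mulr_ge0 (ltW h0) (ltW e0); lra.
Qed.

(** An extra slope [e'] makes the comparison strict; the denominator b - a + 1 stays positive when a
    = b. *)
Lemma rder_mean_value u v (z dz : R -> R) (a b : R) :
  a <= b -> (forall t, is_derive t (1:R) z (dz t)) ->
  (forall t, a <= t -> t < b -> rder u t (v t)) ->
  (forall t, a < t -> t <= b -> lcont u t) ->
  (forall t, a <= t -> t < b -> nrm (v t) <= dz t) ->
  nrm (u b - u a) <= z b - z a.
Proof.
move=> ab zd ud uc hv.
apply/ler_addgt0Pr => e e0.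
pose e' := e / (b - a + 1).
have ba : 0 < b - a + 1 by lra.
have e'0 : 0 < e' by rewrite divr_gt0.
apply: le_trans (_ : z b - z a + e' * (b - a) <= _); last first.
  rewrite lerD2l /e' mulrAC ler_pdivrMr // ler_wpM2l ?ltW //; lra.
pose zz t := z t - z a + e' * (t - a).
apply: (@rder_comparison (fun t => u t - u a) v zz (fun t => dz t + e') a b) => //.
- move=> t; rewrite /zz; have ? := zd t.
  by apply: is_derive_eq; rewrite /GRing.scale /=; ring.
- move=> t at1 tb e1 e10; have [d d0 hd] := ud t at1 tb e1 e10.
  by exists d => // h h0 hhd; rewrite opprB addrA subrK; apply: hd.
- move=> t at1 tb e1 e10; have [d d0 hd] := uc t at1 tb e1 e10.
  by exists d => // h h0 hhd; rewrite opprB addrA subrK; apply: hd.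
- by rewrite subrr nrm0 /zz !subrr mulr0 addr0.
- by move=> t at1 tb _; have := hv t at1 tb; lra.
Qed.

(** The factor 2 in the exponent buys the strict inequality k z < 2 k z, and [e'] keeps z positive.
    The loss is harmless: only a bound uniform in time is drawn from it. *)
Lemma rder_gronwall u v (K k : R -> R) (a b : R) :
  a <= b -> (forall t, is_derive t (1:R) K (k t)) -> (forall t, 0 < k t) ->
  (forall t, a <= t -> t < b -> rder u t (v t)) ->
  (forall t, a < t -> t <= b -> lcont u t) ->
  (forall t, a <= t -> t < b -> nrm (v t) <= k t * nrm (u t)) ->
  nrm (u b) <= nrm (u a) * expR (2 * (K b - K a)).
Proof.
move=> ab Kd k0 ud uc hv.
apply/ler_addgt0Pr => e e0.
pose e' := e / expR (2 * (K b - K a)).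
have e'0 : 0 < e' by rewrite divr_gt0 // expR_gt0.
have -> : nrm (u a) * expR (2 * (K b - K a)) + e
    = (nrm (u a) + e') * expR (2 * (K b - K a)).
  by rewrite [RHS]mulrDl /e' divfK // gt_eqF // expR_gt0.
pose z t := (nrm (u a) + e') * expR (2 * (K t - K a)).
apply: (@rder_comparison u v z (fun t => 2 * k t * z t) a b) => //.
- move=> t; rewrite /z; have ? := Kd t.
  by apply: is_derive_eq; rewrite /GRing.scale /=; ring.
- by rewrite /z subrr mulr0 expR0 mulr1; lra.
- move=> t at1 tb ut; apply: le_lt_trans (hv t at1 tb) _.
  have z0 : 0 < z t by rewrite /z mulr_gt0 ?expR_gt0 // ltr_wpDl // nrm_ge0.
  apply: le_lt_trans (_ : k t * z t < _); first by rewrite ler_wpM2l // ltW.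
  by rewrite ltr_pM2r //; have := k0 t; lra.
Qed.

End Vector.
End RealVariable.

(** * Exponentials of bounded operators *)

Section Exponential.
Variable R : realType.
Local Notation C := R[i].

Lemma cvg_nrm_unique (V : normedModType C) (T : Type) (F : set_system T)
    {FF : ProperFilter F} (f : T -> V) (l l' : V) :
  f @ F --> l -> f @ F --> l' -> l = l'.
Proof. by move=> h h'; apply: (cvg_unique (@norm_hausdorff _ V) h h'). Qed.

(** The majorant test with its tail. For the exponential, N = 0 yields the norm bound and N = 1, at
    time 0, the initial value. *)
Lemma normal_series_cvg (V : completeNormedModType C) (f : nat -> V) (a : nat -> R)
    (S : R) :
  (forall k, nrm (f k) <= a k) -> series a @ \oo --> S ->
  exists2 l : V, series f @ \oo --> l &
    forall N, nrm (l - series f N) <= S - series a N.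
Proof.
move=> fa aS.
have a0 k : 0 <= a k by apply: le_trans (fa k); apply: nrm_ge0.
have nda : {homo series a : n m / (n <= m)%N >-> n <= m}.
  by apply/nondecreasing_seqP => n; rewrite seriesEord /= big_ord_recr /= lerDl.
have aS' n : series a n <= S.
  rewrite -(cvg_lim (@Rhausdorff R) aS); apply: nondecreasing_cvgn_le => //.
  by apply/cvg_ex; exists S.
have bnd n N : (N <= n)%N -> nrm (series f n - series f N) <= S - series a N.
  move=> Nn; rewrite sub_series_geq //; apply: le_trans (nrm_sum _ _ _) _.
  apply: le_trans (_ : series a n - series a N <= _); last by rewrite lerB.
  by rewrite sub_series_geq //; apply: ler_sum.
have [l fl] : exists l : V, series f @ \oo --> l.
  apply: cauchy_seq_cvg => e e0.
  move/cvgrPdist_lt: (aS) => /(_ e e0) [N _ hN]; exists N => n Nn.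
  apply: le_lt_trans (bnd n N Nn) _.
  by apply: le_lt_trans (hN N (leqnn N)); apply: ler_norm.
exists l => // N.
have : (fun n => series f (n + N)%N - series f N) @ \oo --> l - series f N.
  by apply: cvgB; [rewrite cvg_shiftn|exact: cvg_cst].
by move=> /nrm_lim_le; apply => n; apply: bnd; rewrite leq_addl.
Qed.

(** Plain functions with an explicit bound: derivatives and multiplications in the algebra are
    treated alike, although [mul] carries no linear structure. *)
Definition blin (X Y : normedModType C) (L : X -> Y) (c : R) : Prop :=
  [/\ forall (k : C) u v, L (k *: u + v) = k *: L u + L v, 0 <= c &
      forall x, nrm (L x) <= c * nrm x].

Section Blin.
Variables (X Y : normedModType C) (L : X -> Y) (c : R).
Hypothesis hL : blin L c.

Lemma blin0 : L 0 = 0.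
Proof.
by apply/eqP; rewrite -nrm_eq0 eq_le nrm_ge0 andbT; case: hL => _ _ /(_ 0);
  rewrite nrm0 mulr0.
Qed.

Lemma blinD u v : L (u + v) = L u + L v.
Proof. by case: hL => l _ _; have := l 1 u v; rewrite !scale1r. Qed.

Lemma blinZ k u : L (k *: u) = k *: L u.
Proof. by case: hL => l _ _; have := l k u 0; rewrite blin0 !addr0. Qed.

Lemma blinN u : L (- u) = - L u.
Proof. by rewrite -scaleN1r blinZ scaleN1r. Qed.

Lemma blinB u v : L (u - v) = L u - L v.
Proof. by rewrite blinD blinN. Qed.

Lemma blin_le u : nrm (L u) <= c * nrm u.
Proof. by case: hL. Qed.

Lemma blin_ge0 : 0 <= c.
Proof. by case: hL. Qed.

Lemma blin_cvg (T : Type) (F : set_system T) {FF : Filter F} (f : T -> X) (l : X) :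
  f @ F --> l -> (fun n => L (f n)) @ F --> L l.
Proof.
move=> /cvg_nrmP h; apply/cvg_nrmP => e e0.
have c1 : 0 < c + 1 by rewrite ltr_wpDl // blin_ge0.
have := h (e / (c + 1)); rewrite divr_gt0 // => /(_ isT).
apply: filterS => n; rewrite ltr_pdivlMr // => hn.
rewrite -blinB; apply: le_lt_trans (blin_le _) _.
by apply: le_lt_trans hn; rewrite mulrC ler_wpM2l ?nrm_ge0 // lerDl.
Qed.

End Blin.

Lemma blin_opp (X Y : normedModType C) (L : X -> Y) c :
  blin L c -> blin (fun x => - L x) c.
Proof.
move=> hL; split; last by move=> x; rewrite nrmN (blin_le hL).
- by move=> k u v; rewrite (blinD hL) (blinZ hL) opprD scalerN.
- exact: blin_ge0 hL.
Qed.

(** Multiplying by t + h reproduces the remainder and adds a term in h^2. The coefficient (n+2)(n+1)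
    later cancels against (n+2)! and leaves n!. *)
Lemma expo_remainder (t h M : R) n : `|t| <= M -> `|t + h| <= M ->
  `|(t + h) ^+ n.+2 - t ^+ n.+2 - n.+2%:R * h * t ^+ n.+1|
    <= (n.+2 * n.+1)%:R / 2 * h ^+ 2 * M ^+ n.
Proof.
move=> tM thM; have M0 : 0 <= M by apply: le_trans tM.
elim: n => [|n IH].
  rewrite expr0 mulr1 (_ : _ - _ = h ^+ 2); last by ring.
  by rewrite ger0_norm ?sqr_ge0 //; lra.
have -> : (t + h) ^+ n.+3 - t ^+ n.+3 - n.+3%:R * h * t ^+ n.+2 =
   (t + h) * ((t + h) ^+ n.+2 - t ^+ n.+2 - n.+2%:R * h * t ^+ n.+1) +
   n.+2%:R * h ^+ 2 * t ^+ n.+1.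
  rewrite (exprS (t + h) n.+2) (exprS t n.+2) (exprS (t + h) n.+1) (exprS t n.+1).
  rewrite -(natr1 n.+2); move: ((t + h) ^+ n.+1) (t ^+ n.+1) (n.+2%:R : R) => a b m.
  by ring.
apply: le_trans (ler_normD _ _) _; rewrite !normrM !normrX normr_nat.
rewrite (_ : `|h| * `|h| = h ^+ 2); last by rewrite -normrM -expr2 ger0_norm ?sqr_ge0.
have -> : (n.+3 * n.+2)%:R / 2 * h ^+ 2 * M ^+ n.+1 =
   M * ((n.+2 * n.+1)%:R / 2 * h ^+ 2 * M ^+ n) + n.+2%:R * h ^+ 2 * M ^+ n.+1.
  rewrite !natrM (exprS M n) -(natr1 n.+2) -(natr1 n.+1); by field.
apply: lerD; first by apply: ler_pM => //; apply: normr_ge0.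
apply: ler_wpM2l; first by rewrite mulr_ge0 // sqr_ge0.
by apply: lerXn2r; rewrite ?nnegrE.
Qed.

Section OpExp.
Variables (X : completeNormedModType C) (L : X -> X) (c : R).
Hypothesis hL : blin L c.

Lemma iter_blin n : blin (iter n L) (c ^+ n).
Proof.
elim: n => [|n IH].
  by split => // x; rewrite expr0 mul1r.
split.
- by move=> k u v /=; rewrite (blinD IH) (blinZ IH) (blinD hL) (blinZ hL).
- by rewrite exprn_ge0 // (blin_ge0 hL).
- move=> x /=; apply: le_trans (blin_le hL _) _.
  by rewrite exprS -mulrA ler_wpM2l ?(blin_ge0 hL) // (blin_le IH).
Qed.

Definition expterm (t : R) (x : X) n : X := rC (t ^+ n / n`!%:R) *: iter n L x.

Lemma opexp_terms t x :
  (fun n => (n`!%:R : C)^-1 *: iter n (fun y => rC t *: L y) x) = expterm t x.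
Proof.
apply/funext => n; rewrite /expterm rCM rCV rCX rC_nat mulrC -scalerA.
congr (_ *: _); elim: n => [|n IH /=]; first by rewrite expr0 scale1r.
by rewrite IH (blinZ hL) scalerA exprS.
Qed.

Lemma nrm_expterm t x n :
  nrm (expterm t x n) <= nrm x * exp_coeff (`|t| * c) n.
Proof.
rewrite nrmZR normrM normrX normfV normr_nat /exp_coeff /=.
rewrite exprMn; have := blin_le (iter_blin n) x => h.
rewrite mulrC (_ : nrm x * _ = c ^+ n * nrm x * (`|t| ^+ n / n`!%:R)); last by ring.
by rewrite ler_wpM2r // divr_ge0 // exprn_ge0.
Qed.

Lemma expR_major (t : R) (x : X) :
  series (fun n => nrm x * exp_coeff (`|t| * c) n) @ \oo --> nrm x * expR (`|t| * c).
Proof.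
have -> : series (fun n => nrm x * exp_coeff (`|t| * c) n) =
    (fun n => nrm x * series (exp_coeff (`|t| * c)) n).
  by apply/funext => n; rewrite /series /= mulr_sumr.
by apply: cvgMr; apply: is_cvg_series_exp_coeff.
Qed.

Lemma opexp_cvg t x : series (expterm t x) @ \oo --> opexp L t x.
Proof.
have [l hl _] := normal_series_cvg (nrm_expterm t x) (@expR_major t x).
rewrite /opexp opexp_terms.
by apply/cvg_ex; exists l.
Qed.

Lemma opexp_le t x : nrm (opexp L t x) <= expR (`|t| * c) * nrm x.
Proof.
have [l hl /(_ 0%N)] := normal_series_cvg (nrm_expterm t x) (@expR_major t x).
rewrite /series /= !big_geq // !subr0 [nrm x * _]mulrC.
by rewrite (cvg_nrm_unique hl (@opexp_cvg t x)).
Qed.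

Lemma opexp0 x : opexp L 0 x = x.
Proof.
have [l hl /(_ 1%N)] := normal_series_cvg (nrm_expterm 0 x) (@expR_major 0 x).
rewrite /series /= !big_nat1 normr0 mul0r expR0 /exp_coeff /= expr0 fact0 divr1.
rewrite mulr1 subrr /expterm /= expr0 fact0 divr1 scale1r => h.
have -> : opexp L 0 x = l.
  exact: cvg_nrm_unique (@opexp_cvg 0 x) hl.
by apply/eqP; rewrite -subr_eq0 -nrm_eq0 eq_le h nrm_ge0.
Qed.

End OpExp.
#[global] Arguments opexp_cvg {X L c} hL t x.

(** [T] carries the partial sums of one series to those of the other, and boundedness passes this to
    the limit. [T] is later [L] itself or a right multiplication in the algebra. *)
Lemma opexp_intertwine (X Y : completeNormedModType C) (L : X -> X) (L' : Y -> Y)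
    (T : X -> Y) (c c' d t : R) (x : X) :
  blin L c -> blin L' c' -> blin T d -> (forall x, T (L x) = L' (T x)) ->
  T (opexp L t x) = opexp L' t (T x).
Proof.
move=> hL hL' hT TL.
have h1 : (fun n => T (series (expterm L t x) n)) @ \oo --> T (opexp L t x).
  by apply: (blin_cvg hT); exact: opexp_cvg hL t x.
apply: cvg_nrm_unique h1 _.
suff -> : (fun n => T (series (expterm L t x) n)) = series (expterm L' t (T x)).
  exact: opexp_cvg hL' t (T x).
apply/funext => n; rewrite /series /=; elim: n => [|n IH].
  by rewrite !big_geq // (blin0 hT).
rewrite !big_nat_recr //= (blinD hT) IH; congr (_ + _).
rewrite /expterm (blinZ hT); congr (_ *: _).
by elim: n {IH} => [|n IH] //=; rewrite TL IH.
Qed.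

Section OpExpDerive.
Variables (X : completeNormedModType C) (L : X -> X) (c : R).
Hypothesis hL : blin L c.

Lemma opexp_comm t x : L (opexp L t x) = opexp L t (L x).
Proof. exact: opexp_intertwine hL hL hL _. Qed.

Lemma opexp_blin t : blin (opexp L t) (expR (`|t| * c)).
Proof.
split; [move=> k u v | exact: expR_ge0 | exact: opexp_le hL t].
apply: cvg_nrm_unique (opexp_cvg hL t _) _.
suff -> : series (expterm L t (k *: u + v)) =
    (fun n => k *: series (expterm L t u) n + series (expterm L t v) n).
  by apply: cvgD; [apply: cvgZr|]; exact: opexp_cvg hL t _.
apply/funext => n; rewrite /series /= scaler_sumr -big_split /=.
apply: eq_bigr => i _; have hi := iter_blin hL i.
by rewrite /expterm (blinD hi) (blinZ hi) scalerDr !scalerA mulrC.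
Qed.

Lemma opexp_remainder (t h M : R) x : `|t| <= M -> `|t + h| <= M ->
  nrm (opexp L (t + h) x - opexp L t x - rC h *: opexp L t (L x))
   <= h ^+ 2 * (c ^+ 2 * expR (M * c)) * nrm x.
Proof.
move=> tM thM; have M0 : 0 <= M by apply: le_trans tM.
pose s t x n := series (expterm L t x) n.
(* The shifts by 2 and by 1 align L^(k+1) x with L^k (L x). The terms of order 0 and 1 then cancel,
   and the sum starts with L^2. *)
have hc : (fun n => s (t + h) x (n + 2)%N - s t x (n + 2)%N - rC h *: s t (L x) (n + 1)%N)
   @ \oo --> opexp L (t + h) x - opexp L t x - rC h *: opexp L t (L x).
  apply: cvgB; last first.
    by apply: cvgZr; rewrite (cvg_shiftn 1 (s t (L x))); exact: opexp_cvg hL t _.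
  apply: cvgB.
    by rewrite (cvg_shiftn 2 (s (t + h) x)); exact: opexp_cvg hL _ _.
  by rewrite (cvg_shiftn 2 (s t x)); exact: opexp_cvg hL _ _.
apply: nrm_lim_le hc _ => n.
have -> : s (t + h) x (n + 2)%N - s t x (n + 2)%N - rC h *: s t (L x) (n + 1)%N =
  \sum_(k < n) rC (((t + h) ^+ k.+2 - t ^+ k.+2 - k.+2%:R * h * t ^+ k.+1) / k.+2`!%:R)
     *: iter k.+2 L x.
  rewrite /s /series /= !big_mkord; elim: n => [|n IH].
    rewrite big_ord0 !big_ord_recr !big_ord0 /= /expterm /= !add0r.
    rewrite !expr0 !expr1 !fact0 (_ : 1`! = 1%N) // !divr1 !scale1r.
    by rewrite rCD scalerDl opprD addrACA subrr add0r [_ *: _ + _]addrC addrK subrr.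
  rewrite [RHS]big_ord_recr /= -IH {IH} !addn2 !addn1 !(big_ord_recr n.+2) /=.
  rewrite [\sum_(i < n.+2) expterm L t (L x) i]big_ord_recr /= scalerDr.
  rewrite !opprD [X in X + _ = _]addrACA [LHS]addrACA ; congr (_ + _).
  rewrite /expterm -iterSr /= scalerA -!scalerBl -rCM -!rCB; congr (rC _ *: _).
  rewrite (factS n.+1) natrM; field.
  by rewrite pnatr_eq0 -lt0n fact_gt0 /= -natrD pnatr_eq0.
apply: le_trans (nrm_sum _ _ _) _.
apply: le_trans (_ : \sum_(k < n) h ^+ 2 * c ^+ 2 * nrm x * exp_coeff (M * c) k <= _).
  apply: ler_sum => k _; rewrite nrmZR.
  have := expo_remainder k tM thM.
  set q := `|_ - _ - _|; move=> hq.
  have := blin_le (iter_blin hL k.+2) x => hi.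
  rewrite normrM -/q normfV normr_nat.
  have -> : h ^+ 2 * c ^+ 2 * nrm x * exp_coeff (M * c) k =
     (h ^+ 2 * M ^+ k / k`!%:R) * (c ^+ k.+2 * nrm x).
    by rewrite /exp_coeff /= exprMn -(addn2 k) exprD; ring.
  have q0 : 0 <= q by exact: normr_ge0.
  apply: ler_pM; [by rewrite divr_ge0 ?ler0n|exact: nrm_ge0| |exact: hi].
  rewrite ler_pdivrMr ?ltr0n ?fact_gt0 //; apply: le_trans hq _.
  rewrite (factS k.+1) (factS k) !natrM.
  have -> : h ^+ 2 * M ^+ k / k`!%:R * (k.+2%:R * (k.+1%:R * k`!%:R)) =
    k.+2%:R * k.+1%:R * h ^+ 2 * M ^+ k.
    by field; rewrite pnatr_eq0 -lt0n fact_gt0.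
  have : 0 <= k.+2%:R * k.+1%:R * h ^+ 2 * M ^+ k.
    by apply: mulr_ge0; [apply: mulr_ge0; [apply: mulr_ge0|apply: sqr_ge0]|apply: exprn_ge0].
  by lra.
rewrite -mulr_sumr (_ : h ^+ 2 * (c ^+ 2 * expR (M * c)) * nrm x =
  h ^+ 2 * c ^+ 2 * nrm x * expR (M * c)); last by ring.
apply: ler_wpM2l; first by apply: mulr_ge0 (nrm_ge0 _); apply: mulr_ge0; apply: sqr_ge0.
have -> : \sum_(k < n) exp_coeff (M * c) k = series (exp_coeff (M * c)) n.
  by rewrite /series /= big_mkord.
apply: nondecreasing_cvgn_le; last exact: is_cvg_series_exp_coeff.
apply/nondecreasing_seqP => m; rewrite seriesEord /= big_ord_recr /= lerDl.
by rewrite /exp_coeff /= divr_ge0 // exprn_ge0 // mulr_ge0 // (blin_ge0 hL).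
Qed.

End OpExpDerive.
End Exponential.

(** * The group law of the exponential and growth exponents *)

Section ExponentialFlow.
Variable R : realType.
Local Notation C := R[i].

Lemma opexp_opp (X : completeNormedModType C) (L : X -> X) t x :
  opexp (fun y => - L y) t x = opexp L (- t) x.
Proof.
rewrite /opexp (_ : (fun n => _ *: iter n (fun y => rC t *: - L y) x) =
  (fun n => (n`!%:R)^-1 *: iter n (fun y => rC (- t) *: L y) x)) //.
apply/funext => n.
congr (_ *: _); congr (iter n _ x); apply/funext => y.
by rewrite rCN scaleNr scalerN.
Qed.

Section Flow.
Variables (X : completeNormedModType C) (L : X -> X) (c : R).
Hypothesis hL : blin L c.

(** One constant for both signs of h: right derivatives use h > 0, left continuity uses h < 0. *)
Lemma opexp_local (T : R) : exists2 K : R, 0 < K & forall h, `|h| <= 1 ->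
  [/\ forall x, nrm (opexp L (T + h) x) <= K * nrm x,
      forall x, nrm (opexp L (T + h) x - opexp L T x) <= K * `|h| * nrm x &
      forall x, nrm (opexp L (T + h) x - opexp L T x - rC h *: opexp L T (L x))
                 <= K * h ^+ 2 * nrm x].
Proof.
have c0 := blin_ge0 hL.
pose M := `|T| + 1; pose K1 := expR (M * c).
have M0 : 0 <= M by rewrite addr_ge0.
have K10 : 0 < K1 by exact: expR_gt0.
have c2 : 0 <= c ^+ 2 by rewrite exprn_ge0.
have le1 (s : R) : `|s| <= M -> expR (`|s| * c) <= K1.
  by move=> sM; rewrite ler_expR ler_wpM2r.
exists (K1 * (1 + c + c ^+ 2)); first by rewrite mulr_gt0 //; lra.
move=> h h1; have TM : `|T| <= M by rewrite /M; lra.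
have ThM : `|T + h| <= M by rewrite (le_trans (ler_normD _ _)) // /M lerD2l.
have rem x : nrm (opexp L (T + h) x - opexp L T x - rC h *: opexp L T (L x))
    <= c ^+ 2 * K1 * h ^+ 2 * nrm x.
  by rewrite (le_trans (opexp_remainder hL x TM ThM)) // -/K1 [h ^+ 2 * _]mulrC.
split=> x; have x0 := nrm_ge0 x.
- apply: le_trans (opexp_le hL _ _) _; apply: ler_wpM2r => //.
  by rewrite (le_trans (le1 _ ThM)) // ler_peMr ?(ltW K10) //; lra.
- apply: le_trans (nrm_le_add _ (rC h *: opexp L T (L x))) _.
  have := rem x; rewrite nrmZR => r1.
  have r2 : nrm (opexp L T (L x)) <= K1 * (c * nrm x).
    apply: le_trans (opexp_le hL _ _) _.
    by apply: ler_pM; rewrite ?expR_ge0 ?nrm_ge0 ?le1 ?(blin_le hL).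
  have h0 := normr_ge0 h.
  have h2 : h ^+ 2 <= `|h|.
    by rewrite -[h ^+ 2]ger0_norm ?sqr_ge0 // normrX expr2 ler_piMl.
  apply: le_trans (lerD (ler_wpM2l h0 r2) r1) _.
  apply: le_trans (_ : `|h| * (K1 * (c * nrm x)) + c ^+ 2 * K1 * `|h| * nrm x <= _).
    by rewrite lerD2l; apply: ler_wpM2r => //; apply: ler_wpM2l => //; rewrite mulr_ge0 // ltW.
  have := mulr_ge0 (mulr_ge0 (ltW K10) h0) x0.
  by rewrite !mulrDr !mulrDl mulr1; lra.
- apply: le_trans (rem x) _; apply: ler_wpM2r => //; apply: ler_wpM2r; first exact: sqr_ge0.
  by rewrite mulrC; apply: ler_wpM2l; [exact: ltW|lra].
Qed.

(** The product rule for e^((t + c0) L) u(t). The shift [c0] is -T in Duhamel's formula and 0 for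
    the normalized semicocycle. *)
Lemma rder_opexp (u : R -> X) (t c0 : R) (w : X) : rder u t w ->
  rder (fun s => opexp L (s + c0) (u s)) t (opexp L (t + c0) (L (u t) + w)).
Proof.
move=> du e e0; set T := t + c0.
have [K K0 hK] := opexp_local T.
have e1 : 0 < e / 2 / K by rewrite !divr_gt0.
have [d d0 hd] := du _ e1.
pose d' := e / 2 / (K * (nrm (u t) + nrm w + 1)).
have q0 : 0 < K * (nrm (u t) + nrm w + 1).
  by rewrite mulr_gt0 // ltr_wpDl // addr_ge0 ?nrm_ge0.
have d'0 : 0 < d' by rewrite !divr_gt0.
exists (Num.min (Num.min d 1) d'); first by rewrite !lt_min d0 d'0 ltr01.
move=> h h0; rewrite !lt_min => /andP[/andP[hd1 h1] hd2].
have [|K1 K2 K3] := hK h; first by rewrite gtr0_norm // ltW.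
have hb := opexp_blin hL.
have -> : t + h + c0 = T + h by rewrite /T; ring.
rewrite (blinD (hb T)) scalerDr.
(* Three errors: the remainder of u under a bounded operator, the second-order remainder of the
   exponential at u(t), and the change of the exponential at w, which carries a spare factor h. *)
have -> : opexp L (T + h) (u (t + h)) - opexp L T (u t) -
   (rC h *: opexp L T (L (u t)) + rC h *: opexp L T w) =
   opexp L (T + h) (u (t + h) - u t - rC h *: w) +
   ((opexp L (T + h) (u t) - opexp L T (u t) - rC h *: opexp L T (L (u t))) +
    rC h *: (opexp L (T + h) w - opexp L T w)).
  rewrite !(blinB (hb _)) (blinZ (hb _)) scalerBr.
  set a := opexp L (T + h) (u (t + h)); set b := opexp L (T + h) (u t).
  set p := opexp L T (u t); set q := rC h *: _; set r := rC h *: _; set s := rC h *: _.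
  by rewrite [RHS]addrACA addKr !addrA subrK opprD addrA.
apply: le_trans (nrmD _ _) _.
apply: le_trans (lerD (K1 _) (nrmD _ _)) _; rewrite nrmZR gtr0_norm //.
have i1 := hd h h0 hd1; have i2 := K3 (u t); have i3 := K2 w.
rewrite gtr0_norm // in i3.
have j1 : K * nrm (u (t + h) - u t - rC h *: w) <= e / 2 * h.
  by rewrite (le_trans (ler_wpM2l (ltW K0) i1)) // mulrA [K * _]mulrC divfK // gt_eqF.
have j3 : h * nrm (opexp L (T + h) w - opexp L T w) <= h * (K * h * nrm w).
  by rewrite ler_wpM2l // ltW.
have j4 : h * (K * (nrm (u t) + nrm w + 1)) <= e / 2.
  by rewrite -ler_pdivlMr // ltW.
have j5 : h * (h * (K * (nrm (u t) + nrm w + 1))) <= h * (e / 2).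
  by rewrite ler_wpM2l // ltW.
have j6 : 0 <= K * h ^+ 2 by rewrite mulr_ge0 ?sqr_ge0 // ltW.
rewrite expr2 in i2 j6; move: j5 j6; rewrite !mulrDr !mulr1 => j5 j6.
have k1 : h * (K * h * nrm w) = h * (h * (K * nrm w)) by ring.
have k2 : K * (h * h) * nrm (u t) = h * (h * (K * nrm (u t))) by ring.
have k3 : K * (h * h) = h * (h * K) by ring.
by lra.
Qed.

Lemma lcont_opexp (u : R -> X) (t c0 : R) : lcont u t ->
  lcont (fun s => opexp L (s + c0) (u s)) t.
Proof.
move=> cu e e0; set T := t + c0.
have [K K0 hK] := opexp_local T.
have e1 : 0 < e / 2 / K by rewrite !divr_gt0.
have [d d0 hd] := cu _ e1.
pose d' := e / 2 / (K * (nrm (u t) + 1)).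
have q0 : 0 < K * (nrm (u t) + 1) by rewrite mulr_gt0 // ltr_wpDl // nrm_ge0.
have d'0 : 0 < d' by rewrite !divr_gt0.
exists (Num.min (Num.min d 1) d'); first by rewrite !lt_min d0 d'0 ltr01.
move=> h h0; rewrite !lt_min => /andP[/andP[hd1 h1] hd2].
have [|K1 K2 K3] := hK (- h); first by rewrite normrN gtr0_norm // ltW.
have hb := opexp_blin hL.
have -> : t - h + c0 = T - h by rewrite /T; ring.
apply: le_trans (nrm_mid (opexp L (T - h) (u t)) _ _) _.
rewrite -(blinB (hb _)); apply: le_trans (lerD (K1 _) (K2 _)) _.
rewrite normrN gtr0_norm //.
have j1 : K * nrm (u (t - h) - u t) <= e / 2.
  by rewrite mulrC -ler_pdivlMr // hd.
have j4 : h * (K * (nrm (u t) + 1)) <= e / 2.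
  by rewrite -ler_pdivlMr // ltW.
have k1 : h * (K * (nrm (u t) + 1)) = K * h * nrm (u t) + K * h by ring.
have := mulr_ge0 (ltW K0) (ltW h0); lra.
Qed.

Lemma rder_opexp_fun (t s : R) x :
  rder (fun r => opexp L (r + s) x) t (L (opexp L (t + s) x)).
Proof.
rewrite (opexp_comm hL) -[L x]addr0.
apply: (@rder_opexp (fun=> x)) => e e0; exists 1 => // h h0 _.
by rewrite subrr scaler0 subrr nrm0 mulr_ge0 // ltW.
Qed.

Lemma lcont_opexp_fun (t s : R) x : lcont (fun r => opexp L (r + s) x) t.
Proof.
apply: (@lcont_opexp (fun=> x)) => e e0; exists 1 => // h h0 _.
by rewrite subrr nrm0 ltW.
Qed.

End Flow.

(* Duhamel estimate: the derivative of s |-> e^{(T-s)L} u(s) is e^{(T-s)L} (u'(s) - L u(s)). *)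
Lemma duhamel (X : completeNormedModType C) (L : X -> X) (c : R) (u v : R -> X)
    (T K : R) :
  blin L c -> 0 <= T ->
  (forall t, 0 <= t -> t < T -> rder u t (v t)) ->
  (forall t, 0 < t -> t <= T -> lcont u t) ->
  (forall t, 0 <= t -> t < T -> nrm (v t - L (u t)) <= K) ->
  nrm (u T - opexp L T (u 0)) <= expR (T * c) * K * T.
Proof.
move=> hL T0 ud uc hv; have hN := blin_opp hL.
pose w s := opexp (fun y => - L y) (s + (- T)) (u s).
pose dw s := opexp (fun y => - L y) (s + (- T)) (- L (u s) + v s).
have -> : u T = w T by rewrite /w subrr (opexp0 hN).
have -> : opexp L T (u 0) = w 0 by rewrite /w opexp_opp add0r opprK.
have := @rder_mean_value R X w dw (fun s => expR (T * c) * K * s)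
  (fun=> expR (T * c) * K) 0 T T0.
rewrite mulr0 subr0; apply.
- by move=> t; apply: is_derive_eq; rewrite /GRing.scale /= mulr1.
- by move=> t t0 tT; exact: (@rder_opexp _ _ _ hN u t (- T) (v t) (ud t t0 tT)).
- by move=> t t0 tT; exact: (@lcont_opexp _ _ _ hN u t (- T) (uc t t0 tT)).
- move=> t t0 tT; apply: le_trans (opexp_le hN _ _) _.
  apply: ler_pM; rewrite ?expR_ge0 ?nrm_ge0 //; last by rewrite addrC; apply: hv.
  rewrite ler_expR; apply: ler_wpM2r; first exact: blin_ge0 hL.
  by rewrite -normrN opprB ger0_norm; lra.
Qed.

(** Duhamel's estimate with defect 0: both sides solve u' = L u with the same initial value, so no
    product of series has to be formed. *)
Lemma opexpD_ge0 (X : completeNormedModType C) (L : X -> X) (c t s : R) x :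
  blin L c -> 0 <= t -> opexp L t (opexp L s x) = opexp L (t + s) x.
Proof.
move=> hL t0; apply/esym/eqP; rewrite -subr_eq0 -nrm_eq0 eq_le nrm_ge0 andbT.
have := @duhamel X L c (fun r => opexp L (r + s) x)
  (fun r => L (opexp L (r + s) x)) t 0 hL t0.
rewrite mulr0 mul0r add0r; apply.
- by move=> r _ _; exact: (rder_opexp_fun hL).
- by move=> r _ _; exact: (lcont_opexp_fun hL).
- by move=> r _ _; rewrite subrr nrm0.
Qed.

Lemma opexpD (X : completeNormedModType C) (L : X -> X) (c t s : R) x :
  blin L c -> opexp L t (opexp L s x) = opexp L (t + s) x.
Proof.
move=> hL; have [t0|t0] := leP 0 t; first exact: opexpD_ge0 hL t0.
have hN := blin_opp hL.
have := @opexpD_ge0 _ _ _ (- t) (- s) x hN; rewrite !opexp_opp opprD !opprK.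
by apply; lra.
Qed.

Lemma opexpK (X : completeNormedModType C) (L : X -> X) (c t : R) x :
  blin L c -> opexp L t (opexp L (- t) x) = x.
Proof. by move=> hL; rewrite (opexpD _ _ _ hL) subrr (opexp0 hL). Qed.

Section OpNorm.
Variables (X : completeNormedModType C) (T : X -> X) (c : R).
Hypothesis hT : blin T c.

Lemma opnorm_le x : nrm (T x) <= opnorm T * nrm x.
Proof.
have hs : has_sup [set nrm (T y) | y in [set y : X | nrm y <= 1]].
  split; first by exists (nrm (T 0)); exists 0 => //=; rewrite nrm0.
  exists c => _ [y /= y1 <-]; apply: le_trans (blin_le hT y) _.
  by rewrite ler_piMr // (blin_ge0 hT).
have [->|x0] := eqVneq x 0; first by rewrite (blin0 hT) nrm0 mulr0.
have nx : 0 < nrm x by rewrite nrm_gt0.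
rewrite -ler_pdivrMr //; apply: ub_le_sup; first by case: hs.
exists (rC (nrm x)^-1 *: x) => /=.
  by rewrite nrmZR gtr0_norm ?invr_gt0 // mulVf // gt_eqF.
by rewrite (blinZ hT) nrmZR gtr0_norm ?invr_gt0 // mulrC.
Qed.

Lemma opnorm_ge0 : 0 <= opnorm T.
Proof.
apply: le_trans (nrm_ge0 (T 0)) _; apply: ub_le_sup.
  exists c => _ [y /= y1 <-]; apply: le_trans (blin_le hT y) _.
  by rewrite ler_piMr // (blin_ge0 hT).
by exists 0 => //=; rewrite nrm0.
Qed.

End OpNorm.

Lemma limsup_pinfty_lt (g : R -> R) (l : R) : (limsup_pinfty g < l%:E)%E ->
  exists2 T, 0 < T & forall t, T <= t -> g t <= l.
Proof.
move=> /ereal_inf_lt[_ [T _ <-] hT].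
exists (Num.max T 1); first by rewrite lt_max ltr01 orbT.
move=> t; rewrite ge_max => /andP[Tt _].
by rewrite -lee_fin ltW //; apply: le_lt_trans hT; apply: ereal_sup_ubound; exists t.
Qed.

Lemma limsup_pinfty_fin (g : R -> R) (c : R) :
  (forall t, 0 < t -> `|g t| <= c) -> limsup_pinfty g \is a fin_num.
Proof.
move=> gc; have gc' t : 0 < t -> - c <= g t /\ g t <= c.
  by move=> /gc; rewrite ler_norml => /andP.
rewrite fin_numE; apply/andP; split.
  apply/negP => /eqP h.
  have : ((- c)%:E <= limsup_pinfty g)%E.
    apply: le_ereal_inf_tmp => _ [T _ <-].
    apply: le_trans (_ : ((g (Num.max T 1))%:E <= _)%E).
      by rewrite lee_fin; apply: (gc' _ _).1; rewrite lt_max ltr01 orbT.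
    by apply: ereal_sup_ubound; exists (Num.max T 1) => //=; rewrite le_max lexx.
  by rewrite h.
apply/negP => /eqP h.
have : (limsup_pinfty g <= c%:E)%E.
  apply: (@le_trans _ _ (ereal_sup [set (g t)%:E | t in [set t | 1 <= t]])).
    by apply: ereal_inf_lbound; exists 1.
  apply: ge_ereal_sup => _ [t /= t1 <-]; rewrite lee_fin; apply: (gc' _ _).2.
  exact: lt_le_trans t1.
by rewrite h.
Qed.

Lemma limsup_log_growth (phi : R -> R) (l : R) :
  (forall t, 0 <= phi t) -> (limsup_pinfty (fun t => t^-1 * ln (phi t))%R < l%:E)%E ->
  exists2 T, 0 < T & forall t, T <= t -> phi t <= expR (l * t).
Proof.
move=> p0 /limsup_pinfty_lt[T T0 hT]; exists T => // t Tt.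
have t0 : 0 < t by exact: lt_le_trans Tt.
have := hT t Tt; rewrite mulrC ler_pdivrMr // => h.
(* [ln] is 0 at 0, so the logarithmic bound says nothing when [phi t = 0]; the claim is trivial
   there. *)
have := p0 t; rewrite le_eqVlt => /orP[/eqP <-|pt]; first exact: expR_ge0.
by rewrite -[phi t]lnK ?posrE // ler_expR.
Qed.

Lemma limsup_log_bound (phi : R -> R) (l c : R) :
  (forall t, 0 <= phi t) -> (forall t, 0 <= t -> phi t <= expR (t * c)) -> 0 <= c ->
  (limsup_pinfty (fun t => t^-1 * ln (phi t))%R < l%:E)%E ->
  exists2 K, 0 < K & forall t, 0 <= t -> phi t <= K * expR (l * t).
Proof.
move=> p0 pc c0 /(limsup_log_growth p0)[T T0 hT].
have e0 : 0 < expR (T * (c + `|l|)) by exact: expR_gt0.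
(* Before time T the crude bound e^(t c) is at most e^(T (c + |l|)) e^(l t), whatever the sign of
   l. *)
exists (expR (T * (c + `|l|)) + 1); first by lra.
move=> t t0; have [Tt|tT] := leP T t.
  by rewrite (le_trans (hT _ Tt)) // ler_peMl ?expR_ge0 //; lra.
apply: le_trans (pc t t0) _.
apply: le_trans (_ : expR (T * (c + `|l|)) * expR (l * t) <= _); last first.
  by rewrite ler_wpM2r ?expR_ge0 //; lra.
rewrite -expRD ler_expR mulrDr -addrA.
have i1 : t * c <= T * c by rewrite ler_wpM2r // ltW.
have i2 : - (l * t) <= `|l| * t.
  by rewrite -mulNr; apply: ler_wpM2r => //; rewrite -normrN ler_norm.
have i3 : `|l| * t <= `|l| * T by rewrite ler_wpM2l // ltW.
by lra.
Qed.

End ExponentialFlow.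

(** * Goursat's lemma *)

Section Goursat.
Variable R : realType.
Local Notation C := R[i].

Definition cx (a b : R) : C := rC a + 'i%C * rC b.

Lemma cxD a b a' b' : cx (a + a') (b + b') = cx a b + cx a' b'.
Proof. by rewrite /cx !rCD mulrDr addrACA. Qed.

Lemma cabs_cx_le a b : cabs (cx a b) <= `|a| + `|b|.
Proof. by rewrite (le_trans (cabsD _ _)) // cabsM cabs_i mul1r !cabsR. Qed.

Lemma half_pow_small (p d : R) : 0 < d -> exists m, p / 2 ^+ m < d.
Proof.
move=> d0; have [N hN] : exists N : nat, p / d < N%:R.
  by exists (Num.bound `|p / d|); apply: le_lt_trans (ler_norm _) (archi_boundP (normr_ge0 _)).
exists N; rewrite ltr_pdivrMr ?exprn_gt0 // mulrC -ltr_pdivrMr //.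
by apply: lt_le_trans hN _; rewrite -natrX ler_nat ltnW // ltn_expl.
Qed.

Lemma nested_intervals (a l : nat -> R) :
  (forall m, a m <= a m.+1) -> (forall m, a m.+1 + l m.+1 <= a m + l m) ->
  (forall m, 0 <= l m) -> exists A, forall m, a m <= A /\ A <= a m + l m.
Proof.
move=> a1 a2 l0.
have i1 : {homo a : m n / (m <= n)%N >-> m <= n} by apply/nondecreasing_seqP.
have i2 : {homo (fun m => a m + l m) : m n / (m <= n)%N >-> n <= m}.
  by apply/nonincreasing_seqP.
have ub m n : a n <= a m + l m.
  apply: le_trans (i1 n (maxn m n) (leq_maxr _ _)) _.
  by apply: le_trans (i2 m (maxn m n) (leq_maxl _ _)); rewrite lerDl.
exists (sup (range a)) => m; split.
  by apply: ub_le_sup; [exists (a 0%N + l 0%N) => _ [n _ <-]|exists m].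
by apply: ge_sup; [exists (a 0%N); exists 0%N|move=> _ [n _ <-]].
Qed.

Variable Y : normedModType C.

Section Contour.
Variable h : R -> R -> Y.

(** Complex differentiability in s + i th: the differential is multiplication by a + ib, which
    encodes the Cauchy-Riemann equations. *)
Definition cdiff2 (s th : R) (d : Y) : Prop := forall e : R, 0 < e ->
  exists2 dl : R, 0 < dl & forall a b, `|a| < dl -> `|b| < dl ->
    nrm (h (s + a) (th + b) - h s th - cx a b *: d) <= e * (`|a| + `|b|).

(* dyadic Riemann sums for the integrals of [h] over a horizontal and a vertical segment *)
Definition hsum n s th p : Y :=
  rC (p / 2 ^+ n) *: \sum_(j < 2 ^ n) h (s + p * (j%:R / 2 ^+ n)) th.
Definition vsum n s th q : Y :=
  rC (q / 2 ^+ n) *: \sum_(j < 2 ^ n) h s (th + q * (j%:R / 2 ^+ n)).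
Definition contour n s th p q : Y :=
  hsum n s th p - hsum n s (th + q) p + 'i%C *: (vsum n (s + p) th q - vsum n s th q).

Lemma sum_pow2S n (F : nat -> Y) : \sum_(j < 2 ^ n.+1) F j =
  \sum_(j < 2 ^ n) F j + \sum_(j < 2 ^ n) F (2 ^ n + j)%N.
Proof.
by rewrite expnS mul2n -addnn big_split_ord.
Qed.

(** The left endpoints at level n + 1 are exactly those at level n in the two halves, so halving
    causes no error. *)
Lemma hsumS n s th p :
  hsum n.+1 s th p = hsum n s th (p / 2) + hsum n (s + p / 2) th (p / 2).
Proof.
have n0 : (2 : R) ^+ n != 0 by rewrite expf_eq0 /= pnatr_eq0 andbF.
rewrite /hsum (sum_pow2S n (fun j => h (s + p * (j%:R / 2 ^+ n.+1)) th)) scalerDr.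
congr (rC _ *: _ + rC _ *: _); rewrite ?exprS; try by field.
  by apply: eq_bigr => j _; congr (h (_ + _) _); field.
apply: eq_bigr => j _; congr (h _ _); rewrite natrD natrX; field.
exact: n0.
Qed.

Lemma vsumS n s th q :
  vsum n.+1 s th q = vsum n s th (q / 2) + vsum n s (th + q / 2) (q / 2).
Proof.
have n0 : (2 : R) ^+ n != 0 by rewrite expf_eq0 /= pnatr_eq0 andbF.
rewrite /vsum (sum_pow2S n (fun j => h s (th + q * (j%:R / 2 ^+ n.+1)))) scalerDr.
congr (rC _ *: _ + rC _ *: _); rewrite ?exprS; try by field.
  by apply: eq_bigr => j _; congr (h _ (_ + _)); field.
apply: eq_bigr => j _; congr (h _ _); rewrite natrD natrX; field.
exact: n0.
Qed.

(** The inner sides of the four quarters occur with opposite orientations and cancel already at the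
    level of sums. *)
Lemma contourS n s th p q : contour n.+1 s th p q =
  (contour n s th (p / 2) (q / 2) + contour n s (th + q / 2) (p / 2) (q / 2)) +
  (contour n (s + p / 2) th (p / 2) (q / 2) +
   contour n (s + p / 2) (th + q / 2) (p / 2) (q / 2)).
Proof.
have sub_mid (a b c : Y) : (a - b) + (b - c) = a - c by rewrite addrA subrK.
have sub_mid' (a b c : Y) : (b - c) + (a - b) = a - c by rewrite addrC sub_mid.
rewrite /contour.
have -> : th + q / 2 + q / 2 = th + q by field.
have -> : s + p / 2 + p / 2 = s + p by field.
rewrite [X in _ = X + _]addrACA [X in _ = _ + X]addrACA !sub_mid -!scalerDr.
rewrite [RHS]addrACA -scalerDr; congr (_ + _ *: _).
  by rewrite !hsumS opprD addrACA.
by rewrite !vsumS [RHS]addrACA !sub_mid' opprD addrACA.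
Qed.

Lemma pow2_average n p (v : 'I_(2 ^ n) -> Y) (w : Y) K : 0 <= p ->
  (forall j, nrm (v j - w) <= K) ->
  nrm (rC (p / 2 ^+ n) *: \sum_(j < 2 ^ n) v j - rC p *: w) <= p * K.
Proof.
move=> p0 hv; have n0 : (2 : R) ^+ n != 0 by rewrite expf_eq0 /= pnatr_eq0 andbF.
have n1 : 0 < (2 : R) ^+ n by rewrite exprn_gt0.
have -> : rC p *: w = rC (p / 2 ^+ n) *: \sum_(j < 2 ^ n) w.
  rewrite sumr_const card_ord -(scaler_nat (2 ^ n)%N w) scalerA -rC_nat -rCM natrX divfK //.
rewrite -scalerBr -sumrB nrmZR ger0_norm; last by rewrite divr_ge0 // ltW.
rewrite -mulrA ler_wpM2l // ler_pdivrMl //.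
apply: le_trans (nrm_sum _ _ _) _.
apply: le_trans (ler_sum _ (fun j _ => hv j)) _.
by rewrite sumr_const card_ord -(mulr_natl K (2 ^ n)%N) natrX.
Qed.

(** For an affine function, opposite sides sampled at matching points contribute -i p q d and i p q
    d, so the contour sum vanishes at every level. Only the error e survives, twice per difference,
    over the lengths p and q. *)
Lemma contour_affine_bound n s th p q A B (d : Y) e :
  0 <= p -> 0 <= q -> 0 <= e ->
  (forall x y, s <= x -> x <= s + p -> th <= y -> y <= th + q ->
     nrm (h x y - h A B - cx (x - A) (y - B) *: d) <= e) ->
  nrm (contour n s th p q) <= 2 * e * (p + q).
Proof.
move=> p0 q0 e0 hh.
have n1 : 0 < (2 : R) ^+ n by rewrite exprn_gt0.
have j01 (j : 'I_(2 ^ n)) (r : R) : 0 <= r ->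
    0 <= r * (j%:R / 2 ^+ n) /\ r * (j%:R / 2 ^+ n) <= r.
  move=> r0; split; first by rewrite mulr_ge0 // divr_ge0 // ltW.
  by rewrite ler_piMr // ler_pdivrMr // mul1r -natrX ler_nat ltnW.
have key x y x' y' w : s <= x -> x <= s + p -> th <= y -> y <= th + q ->
   s <= x' -> x' <= s + p -> th <= y' -> y' <= th + q ->
   w = cx (x - x') (y - y') *: d -> nrm (h x y - h x' y' - w) <= 2 * e.
  move=> a1 a2 a3 a4 b1 b2 b3 b4 ->.
  have -> : h x y - h x' y' - cx (x - x') (y - y') *: d =
     (h x y - h A B - cx (x - A) (y - B) *: d)
     - (h x' y' - h A B - cx (x' - A) (y' - B) *: d).
    have -> : x - x' = (x - A) + (- (x' - A)) by ring.
    have -> : y - y' = (y - B) + (- (y' - B)) by ring.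
    rewrite cxD scalerDl (_ : cx (- (x' - A)) _ = - cx (x' - A) (y' - B)); last first.
      by rewrite /cx !rCN mulrN opprD.
      rewrite scaleNr [RHS]subrACA; congr (_ - _).
    by rewrite subrACA subrr subr0.
  by rewrite (le_trans (nrmD _ _)) // nrmN mulr_natl mulr2n lerD // hh.
have bh : nrm (hsum n s th p - hsum n s (th + q) p - rC p *: (cx 0 (- q) *: d)) <= p * (2 * e).
  rewrite /hsum -scalerBr -sumrB; apply: pow2_average => // j.
  have [? ?] := j01 j p p0; apply: key;
    [lra|lra|lra|lra|lra|lra|lra|lra|congr (cx _ _ *: _); lra].
have bv : nrm (vsum n (s + p) th q - vsum n s th q - rC q *: (cx p 0 *: d)) <= q * (2 * e).
  rewrite /vsum -scalerBr -sumrB; apply: pow2_average => // j.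
  have [? ?] := j01 j q q0; apply: key;
    [lra|lra|lra|lra|lra|lra|lra|lra|congr (cx _ _ *: _); lra].
rewrite /contour; move: bh bv; set P := hsum _ _ _ _ - _; set Q := vsum _ _ _ _ - _.
set P' := rC p *: _; set Q' := rC q *: _ => bh bv.
have -> : P + 'i%C *: Q = (P - P') + 'i%C *: (Q - Q').
  have z : P' = - ('i%C *: Q').
    rewrite /P' /Q' !scalerA -scaleNr; congr (_ *: _).
    by rewrite /cx rCN !rC0 mulr0 addr0 add0r; ring.
  have cancel (a b c' w : Y) : c' = - ('i%C *: w) ->
      a + 'i%C *: b = (a - c') + 'i%C *: (b - w).
    by move=> ->; rewrite scalerBr opprK [X in _ = _ + X]addrC addrA addrK.
  exact: cancel z.
rewrite (le_trans (nrmD _ _)) // nrmZ cabs_i mul1r; lra.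
Qed.

(* Goursat's lemma for the Riemann sums themselves: being frequently larger than c is
   inherited by one of the four quarters, because the sums split exactly; no integral
   needs to exist. *)
Lemma goursat s th p q : 0 <= p -> 0 <= q ->
  (forall x y, s <= x -> x <= s + p -> th <= y -> y <= th + q -> exists d, cdiff2 x y d) ->
  forall c, 0 < c -> exists N, forall n, (N <= n)%N -> nrm (contour n s th p q) <= c.
Proof.
move=> p0 q0 hd c c0; apply: contrapT => hneg.
pose P m (x : R * R) := forall N, exists2 n, (N <= n)%N &
  c / 4 ^+ m < nrm (contour n x.1 x.2 (p / 2 ^+ m) (q / 2 ^+ m)).
have P0 : P 0%N (s, th).
  move=> N; apply: contrapT => hN; apply: hneg; exists N => n Nn.
  rewrite leNgt; apply/negP => cn; apply: hN; exists n => //.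
  by rewrite /= !expr0 !divr1.
pose mv m (x : R * R) (ij : bool * bool) : R * R :=
  (x.1 + ij.1%:R * (p / 2 ^+ m.+1), x.2 + ij.2%:R * (q / 2 ^+ m.+1)).
have Pher (mx : nat * (R * R)) : exists ij, P mx.1 mx.2 -> P mx.1.+1 (mv mx.1 mx.2 ij).
  case: mx => m x /=; apply: contrapT => hn.
  have nP ij : P m x /\ ~ P m.+1 (mv m x ij).
    by apply: contrapT => h1; apply: hn; exists ij => Pm; apply: contrapT => h2; apply: h1.
  have Q ij : exists N, forall n, (N <= n)%N ->
     nrm (contour n (mv m x ij).1 (mv m x ij).2 (p / 2 ^+ m.+1) (q / 2 ^+ m.+1)) <= c / 4 ^+ m.+1.
    apply: contrapT => h1; apply: (nP ij).2 => N; apply: contrapT => h2; apply: h1.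
    exists N => n Nn; rewrite leNgt; apply/negP => h3; apply: h2; by exists n.
  have [N1 h1] := Q (false, false); have [N2 h2] := Q (false, true).
  have [N3 h3] := Q (true, false); have [N4 h4] := Q (true, true).
  (* The successor in the threshold forces a level of the form n + 1, which [contourS] can split. *)
  have [[|n] Nn] := (nP (true, true)).1 (maxn (maxn N1 N2) (maxn N3 N4)).+1.
    by [].
  move: Nn; rewrite ltnS !geq_max => /andP[/andP[g1 g2] /andP[g3 g4]].
  rewrite contourS.
  have half (r : R) : r / 2 ^+ m / 2 = r / 2 ^+ m.+1.
    by rewrite exprSr invfM mulrA.
  rewrite !half.
  have := h1 n g1; have := h2 n g2; have := h3 n g3; have := h4 n g4.
  rewrite /mv /= !mul0r !mul1r !addr0 => b4 b3 b2 b1 b0.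
  have := lt_le_trans b0 (le_trans (nrmD _ _) (lerD (nrmD _ _) (nrmD _ _))).
  have : c / 4 ^+ m = 4 * (c / 4 ^+ m.+1).
    by rewrite exprS; field; rewrite expf_eq0 pnatr_eq0 andbF.
  by lra.
have [f hf] := choice Pher.
pose fix xs m := if m is m'.+1 then mv m' (xs m') (f (m', xs m')) else (s, th).
have Pxs m : P m (xs m) by elim: m => [//|m IH]; apply: (hf (m, xs m)).
have pw (r : R) m : 0 <= r -> 0 <= r / 2 ^+ m.
  by move=> r0; rewrite divr_ge0 // exprn_ge0.
have half (r : R) m : r / 2 ^+ m = r / 2 ^+ m.+1 + r / 2 ^+ m.+1.
  by rewrite exprS; field; rewrite expf_eq0 pnatr_eq0 andbF.
have [A hA] : exists A, forall m, (xs m).1 <= A /\ A <= (xs m).1 + p / 2 ^+ m.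
  apply: nested_intervals => m; last exact: pw.
    by rewrite /= lerDl mulr_ge0 // pw.
  rewrite /= (half p m) -addrA lerD2l lerD2r ler_piMl ?pw //.
  by case: (f _).1.
have [B hB] : exists B, forall m, (xs m).2 <= B /\ B <= (xs m).2 + q / 2 ^+ m.
  apply: nested_intervals => m; last exact: pw.
    by rewrite /= lerDl mulr_ge0 // pw.
  rewrite /= (half q m) -addrA lerD2l lerD2r ler_piMl ?pw //.
  by case: (f _).2.
have [d hdd] : exists d, cdiff2 A B d.
  have := hA 0%N; have := hB 0%N; rewrite /= !expr0 !divr1 => -[? ?] [? ?].
  exact: hd.
(* The affine bound on the m-th rectangle is 2 e (p + q)^2 / 4^m. This choice keeps it below c /
   4^m, against [P m]. *)
pose e := c / (2 * ((p + q) ^+ 2 + 1)).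
have q1 : 0 < 2 * ((p + q) ^+ 2 + 1) by rewrite mulr_gt0 // ltr_wpDl // sqr_ge0.
have e0 : 0 < e by rewrite divr_gt0.
have [dl dl0 hdl] := hdd e e0.
have [m hm] := half_pow_small (p + q) dl0.
have pm := pw p m p0; have qm := pw q m q0.
rewrite mulrDl in hm.
have [n _] := Pxs m 0%N; apply/negP; rewrite -leNgt.
have [? ?] := hA m; have [? ?] := hB m.
apply: le_trans (@contour_affine_bound n _ _ _ _ A B d (e * (p / 2 ^+ m + q / 2 ^+ m)) pm qm _ _) _.
- by rewrite mulr_ge0 ?addr_ge0 // ltW.
- move=> x y x1 x2 y1 y2.
  have xA : `|x - A| <= p / 2 ^+ m by rewrite ler_norml; lra.
  have yB : `|y - B| <= q / 2 ^+ m by rewrite ler_norml; lra.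
  have := hdl (x - A) (y - B); rewrite !subrKC => hh.
  apply: le_trans (hh _ _) _; [lra|lra|].
  by rewrite ler_wpM2l ?lerD // ltW.
- have -> : 2 * (e * (p / 2 ^+ m + q / 2 ^+ m)) * (p / 2 ^+ m + q / 2 ^+ m) =
     2 * e * (p + q) ^+ 2 / 4 ^+ m.
    have -> : (4 : R) ^+ m = 2 ^+ m * 2 ^+ m by rewrite -exprMn; congr (_ ^+ _); ring.
    by field; rewrite expf_eq0 pnatr_eq0 andbF.
  rewrite ler_wpM2r ?invr_ge0 ?exprn_ge0 //.
  have : e * (2 * ((p + q) ^+ 2 + 1)) = c by rewrite divfK // gt_eqF.
  by lra.
Qed.

End Contour.
End Goursat.

(** * Polar coordinates and rules for complex derivatives *)

Section ComplexVariable.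
Variable R : realType.
Local Notation C := R[i].

Lemma cxE (a b : R) : cx a b = (a +i* b)%C.
Proof. by rewrite [RHS]complexE. Qed.

Lemma cxM (a b a' b' : R) : cx a b * cx a' b' = cx (a * a' - b * b') (a * b' + b * a').
Proof. by rewrite !cxE. Qed.

(** The exponential of s + i th. It turns a rectangle into an annulus and vertical segments into
    circular arcs, so Goursat's lemma is needed for rectangles only. *)
Definition polar (s th : R) : C := rC (expR s) * cx (cos th) (sin th).

Lemma cabs_polar s th : cabs (polar s th) = expR s.
Proof.
rewrite /polar cabsM cabsR ger0_norm ?expR_ge0 // cxE /cabs normc_def /=.
by rewrite cos2Dsin2 sqrtr1 mulr1.
Qed.

Lemma polar_neq0 s th : polar s th != 0.
Proof. by rewrite -cabs_gt0 cabs_polar expR_gt0. Qed.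

Lemma polarD s th a b : polar (s + a) (th + b) = polar s th * polar a b.
Proof.
rewrite /polar expRD cosD sinD rCM mulrACA cxM; congr (_ * cx _ _).
by rewrite addrC.
Qed.

Lemma polar2pi s : polar s (pi *+ 2) = polar s 0.
Proof. by rewrite /polar cos2pi sin2pi cos0 sin0. Qed.

Lemma polar_expand (e : R) : 0 < e -> exists2 d : R, 0 < d &
  forall a b, `|a| < d -> `|b| < d ->
    cabs (polar a b - 1 - cx a b) <= e * (`|a| + `|b|).
Proof.
(* The 8 anticipates the final sum of errors, e'|a| + (3 + 3 + 2) e'|b|. *)
move=> e0; have [e' [e'0 e'1 e'8]] : exists e' : R, [/\ 0 < e', e' <= 1 & 8 * e' <= e].
  exists (Num.min 1 (e / 8)); split; first by rewrite lt_min ltr01 divr_gt0.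
    by rewrite ge_min lexx.
  by rewrite mulrC -ler_pdivlMr // ge_min lexx orbT.
have de : is_derive (0 : R) (1 : R) (@expR R) 1.
  by apply: is_derive_eq; rewrite expR0.
have dc : is_derive (0 : R) (1 : R) (@cos R) 0.
  by apply: is_derive_eq; rewrite sin0 oppr0.
have ds : is_derive (0 : R) (1 : R) (@sin R) 1.
  by apply: is_derive_eq; rewrite cos0.
have [d1 d10 h1] := is_derive_eps de e'0.
have [d2 d20 h2] := is_derive_eps dc e'0.
have [d3 d30 h3] := is_derive_eps ds e'0.
exists (Num.min (Num.min d1 d2) (Num.min d3 e')).
  by rewrite !lt_min d10 d20 d30 e'0.
move=> a b; rewrite !lt_min => /andP[/andP[a1 a2] /andP[a3 a4]].
move=> /andP[/andP[b1 b2] /andP[b3 b4]].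
have := h1 a a1; have := h2 b b2; have := h3 b b3.
rewrite !add0r expR0 cos0 sin0 subr0 !mulr1 mulr0 subr0 => k3 k2 k1.
have ea : `|expR a - 1| <= 2 * `|a|.
  have : `|expR a - 1| <= `|expR a - 1 - a| + `|a|.
    by rewrite -{1}(subrK a (expR a - 1)) ler_normD.
  have : e' * `|a| <= `|a| by rewrite ler_piMl.
  by lra.
have ea3 : expR a <= 3.
  by move: ea (ler_norm (expR a - 1)) => *; lra.
have -> : polar a b - 1 - cx a b = cx (expR a * cos b - 1 - a) (expR a * sin b - b).
  by rewrite /polar /cx !rCB !rCM rC1; ring.
apply: le_trans (cabs_cx_le _ _) _.
have -> : expR a * cos b - 1 - a = (expR a - 1 - a) + expR a * (cos b - 1) by ring.
have -> : expR a * sin b - b = expR a * (sin b - b) + (expR a - 1) * b by ring.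
apply: le_trans (lerD (ler_normD _ _) (ler_normD _ _)) _.
rewrite !normrM (ger0_norm (expR_ge0 a)).
have i1 : expR a * `|cos b - 1| <= 3 * (e' * `|b|).
  by apply: ler_pM; rewrite ?expR_ge0.
have i2 : expR a * `|sin b - b| <= 3 * (e' * `|b|).
  by apply: ler_pM; rewrite ?expR_ge0.
have i3 : `|expR a - 1| * `|b| <= 2 * e' * `|b|.
  by apply: ler_wpM2r => //; apply: le_trans ea _; apply: ler_wpM2l => //; exact: ltW.
have i4 : 8 * e' * (`|a| + `|b|) <= e * (`|a| + `|b|).
  by apply: ler_wpM2r => //; rewrite addr_ge0.
have := mulr_ge0 (ltW e'0) (normr_ge0 a).
by move: i4; rewrite !mulrDr; lra.
Qed.

Variable Y : normedModType C.
Implicit Types (g : C -> Y) (z w : C) (d : Y).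

Definition cdiff g z d : Prop := forall e : R, 0 < e -> exists2 dl : R, 0 < dl &
  forall w, cabs w < dl -> nrm (g (z + w) - g z - w *: d) <= e * cabs w.

Lemma cdiff_polar g s th d : cdiff g (polar s th) d ->
  cdiff2 (fun x y => g (polar x y)) s th (polar s th *: d).
Proof.
move=> gd e e0; set z := polar s th; set az := cabs z.
have az0 : 0 < az by rewrite /az cabs_polar expR_gt0.
have e1 : 0 < e / (4 * az) by rewrite divr_gt0 // mulr_gt0.
have [d1 d10 h1] := gd _ e1.
pose e2 := Num.min 1 (e / 2 / (az * (nrm d + 1))).
have q0 : 0 < az * (nrm d + 1) by rewrite mulr_gt0 // ltr_wpDl ?nrm_ge0.
have e20 : 0 < e2 by rewrite lt_min ltr01 !divr_gt0.
have e21 : e2 <= 1 by rewrite ge_min lexx.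
have e22 : e2 * (az * (nrm d + 1)) <= e / 2.
  by rewrite -ler_pdivlMr // ge_min lexx orbT.
have [d2 d20 h2] := polar_expand e20.
exists (Num.min d2 (d1 / (4 * az))).
  by rewrite lt_min d20 divr_gt0 // mulr_gt0.
move=> a b; rewrite !lt_min => /andP[a1 a2] /andP[b1 b2].
rewrite polarD -/z; set w := z * (polar a b - 1).
have -> : z * polar a b = z + w by rewrite /w mulrBr mulr1 subrKC.
have k2 := h2 a b a1 b1.
have ab0 : 0 <= `|a| + `|b| by rewrite addr_ge0.
have k3 : cabs (polar a b - 1) <= 2 * (`|a| + `|b|).
  rewrite -(subrK (cx a b) (polar a b - 1)) (le_trans (cabsD _ _)) //.
  have := cabs_cx_le a b; have : e2 * (`|a| + `|b|) <= `|a| + `|b| by rewrite ler_piMl.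
  by lra.
have wle : cabs w <= az * (2 * (`|a| + `|b|)) by rewrite cabsM ler_wpM2l // ltW.
have wd : cabs w < d1.
  apply: le_lt_trans wle _.
  have : (`|a| + `|b|) < d1 / (4 * az) + d1 / (4 * az) by exact: ltrD.
  have -> : d1 / (4 * az) + d1 / (4 * az) = d1 / (2 * az) by field; rewrite gt_eqF.
  rewrite ltr_pdivlMr ?mulr_gt0 //; lra.
have k1 := h1 w wd.
have -> : g (z + w) - g z - cx a b *: (z *: d) =
  (g (z + w) - g z - w *: d) + (z * (polar a b - 1 - cx a b)) *: d.
  by rewrite /w [z * (_ - _ - _)]mulrBr scalerBl addrA subrK scalerA [cx a b * z]mulrC.
rewrite (le_trans (nrmD _ _)) // nrmZ cabsM -/az.
have k4 : e / (4 * az) * cabs w <= e / 2 * (`|a| + `|b|).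
  apply: le_trans (ler_wpM2l (ltW e1) wle) _.
  have -> : e / (4 * az) * (az * (2 * (`|a| + `|b|))) = e / 2 * (`|a| + `|b|).
    by field; rewrite gt_eqF.
  exact: lexx.
have k5 : az * cabs (polar a b - 1 - cx a b) * nrm d <= e / 2 * (`|a| + `|b|).
  apply: le_trans (_ : az * (e2 * (`|a| + `|b|)) * (nrm d + 1) <= _).
    apply: ler_pM; rewrite ?mulr_ge0 ?nrm_ge0 ?cabs_ge0 // ?(ltW az0) //.
      by rewrite ler_wpM2l // ltW.
    by rewrite lerDl.
  have -> : az * (e2 * (`|a| + `|b|)) * (nrm d + 1) =
     e2 * (az * (nrm d + 1)) * (`|a| + `|b|) by ring.
  by rewrite ler_wpM2r.
by lra.
Qed.

Lemma cdiff_divz g z d : z != 0 -> cdiff g z d ->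
  exists d', cdiff (fun w => w^-1 *: g w) z d'.
Proof.
move=> z0 gd; exists (z^-1 *: d - (z ^+ 2)^-1 *: g z) => e e0.
have az0 : 0 < cabs z by rewrite cabs_gt0.
set r := cabs z in az0 *.
have e1 : 0 < e / 2 * (r / 2) by rewrite mulr_gt0 ?divr_gt0.
have [d1 d10 h1] := gd _ e1.
pose K := nrm d / (r * (r / 2)) + nrm (g z) / (r ^+ 2 * (r / 2)) + 1.
have K0 : 0 < K.
  by rewrite ltr_wpDl // addr_ge0 // divr_ge0 ?nrm_ge0 ?mulr_ge0 ?exprn_ge0 // ?ltW // divr_gt0.
exists (Num.min d1 (Num.min (r / 2) (e / 2 / K))).
  by rewrite !lt_min d10 !divr_gt0.
move=> w; rewrite !lt_min => /andP[w1 /andP[w2 w3]].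
have zw : r / 2 <= cabs (z + w).
  have := cabsD (z + w) (- w); rewrite addrK cabsN -/r; lra.
have zw0 : z + w != 0 by rewrite -cabs_gt0; lra.
(* The quotient rule with its error: one term is the remainder of g, the other two are quadratic in
   w. *)
have -> : (z + w)^-1 *: g (z + w) - z^-1 *: g z - w *: (z^-1 *: d - (z ^+ 2)^-1 *: g z) =
  (z + w)^-1 *: (g (z + w) - g z - w *: d) +
   ((- (w ^+ 2 / (z * (z + w)))) *: d + (w ^+ 2 / (z ^+ 2 * (z + w))) *: g z).
  rewrite !scalerBr !scalerA.
  have -> : w ^+ 2 / (z ^+ 2 * (z + w)) = (z + w)^-1 - z^-1 + w / z ^+ 2.
    by field; rewrite zw0 z0.
  have -> : - (w ^+ 2 / (z * (z + w))) = (z + w)^-1 * w - w / z.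
    by field; rewrite zw0 z0.
  rewrite !scalerDl !scaleNr; set A := _ *: g (z + w); set B := (z + w)^-1 *: g z.
  set a := _ *: d; set b := _ *: d; set p := _ *: g z; set q := _ *: g z.
  rewrite opprB [RHS]addrA [A - B - b + _]addrA subrK.
  rewrite -[B - p + q]addrA [A - B - a]addrAC [RHS]addrA subrK.
  by rewrite [RHS]addrACA [- a + q]addrC addrA.
have r20 : 0 < r / 2 by rewrite divr_gt0.
have cw := cabs_ge0 w.
have iV : (cabs (z + w))^-1 <= (r / 2)^-1 by rewrite lef_pV2 ?posrE // (lt_le_trans r20).
apply: le_trans (nrmD _ _) (le_trans (lerD (lexx _) (nrmD _ _)) _).
rewrite !nrmZ cabsN !(cabsM (w ^+ 2)) !cabsV (cabsM z) (cabsM (z ^+ 2)) !cabsX -/r.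
have i1 : (cabs (z + w))^-1 * nrm (g (z + w) - g z - w *: d) <= e / 2 * cabs w.
  apply: le_trans (_ : (r / 2)^-1 * (e / 2 * (r / 2) * cabs w) <= _).
    by apply: ler_pM; rewrite ?invr_ge0 ?cabs_ge0 ?nrm_ge0 // h1.
  have -> // : (r / 2)^-1 * (e / 2 * (r / 2) * cabs w) = e / 2 * cabs w.
  by field; rewrite gt_eqF.
have i2 : cabs w ^+ 2 / (r * cabs (z + w)) * nrm d <= cabs w ^+ 2 * (nrm d / (r * (r / 2))).
  rewrite -mulrA; apply: ler_wpM2l; first exact: sqr_ge0.
  rewrite mulrC; apply: ler_wpM2l; first exact: nrm_ge0.
  by rewrite (invfM r (cabs _)) (invfM r (r / 2)); apply: ler_wpM2l => //; rewrite invr_ge0 ltW.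
have i3 : cabs w ^+ 2 / (r ^+ 2 * cabs (z + w)) * nrm (g z)
    <= cabs w ^+ 2 * (nrm (g z) / (r ^+ 2 * (r / 2))).
  rewrite -mulrA; apply: ler_wpM2l; first exact: sqr_ge0.
  rewrite mulrC; apply: ler_wpM2l; first exact: nrm_ge0.
  by rewrite (invfM _ (cabs _)) (invfM _ (r / 2)); apply: ler_wpM2l => //; rewrite invr_ge0 exprn_ge0 // ltW.
have i4 : cabs w * (cabs w * K) <= cabs w * (e / 2).
  by rewrite ler_wpM2l // -ler_pdivlMr // ltW.
have i5 : cabs w * (cabs w * K) = cabs w ^+ 2 * (nrm d / (r * (r / 2))) +
   cabs w ^+ 2 * (nrm (g z) / (r ^+ 2 * (r / 2))) + cabs w ^+ 2.
  by rewrite /K; ring.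
by have := sqr_ge0 (cabs w); lra.
Qed.

Lemma cdiff_comp_affine g a k z d :
  cdiff g (a + k * z) d -> cdiff (fun w => g (a + k * w)) z (k *: d).
Proof.
move=> gd e e0; pose K := cabs k + 1.
have K0 : 0 < K by rewrite ltr_wpDl ?cabs_ge0.
have [|d1 d10 h1] := gd (e / K); first by rewrite divr_gt0.
exists (d1 / K); first by rewrite divr_gt0.
move=> w; rewrite ltr_pdivlMr // => wd.
have kw : cabs (k * w) <= cabs w * K.
  by rewrite cabsM mulrC ler_wpM2l ?cabs_ge0 // lerDl.
have := h1 (k * w) (le_lt_trans kw wd).
rewrite mulrDr addrA scalerA [w * k]mulrC => h; apply: le_trans h _.
by rewrite -mulrA ler_wpM2l ?(ltW e0) // ler_pdivrMl // [K * _]mulrC.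
Qed.

Lemma cdiff_subc g (c : Y) z d : cdiff g z d -> cdiff (fun w => g w - c) z d.
Proof.
move=> gd e e0; have [d1 d10 h1] := gd e e0; exists d1 => // w /h1.
by rewrite opprB addrA subrK.
Qed.

Lemma cdiff_lin g g' (k : C) z d d' : cdiff g z d -> cdiff g' z d' ->
  cdiff (fun w => k *: (g w - g' w)) z (k *: (d - d')).
Proof.
move=> gd gd' e e0; pose K := cabs k + 1.
have K0 : 0 < K by rewrite ltr_wpDl ?cabs_ge0.
have e1 : 0 < e / 2 / K by rewrite !divr_gt0.
have [d1 d10 h1] := gd _ e1; have [d2 d20 h2] := gd' _ e1.
exists (Num.min d1 d2); first by rewrite lt_min d10.
move=> w; rewrite lt_min => /andP[w1 w2].
have -> : k *: (g (z + w) - g' (z + w)) - k *: (g z - g' z) - w *: (k *: (d - d')) =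
   k *: ((g (z + w) - g z - w *: d) - (g' (z + w) - g' z - w *: d')).
  rewrite scalerA mulrC -scalerA -!scalerBr; congr (_ *: _).
  by rewrite scalerBr [RHS]subrACA; congr (_ - _); rewrite subrACA.
rewrite nrmZ; apply: le_trans (ler_wpM2l (cabs_ge0 k) (nrmD _ _)) _; rewrite nrmN.
have := lerD (h1 w w1) (h2 w w2) => i1.
apply: le_trans (ler_wpM2l (cabs_ge0 k) i1) _.
apply: le_trans (_ : K * (e / 2 / K * cabs w + e / 2 / K * cabs w) <= _).
  apply: ler_wpM2r; last by rewrite lerDl.
  by rewrite addr_ge0 // mulr_ge0 ?cabs_ge0 // ltW.
have -> // : K * (e / 2 / K * cabs w + e / 2 / K * cabs w) = e * cabs w.
by field; rewrite gt_eqF.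
Qed.

End ComplexVariable.

(** * Cauchy estimates *)

Section CauchyEstimates.
Variable R : realType.
Local Notation C := R[i].
Variable Y : normedModType C.
Implicit Types (g : C -> Y) (z w : C) (d : Y).

Definition holo g (r : R) : Prop := forall z, cabs z < r -> exists d, cdiff g z d.

(** In logarithmic coordinates the mean of (g z - g 0)/z over a circle does not depend on the
    radius. On small circles it is close to d, on the circle of radius r/2 it is at most 2M / (r/2).
    A single level of the sums suffices, because both estimates hold for every Riemann sum. *)
Lemma cauchy_at0 g r M d : 0 < r -> holo g r ->
  (forall z, cabs z < r -> nrm (g z) <= M) -> cdiff g 0 d -> nrm d <= 4 * M / r.
Proof.
move=> r0 hg gM gd; apply/ler_addgt0Pr => e' e'0.
pose e := e' / 2; have e0 : 0 < e by rewrite divr_gt0.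
have [dl dl0 hdl] := gd e e0.
have r2 : 0 < r / 2 by rewrite divr_gt0.
have dl2 : 0 < dl / 2 by rewrite divr_gt0.
pose s1 := ln (r / 2); pose s0 := Num.min s1 (ln (dl / 2)).
have es1 : expR s1 = r / 2 by rewrite lnK.
have es0 : expR s0 < dl.
  have : expR s0 <= dl / 2 by rewrite -[dl / 2]lnK // ler_expR ge_min lexx orbT.
  by lra.
pose k (z : C) := z^-1 *: (g z - g 0); pose h x y := k (polar x y).
pose q : R := pi *+ 2; have q0 : 0 < q by rewrite mulrn_wgt0 // pi_gt0.
have p0 : 0 <= s1 - s0 by rewrite subr_ge0 ge_min lexx.
have hd x y : s0 <= x -> x <= s0 + (s1 - s0) -> 0 <= y -> y <= 0 + q ->
    exists d, cdiff2 h x y d.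
  rewrite subrKC => _ xs1 _ _.
  have cz : cabs (polar x y) < r.
    by rewrite cabs_polar; apply: le_lt_trans (_ : r / 2 < _); [rewrite -es1 ler_expR|lra].
  have [d1 /(cdiff_subc (g 0)) h1] := hg _ cz.
  have [d2 h2] := cdiff_divz (polar_neq0 x y) h1.
  by eexists; exact: cdiff_polar h2.
have [N hN] := goursat p0 (ltW q0) hd (mulr_gt0 q0 e0).
have := hN N (leqnn N); rewrite /contour subrKC add0r.
(* The sides at angles 0 and 2 pi carry the same values and cancel; only the two circles remain. *)
have -> : hsum h N s0 q (s1 - s0) = hsum h N s0 0 (s1 - s0).
  by rewrite /hsum; congr (_ *: _); apply: eq_bigr => j _; rewrite /h polar2pi.
rewrite subrr add0r nrmZ cabs_i mul1r.
set V1 := vsum _ _ _ _ _; set V0 := vsum _ _ _ _ _ => b01.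
have b0 : nrm (V0 - rC q *: d) <= q * e.
  apply: pow2_average => [|j]; first exact: ltW.
  rewrite /h /k; set z := polar _ _.
  have z0 : z != 0 by exact: polar_neq0.
  have zd : cabs z < dl by rewrite cabs_polar.
  have -> : z^-1 *: (g z - g 0) - d = z^-1 *: (g (0 + z) - g 0 - z *: d).
    by rewrite add0r [RHS]scalerBr scalerA mulVf // scale1r.
  rewrite nrmZ cabsV ler_pdivrMl ?cabs_gt0 // mulrC; exact: hdl.
have M0 : 0 <= M by apply: le_trans (nrm_ge0 (g 0)) (gM 0 _); rewrite cabs0.
have b1 : nrm (V1 - rC q *: 0) <= q * (4 * M / r).
  apply: pow2_average => [|j]; first exact: ltW.
  rewrite subr0 /h /k; set z := polar _ _.
  have cz : cabs z = r / 2 by rewrite cabs_polar.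
  rewrite nrmZ cabsV cz.
  have : nrm (g z - g 0) <= M + M.
    by rewrite (le_trans (nrmD _ _)) // nrmN lerD // gM ?cz ?cabs0 //; lra.
  have -> : 4 * M / r = (r / 2)^-1 * (M + M) by field; rewrite gt_eqF.
  by apply: ler_wpM2l; rewrite invr_ge0 ltW.
have : q * nrm d <= q * (4 * M / r + e').
  have -> : q * nrm d = nrm (rC q *: d) by rewrite nrmZR gtr0_norm.
  move: b1; rewrite scaler0 subr0 => b1.
  have := nrm_mid V0 0 (rC q *: d); rewrite !sub0r !nrmN => i1.
  have := nrm_le_add V0 V1; rewrite nrmB => i2.
  have : q * e' = q * e + q * e by rewrite -mulrDr /e -splitr.
  by rewrite mulrDr; lra.
by rewrite ler_pM2l.
Qed.

Lemma holo_shift g r r' a : holo g r -> cabs a + r' <= r -> holo (fun w => g (a + w)) r'.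
Proof.
move=> hg ar z zr'; have [|d gd] := hg (a + z).
  by apply: le_lt_trans (cabsD _ _) _; lra.
exists d; have := @cdiff_comp_affine R Y g a 1 z d.
rewrite mul1r scale1r => /(_ gd).
by under [X in cdiff X]eq_fun do rewrite mul1r.
Qed.

Lemma cauchy_deriv g r M z d : 0 < r -> holo g r ->
  (forall z, cabs z < r -> nrm (g z) <= M) ->
  cabs z < r / 2 -> cdiff g z d -> nrm d <= 8 * M / r.
Proof.
move=> r0 hg gM zr gd.
have -> : 8 * M / r = 4 * M / (r / 2) by field; rewrite gt_eqF.
apply: (@cauchy_at0 (fun w => g (z + w))); first by lra.
- by apply: holo_shift hg _; lra.
- by move=> w wr; apply: gM; apply: le_lt_trans (cabsD _ _) _; lra.
- have := @cdiff_comp_affine R Y g z 1 0 d.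
  rewrite mulr0 addr0 scale1r => /(_ gd).
  by under [X in cdiff X]eq_fun do rewrite mul1r.
Qed.

Lemma cdiff_continuous g z d : cdiff g z d -> forall e : R, 0 < e ->
  exists2 dl : R, 0 < dl & forall w, cabs w < dl -> nrm (g (z + w) - g z) <= e.
Proof.
move=> gd e e0; have [d1 d10 h1] := gd 1 ltr01.
pose K := 1 + nrm d; have K0 : 0 < K by rewrite ltr_pwDl ?nrm_ge0.
exists (Num.min d1 (e / K)); first by rewrite lt_min d10 divr_gt0.
move=> w; rewrite lt_min ltr_pdivlMr // => /andP[w1 w2].
apply: le_trans (nrm_le_add _ (w *: d)) _; rewrite nrmZ.
have := h1 w w1; move: w2; rewrite /K mulrDr; lra.
Qed.

Lemma segment_mean_value g a b K :
  (forall t, 0 <= t -> t <= 1 -> exists2 d, cdiff g (a + rC t * (b - a)) d & nrm d <= K) ->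
  nrm (g b - g a) <= K * cabs (b - a).
Proof.
move=> hg; pose D t := if pselect (exists2 d, cdiff g (a + rC t * (b - a)) d & nrm d <= K)
  is left h then s2val (cid2 h) else 0.
have hD t : 0 <= t -> t <= 1 -> cdiff g (a + rC t * (b - a)) (D t) /\ nrm (D t) <= K.
  move=> t0 t1; rewrite /D; case: pselect => [h|[]]; last exact: hg.
  by case: cid2.
pose u t := g (a + rC t * (b - a)); pose w := b - a.
have small (d1 : R) : 0 < d1 -> exists2 d2, 0 < d2 &
    forall h, 0 < h -> h < d2 -> cabs (rC h * w) < d1.
  move=> d10; pose W := cabs w + 1; have W0 : 0 < W by rewrite ltr_wpDl ?cabs_ge0.
  exists (d1 / W); first by rewrite divr_gt0.
  move=> h h0; rewrite ltr_pdivlMr // => hd; apply: le_lt_trans hd.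
  by rewrite cabsM cabsR gtr0_norm // ler_wpM2l ?(ltW h0) // lerDl.
have := @rder_mean_value R Y u (fun t => w *: D t) (fun t => K * cabs w * t)
   (fun=> K * cabs w) 0 1 ler01.
rewrite mulr0 subr0 mulr1 /u rC0 rC1 mul0r addr0 mul1r subrKC; apply.
- by move=> t; apply: is_derive_eq; rewrite /GRing.scale /= mulr1.
- move=> t t0 t1 e e0; have [gd _] := hD t t0 (ltW t1).
  pose W := cabs w + 1; have W0 : 0 < W by rewrite ltr_wpDl ?cabs_ge0.
  have [|d1 d10 h1] := gd (e / W); first by rewrite divr_gt0.
  have [d2 d20 h2] := small d1 d10; exists d2 => // h h0 hd.
  have := h1 _ (h2 h h0 hd); rewrite -(addrA a) /w -mulrDl -rCD => i1.
  rewrite scalerA; apply: le_trans i1 _; rewrite -/w cabsM cabsR gtr0_norm // mulrCA [e * h]mulrC.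
  apply: ler_wpM2l; first exact: ltW.
  by rewrite mulrAC ler_pdivrMr // ler_wpM2l ?(ltW e0) // lerDl.
- move=> t t0 t1 e e0; have [gd _] := hD t (ltW t0) t1.
  have [d1 d10 h1] := cdiff_continuous gd e0.
  have [d2 d20 h2] := small d1 d10; exists d2 => // h h0 hd.
  have := h1 (- (rC h * w)); rewrite cabsN => /(_ (h2 h h0 hd)).
  by rewrite -addrA /w -mulrBl -rCB.
- move=> t t0 t1; rewrite nrmZ mulrC ler_wpM2r ?cabs_ge0 //.
  by have [] := hD t t0 (ltW t1).
Qed.

Lemma cabs_segment a b (t r : R) : 0 <= t -> t <= 1 -> cabs a < r -> cabs b < r ->
  cabs (a + rC t * (b - a)) < r.
Proof.
move=> t0 t1 ar br.
have -> : a + rC t * (b - a) = rC (1 - t) * a + rC t * b by rewrite rCB rC1; ring.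
apply: le_lt_trans (cabsD _ _) _; rewrite !cabsM !cabsR !ger0_norm ?subr_ge0 //.
have [->|tn] := eqVneq t 0; first by rewrite subr0 mul1r mul0r addr0.
have tp : 0 < t by rewrite lt_neqAle eq_sym tn.
have i1 : t * cabs b < t * r by rewrite ltr_pM2l.
have i2 : (1 - t) * cabs a <= (1 - t) * r by rewrite ler_wpM2l ?subr_ge0 // ltW.
by move: i1 i2; rewrite !mulrBl !mul1r; lra.
Qed.

Lemma cauchy_lipschitz g r M a b : 0 < r -> holo g r ->
  (forall z, cabs z < r -> nrm (g z) <= M) ->
  cabs a < r / 2 -> cabs b < r / 2 -> nrm (g b - g a) <= 8 * M / r * cabs (b - a).
Proof.
move=> r0 hg gM ar br; apply: segment_mean_value => t t0 t1.
have cz := cabs_segment t0 t1 ar br.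
have [|d gd] := hg (a + rC t * (b - a)); first by lra.
by exists d => //; exact: cauchy_deriv gd.
Qed.

(* The difference quotients (g(z+h) - g z)/h are holomorphic in z and bounded by the
   Lipschitz estimate, so the Lipschitz estimate applies to them in turn. *)
Lemma cauchy_deriv_lipschitz g r M d z dz : 0 < r -> holo g r ->
  (forall z, cabs z < r -> nrm (g z) <= M) -> cdiff g 0 d ->
  cabs z < r / 8 -> cdiff g z dz -> nrm (dz - d) <= 256 * M / r ^+ 2 * cabs z.
Proof.
move=> r0 hg gM gd zr gdz; apply/ler_addgt0Pr => e e0.
have e2 : 0 < e / 2 by rewrite divr_gt0.
have [d1 d10 h1] := gd _ e2; have [d2 d20 h2] := gdz _ e2.
pose m := Num.min (Num.min d1 d2) (r / 4).
have m0 : 0 < m by rewrite !lt_min d10 d20 divr_gt0.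
have : m / 2 < m by lra.
rewrite {2}/m !lt_min => /andP[/andP[m1 m2] m4].
pose h := rC (m / 2); have ch : cabs h = m / 2 by rewrite cabsR gtr0_norm ?divr_gt0.
have h0 : h != 0 by rewrite -cabs_gt0 ch divr_gt0.
pose Dh w := h^-1 *: (g (h + w) - g w).
have r4 : 0 < r / 4 by rewrite divr_gt0.
have hDh : holo Dh (r / 4).
  move=> w wr; have [|e1 he1] := hg w; first by lra.
  have hs : holo (fun w => g (h + w)) (r / 4) by apply: holo_shift hg _; rewrite ch; lra.
  by have [e3 he3] := hs w wr; eexists; exact: cdiff_lin he3 he1.
have bDh w : cabs w < r / 4 -> nrm (Dh w) <= 8 * M / r.
  move=> wr; rewrite nrmZ cabsV ler_pdivrMl; last by rewrite ch divr_gt0.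
  have := @cauchy_lipschitz g r M w (h + w) r0 hg gM; rewrite addrK => i1.
  rewrite mulrC; apply: i1; first by lra.
  by apply: le_lt_trans (cabsD _ _) _; rewrite ch; lra.
have close w dw : (nrm (g (w + h) - g w - h *: dw) <= e / 2 * cabs h) ->
   nrm (Dh w - dw) <= e / 2.
  move=> i1; have -> : Dh w - dw = h^-1 *: (g (w + h) - g w - h *: dw).
    by rewrite scalerBr scalerA mulVf // scale1r addrC /Dh [h + w]addrC addrC.
  by rewrite nrmZ cabsV ler_pdivrMl 1?mulrC // ch divr_gt0.
have c1 : nrm (Dh 0 - d) <= e / 2 by apply: close; apply: h1; rewrite ch.
have c2 : nrm (Dh z - dz) <= e / 2 by apply: close; apply: h2; rewrite ch.
have c3 : nrm (Dh z - Dh 0) <= 256 * M / r ^+ 2 * cabs z.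
  have -> : 256 * M / r ^+ 2 * cabs z = 8 * (8 * M / r) / (r / 4) * cabs (z - 0).
    by rewrite subr0; field; rewrite gt_eqF.
  by apply: (cauchy_lipschitz r4 hDh bDh); rewrite ?cabs0; lra.
apply: le_trans (nrm_mid (Dh z) _ _) _; rewrite [nrm (dz - _)]nrmB.
have := nrm_mid (Dh 0) (Dh z) d; lra.
Qed.

(** The mean value inequality for g w - w d, whose derivative is small by
    [cauchy_deriv_lipschitz]. *)
Lemma cauchy_taylor1 g r M d z : 0 < r -> holo g r ->
  (forall z, cabs z < r -> nrm (g z) <= M) -> cdiff g 0 d -> cabs z < r / 8 ->
  nrm (g z - g 0 - z *: d) <= 256 * M / r ^+ 2 * cabs z ^+ 2.
Proof.
move=> r0 hg gM gd zr.
have M0 : 0 <= M by apply: le_trans (nrm_ge0 (g 0)) (gM 0 _); rewrite cabs0.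
have K0 : 0 <= 256 * M / r ^+ 2 by rewrite divr_ge0 ?sqr_ge0 // mulr_ge0.
pose G w := g w - w *: d.
have -> : g z - g 0 - z *: d = G z - G 0 by rewrite /G scale0r subr0 addrAC.
have -> : 256 * M / r ^+ 2 * cabs z ^+ 2 = 256 * M / r ^+ 2 * cabs z * cabs (z - 0).
  by rewrite subr0 expr2 mulrA.
apply: segment_mean_value => t t0 t1; rewrite add0r subr0.
have ct : cabs (rC t * z) <= cabs z.
  by rewrite cabsM cabsR ger0_norm // ler_piMl // cabs_ge0.
have [|dt gdt] := hg (rC t * z); first by lra.
exists (dt - d).
  move=> e e0; have [d1 d10 h1] := gdt e e0; exists d1 => // w /h1.
  rewrite /G scalerDl scalerBr.
  rewrite (subrACA (g (rC t * z + w))) [(rC t * z) *: d + _]addrC addrK.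
  by rewrite (subrACA _ (w *: d)) subrr subr0.
apply: le_trans (cauchy_deriv_lipschitz r0 hg gM gd _ gdt) _; first by lra.
by rewrite ler_wpM2l.
Qed.

(** Dividing by z lowers the order by one and keeps the function holomorphic. The constants depend
    on k, r and M only, so they serve all slices of a map on a Banach space at once. *)
Lemma cauchy_order (k : nat) (r M : R) : 0 < r -> exists C0 rho : R, [/\ 0 <= C0, 0 < rho &
  forall g, holo g r -> (forall z, cabs z < r -> nrm (g z) <= M) -> g 0 = 0 ->
   (forall e : R, 0 < e -> exists2 dl : R, 0 < dl & forall z, cabs z < dl ->
       nrm (g z) <= e * cabs z ^+ k) ->
   forall z, cabs z < rho -> nrm (g z) <= C0 * cabs z ^+ k.+1].
Proof.
elim: k r M => [|k IH] r M r0.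
  exists (8 * `|M| / r), (r / 2); split; first by rewrite divr_ge0 ?mulr_ge0 // ltW.
    by rewrite divr_gt0.
  move=> g hg gM g0 _ z zr; rewrite expr1.
  have M0 : 0 <= M by apply: le_trans (nrm_ge0 (g 0)) (gM 0 _); rewrite cabs0.
  have := @cauchy_lipschitz g r M 0 z r0 hg gM; rewrite g0 !subr0 ger0_norm //.
  by apply; rewrite ?cabs0 // divr_gt0.
(* The case k = 1 stands apart: if g = o(|z|), then g/z tends to 0 at the origin but is not yet
   known to be differentiable there. Instead g'(0) = 0 enters the Taylor bound. *)
case: k IH => [_|k IH].
  exists (256 * `|M| / r ^+ 2), (r / 8); split.
    by rewrite divr_ge0 ?sqr_ge0 ?mulr_ge0.
    by rewrite divr_gt0.
  move=> g hg gM g0 go z zr.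
  have M0 : 0 <= M by apply: le_trans (nrm_ge0 (g 0)) (gM 0 _); rewrite cabs0.
  have gd : cdiff g 0 0.
    move=> e /go[dl dl0 hdl]; exists dl => // w /hdl.
    by rewrite add0r g0 scaler0 !subr0 expr1.
  have := cauchy_taylor1 r0 hg gM gd zr; rewrite g0 scaler0 !subr0 ger0_norm //.
have r2 : 0 < r / 2 by rewrite divr_gt0.
have [C0 [rho [C00 rho0 H]]] := IH (r / 2) (8 * M / r) r2.
exists C0, (Num.min rho (r / 2)); split=> //; first by rewrite lt_min rho0.
move=> g hg gM g0 go z; rewrite lt_min => /andP[zrho zr].
pose g1 (w : C) := w^-1 *: g w.
have g1o (e : R) : 0 < e -> exists2 dl : R, 0 < dl & forall z, cabs z < dl ->
       nrm (g1 z) <= e * cabs z ^+ k.+1.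
  move=> /[dup] e0 /go[dl dl0 hdl]; exists dl => // w wd; rewrite nrmZ cabsV.
  have [->|w0] := eqVneq w 0.
    by rewrite g0 nrm0 mulr0 mulr_ge0 ?exprn_ge0 ?cabs_ge0 // ltW.
  by rewrite ler_pdivrMl ?cabs_gt0 // mulrCA -exprS; exact: hdl.
have g10 : g1 0 = 0 by rewrite /g1 g0 scaler0.
have hg1 : holo g1 (r / 2).
  move=> w wr; have [->|w0] := eqVneq w 0.
    exists 0 => e e0; have [dl dl0 hdl] := g1o e e0; exists (Num.min dl 1); first by rewrite lt_min dl0 ltr01.
    move=> v; rewrite lt_min => /andP[v1 v2].
    rewrite add0r g10 scaler0 !subr0; apply: le_trans (hdl v v1) _.
    rewrite ler_wpM2l ?(ltW e0) // exprS ler_piMr ?cabs_ge0 // exprn_ile1 ?cabs_ge0 //.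
    exact: ltW.
  have [|d gd] := hg w; first by lra.
  exact: cdiff_divz w0 gd.
have bg1 w : cabs w < r / 2 -> nrm (g1 w) <= 8 * M / r.
  move=> wr; rewrite nrmZ cabsV.
  have := @cauchy_lipschitz g r M 0 w r0 hg gM; rewrite g0 !subr0 cabs0 => /(_ r2 wr) i1.
  have [w0|w0] := eqVneq w 0.
    have M0 : 0 <= M by apply: le_trans (nrm_ge0 (g 0)) (gM 0 _); rewrite cabs0.
    by rewrite w0 g0 nrm0 mulr0 divr_ge0 ?mulr_ge0 // ltW.
  by rewrite ler_pdivrMl ?cabs_gt0 // mulrC.
have := H g1 hg1 bg1 g10 g1o z zrho.
have [->|z0] := eqVneq z 0.
  by rewrite g0 nrm0 => _; rewrite mulr_ge0 ?exprn_ge0 ?cabs_ge0.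
by rewrite nrmZ cabsV ler_pdivrMl ?cabs_gt0 // mulrCA -exprS.
Qed.

End CauchyEstimates.

(** * Holomorphic maps between Banach spaces *)

Section BanachSpaces.
Variable R : realType.
Local Notation C := R[i].

Section Slices.
Variables X Y : completeNormedModType C.
Implicit Types (g : X -> Y) (x y v : X).

Lemma slice_cdiff g x v (z : C) : differentiable g (x + z *: v) ->
  cdiff (fun w => g (x + w *: v)) z ('d g (x + z *: v) v).
Proof.
move=> /differentiable_nrm[_ hd] e e0.
pose V := nrm v + 1; have V0 : 0 < V by rewrite ltr_wpDl ?nrm_ge0.
have [|d d0 hdd] := hd (e / V); first by rewrite divr_gt0.
exists (d / V); first by rewrite divr_gt0.
move=> w; rewrite ltr_pdivlMr // => wd.
have wv : nrm (w *: v) <= cabs w * V by rewrite nrmZ ler_wpM2l ?cabs_ge0 // lerDl.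
have := hdd _ (le_lt_trans wv wd); rewrite linearZ scalerDl addrA => i1.
apply: le_trans i1 _; apply: le_trans (ler_wpM2l _ wv) _; first by rewrite divr_ge0 // ltW.
by rewrite [cabs w * V]mulrC mulrA divfK // gt_eqF.
Qed.

Lemma unit_slice x y : x != y -> exists2 v, nrm v = 1 & y = x + rC (nrm (y - x)) *: v.
Proof.
move=> xy; have n0 : 0 < nrm (y - x) by rewrite nrm_gt0 subr_eq0 eq_sym.
exists (rC (nrm (y - x))^-1 *: (y - x)).
  by rewrite nrmZR gtr0_norm ?invr_gt0 // mulVf // gt_eqF.
by rewrite scalerA -rCM mulfV ?gt_eqF // scale1r subrKC.
Qed.

Definition hol_bounded g x (r M : R) : Prop :=
  forall y, nrm (y - x) < r -> differentiable g y /\ nrm (g y) <= M.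

(** Estimates on a Banach space are read on complex lines: in a unit direction the disc of radius r
    maps into the ball of radius r, so no constant depends on the direction. *)
Lemma slice_holo g x r M v : hol_bounded g x r M -> nrm v = 1 ->
  holo (fun w => g (x + w *: v)) r /\
  (forall z, cabs z < r -> nrm (g (x + z *: v)) <= M).
Proof.
move=> hg v1; split=> z zr; have [|gd gM] := hg (x + z *: v).
- by rewrite addrC addKr nrmZ v1 mulr1.
- by exists ('d g (x + z *: v) v); exact: slice_cdiff.
- by rewrite addrC addKr nrmZ v1 mulr1.
- by [].
Qed.

Lemma lipschitz_ball g x r M y : 0 < r -> hol_bounded g x r M ->
  nrm (y - x) < r / 2 -> nrm (g y - g x) <= 8 * M / r * nrm (y - x).
Proof.
move=> r0 hg yr; have [->|xy] := eqVneq x y; first by rewrite !subrr !nrm0 mulr0.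
have [v v1 yE] := unit_slice xy; have [h1 h2] := slice_holo hg v1.
have := @cauchy_lipschitz _ _ _ r M 0 (rC (nrm (y - x))) r0 h1 h2.
rewrite scale0r addr0 -yE subr0 cabsR ger0_norm ?nrm_ge0 //.
by apply; rewrite ?cabs0 // divr_gt0.
Qed.

Lemma taylor_ball g x r M y : 0 < r -> hol_bounded g x r M ->
  nrm (y - x) < r / 8 ->
  nrm (g y - g x - 'd g x (y - x)) <= 256 * M / r ^+ 2 * nrm (y - x) ^+ 2.
Proof.
move=> r0 hg yr; have [->|xy] := eqVneq x y.
  by rewrite !subrr linear0 subr0 !nrm0 expr0n mulr0.
have [v v1 yE] := unit_slice xy; have [h1 h2] := slice_holo hg v1.
have := @slice_cdiff g x v 0; rewrite scale0r addr0 => gd.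
have [|gx _] := hg x; first by rewrite subrr nrm0.
have := @cauchy_taylor1 _ _ _ r M _ (rC (nrm (y - x))) r0 h1 h2 (gd gx).
rewrite scale0r addr0 -yE cabsR ger0_norm ?nrm_ge0 //.
have yv : y - x = rC (nrm (y - x)) *: v by rewrite {1}yE [x + _]addrC addrK.
have -> : 'd g x (y - x) = rC (nrm (y - x)) *: 'd g x v by rewrite {1}yv linearZ.
by apply.
Qed.

Lemma deriv_ball g x r M h : 0 < r -> hol_bounded g x r M ->
  nrm ('d g x h) <= 4 * M / r * nrm h.
Proof.
move=> r0 hg; have [->|h0] := eqVneq h 0; first by rewrite linear0 !nrm0 mulr0.
have [|v v1] := @unit_slice 0 h; first by rewrite eq_sym.
rewrite subr0 add0r => hE; have [h1 h2] := slice_holo hg v1.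
have := @slice_cdiff g x v 0; rewrite scale0r addr0 => gd.
have [|gx _] := hg x; first by rewrite subrr nrm0.
have := cauchy_at0 r0 h1 h2 (gd gx).
rewrite {1}hE linearZ nrmZR ger0_norm ?nrm_ge0 // => i1.
by rewrite mulrC ler_wpM2r ?nrm_ge0.
Qed.

Lemma order_ball (k : nat) (r M : R) : 0 < r -> exists C0 rho : R, [/\ 0 <= C0, 0 < rho &
  forall g x, hol_bounded g x r M -> g x = 0 ->
   (forall e : R, 0 < e -> exists2 dl : R, 0 < dl & forall y, nrm (y - x) < dl ->
       nrm (g y) <= e * nrm (y - x) ^+ k) ->
   forall y, nrm (y - x) < rho -> nrm (g y) <= C0 * nrm (y - x) ^+ k.+1].
Proof.
move=> r0; have [C0 [rho [C00 rho0 H]]] := @cauchy_order R Y k r M r0.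
exists C0, rho; split=> // g x hg gx go y yr.
have [<-|xy] := eqVneq x y.
  by rewrite gx nrm0 mulr_ge0 // exprn_ge0 // nrm_ge0.
have [v v1 yE] := unit_slice xy; have [h1 h2] := slice_holo hg v1.
have := H _ h1 h2; rewrite scale0r addr0 gx => /(_ erefl) H1.
have := H1 _ (rC (nrm (y - x))); rewrite -yE cabsR ger0_norm ?nrm_ge0 //.
apply=> // e /go[dl dl0 hdl]; exists dl => // z zd.
have := hdl (x + z *: v); rewrite [x + _]addrC addrK nrmZ v1 mulr1 [_ + x]addrC; exact.
Qed.

(** Pointwise convergence and a common bound suffice. The Taylor bound is uniform in n, so the
    differentials stay close to converging difference quotients and converge too; the limit inherits
    linearity, the bound 4M/r and the Taylor estimate. *)
Lemma weierstrass (gn : nat -> X -> Y) (G : X -> Y) x r M : 0 < r ->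
  (forall n, hol_bounded (gn n) x r M) ->
  (forall y, nrm (y - x) < r -> (fun n => gn n y) @ \oo --> G y) ->
  differentiable G x.
Proof.
move=> r0 hg hG; have M0 : 0 <= M.
  by have [|_] := hg 0%N x; [rewrite subrr nrm0|exact/le_trans/nrm_ge0].
pose K := 256 * M / r ^+ 2; have K0 : 0 <= K by rewrite divr_ge0 ?sqr_ge0 ?mulr_ge0.
pose D n := 'd (gn n) x : X -> Y.
have Gx : (fun n => gn n x) @ \oo --> G x by apply: hG; rewrite subrr nrm0.
have tay n h : nrm h < r / 8 -> nrm (gn n (x + h) - gn n x - D n h) <= K * nrm h ^+ 2.
  move=> hr; have := @taylor_ball (gn n) x r M (x + h) r0 (hg n).
  by rewrite [x + h]addrC addrK; apply.
have Dc h : exists l : Y, (fun n => D n h) @ \oo --> l.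
  apply: cauchy_cvg_nrm => e e0.
  pose q := nrm h + 1; have q0 : 0 < q by rewrite ltr_wpDl ?nrm_ge0.
  have hq : nrm h <= q by rewrite lerDl.
  (* The first bound keeps t h in the range of the Taylor estimate, the second makes the Taylor
     error, after division by t, at most e/2. This t is fixed before n. *)
  pose t := Num.min (r / 8 / q / 2) (e / 2 / (K + 1) / q ^+ 2).
  have K10 : 0 < K + 1 by lra.
  have t0 : 0 < t by rewrite lt_min !divr_gt0 // exprn_gt0.
  have t1 : t * q <= r / 8 / 2.
    by rewrite -ler_pdivlMr // mulrAC ge_min lexx.
  have t2 : t * ((K + 1) * q ^+ 2) <= e / 2.
    by rewrite mulrCA -ler_pdivlMl // -ler_pdivlMr ?exprn_gt0 // [_^-1 * _]mulrC ge_min lexx orbT.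
  pose k := rC t *: h.
  have nk : nrm k = t * nrm h by rewrite nrmZR gtr0_norm.
  have kr : nrm k < r / 8.
    rewrite nk; apply: le_lt_trans (_ : t * q < _); first by rewrite ler_wpM2l // ltW.
    by apply: le_lt_trans t1 _; lra.
  have Gk : (fun n => gn n (x + k)) @ \oo --> G (x + k).
    by apply: hG; rewrite [x + k]addrC addrK; lra.
  have e4 : 0 < t * (e / 4) by rewrite mulr_gt0 // divr_gt0.
  move/cvg_nrm_seqP: Gk => /(_ _ e4)[N1 h1]; move/cvg_nrm_seqP: (Gx) => /(_ _ e4)[N2 h2].
  exists (rC t^-1 *: (G (x + k) - G x)); exists (maxn N1 N2) => // n /=.
  rewrite geq_max => /andP[n1 n2].
  have -> : D n h = rC t^-1 *: D n k.
    by rewrite /D /k linearZ scalerA -rCM mulVf ?gt_eqF // scale1r.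
  rewrite -scalerBr nrmZR gtr0_norm ?invr_gt0 // ltr_pdivrMl //.
  have i3 := tay n k kr.
  have i4 : K * nrm k ^+ 2 <= t * (e / 2).
    rewrite nk (_ : K * (t * nrm h) ^+ 2 = t * (t * (K * nrm h ^+ 2))); last by ring.
    apply: ler_wpM2l; first exact: ltW.
    apply: le_trans t2; apply: ler_wpM2l; first exact: ltW.
    by apply: ler_pM; rewrite ?exprn_ge0 ?nrm_ge0 ?lerDl // lerXn2r ?nnegrE ?nrm_ge0 // ltW.
  have := nrm_mid (gn n (x + k) - gn n x) (D n k) (G (x + k) - G x).
  rewrite [nrm (D n k - (gn n (x + k) - _))]nrmB (_ : gn n (x + k) - gn n x - (G (x + k) - G x) =
     (gn n (x + k) - G (x + k)) - (gn n x - G x)); last by rewrite subrACA.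
  have := nrmD (gn n (x + k) - G (x + k)) (- (gn n x - G x)); rewrite nrmN.
  have := h1 n n1; have := h2 n n2.
  have -> : t * e = t * (e / 2) + (t * (e / 4) + t * (e / 4)) by field.
  by lra.
have [L hL] := choice Dc.
apply: (@nrm_differentiable_fun _ _ _ G x L (4 * M / r)).
- move=> k u v; apply: cvg_nrm_unique (hL (k *: u + v)) _.
  have -> : (fun n => D n (k *: u + v)) = (fun n => k *: D n u + D n v).
    by apply/funext => n; rewrite /D linearP.
  by apply: cvgD; [apply: cvgZr|]; apply: hL.
- by move=> h; apply: nrm_lim_le (hL h) _ => n; apply: deriv_ball.
- move=> e e0; pose d := Num.min (r / 8) (e / (K + 1)).
  have K10 : 0 < K + 1 by lra.
  exists d; first by rewrite lt_min !divr_gt0.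
  move=> h; rewrite lt_min => /andP[h1]; rewrite ltr_pdivlMr // => h2.
  have : (fun n => gn n (x + h) - gn n x - D n h) @ \oo --> G (x + h) - G x - L h.
    apply: cvgB (hL h); apply: cvgB Gx; apply: hG.
    by rewrite [x + h]addrC addrK; lra.
  move=> /(nrm_lim_le (K := K * nrm h ^+ 2)) /(_ (fun n => tay n h h1)) i1; apply: le_trans i1 _.
  rewrite expr2 mulrA; apply: ler_wpM2r; first exact: nrm_ge0.
  by move: h2 (nrm_ge0 h); rewrite mulrDr; lra.
Qed.

End Slices.

Lemma differentiable_bilinear (X : completeNormedModType C) (Y1 Y2 Z : normedModType C)
    (m : Y1 -> Y2 -> Z) (a : X -> Y1) (b : X -> Y2) (x : X) :
  (forall u, exists c, blin (m u) c) -> (forall v, exists c, blin (m ^~ v) c) ->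
  (forall u v, nrm (m u v) <= nrm u * nrm v) ->
  differentiable a x -> differentiable b x ->
  differentiable (fun y => m (a y) (b y)) x.
Proof.
move=> mr ml mb da db.
have [Ka Ka0 [da1 da10 la]] := differentiable_lip da.
have [Kb Kb0 [db1 db10 lb]] := differentiable_lip db.
have [[Na Na0 bda] ha] := differentiable_nrm da.
have [[Nb Nb0 bdb] hb] := differentiable_nrm db.
have mDr u v w : m u (v + w) = m u v + m u w by have [c /blinD] := mr u.
have mDl u v w : m (u + v) w = m u w + m v w.
  by have [c hc] := ml w; exact: (blinD hc).
have mZr u k w : m u (k *: w) = k *: m u w by have [c /blinZ] := mr u.
have mZl u k w : m (k *: u) w = k *: m u w.
  by have [c hc] := ml w; exact: (blinZ hc).
have mBr u v w : m u (v - w) = m u v - m u w by have [c /blinB] := mr u.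
have mBl u v w : m (u - v) w = m u w - m v w.
  by have [c hc] := ml w; exact: (blinB hc).
apply: (@nrm_differentiable_fun _ _ _ _ x
  (fun h => m ('d a x h) (b x) + m (a x) ('d b x h)) (Na * nrm (b x) + nrm (a x) * Nb)).
- move=> k u v; rewrite !linearP mDl mZl mDr mZr scalerDr.
  by rewrite addrACA.
- move=> h; rewrite (le_trans (nrmD _ _)) // mulrDl; apply: lerD.
    apply: le_trans (mb _ _) _; rewrite mulrAC; apply: ler_wpM2r; [exact: nrm_ge0|exact: bda].
  apply: le_trans (mb _ _) _; rewrite -mulrA; apply: ler_wpM2l; [exact: nrm_ge0|exact: bdb].
- move=> e e0; pose Q := nrm (a x) + nrm (b x) + Ka * Kb + 1.
  have ax := nrm_ge0 (a x); have bx := nrm_ge0 (b x).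
  have kk : 0 < Ka * Kb by rewrite mulr_gt0.
  have Q0 : 0 < Q by rewrite /Q; lra.
  have eQ : 0 < e / Q by rewrite divr_gt0.
  have [d1 d10 h1] := ha _ eQ; have [d2 d20 h2] := hb _ eQ.
  exists (Num.min (Num.min d1 d2) (Num.min (Num.min da1 db1) (e / Q))).
    by rewrite !lt_min d10 d20 da10 db10.
  move=> h; rewrite !lt_min => /andP[/andP[g1 g2] /andP[/andP[g3 g4] g5]].
  (* Two remainders and the product of the two increments, which is quadratic in h. *)
  have -> : m (a (x + h)) (b (x + h)) - m (a x) (b x) -
     (m ('d a x h) (b x) + m (a x) ('d b x h)) =
     m (a (x + h) - a x - 'd a x h) (b x) + (m (a x) (b (x + h) - b x - 'd b x h) +
       m (a (x + h) - a x) (b (x + h) - b x)).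
    rewrite !mBl !mBr; set A := m (a (x + h)) (b (x + h)); set B := m (a x) (b x).
    set P := m ('d a x h) _; set Q' := m _ ('d b x h).
    set S := m (a (x + h)) (b x); set T := m (a x) (b (x + h)).
    rewrite [T - B - Q' + _]addrC [_ - (T - B) + _]addrA subrK.
    by rewrite [RHS]addrC [RHS]addrACA [A - S + _]addrA subrK opprD [- P - Q']addrC.
  have i1 := h1 h g1; have i2 := h2 h g2.
  have := la (x + h); have := lb (x + h); rewrite [x + h]addrC addrK [h + x]addrC.
  move=> /(_ g4) i4 /(_ g3) i3; have h0 := nrm_ge0 h.
  apply: le_trans (nrmD _ _) (le_trans (lerD (lexx _) (nrmD _ _)) _).
  apply: le_trans (lerD (mb _ _) (lerD (mb _ _) (mb _ _))) _.
  have j1 : nrm (a (x + h) - a x - 'd a x h) * nrm (b x) <= e / Q * nrm h * nrm (b x).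
    by rewrite ler_wpM2r.
  have j2 : nrm (a x) * nrm (b (x + h) - b x - 'd b x h) <= nrm (a x) * (e / Q * nrm h).
    by rewrite ler_wpM2l.
  have j3 : nrm (a (x + h) - a x) * nrm (b (x + h) - b x) <= (Ka * nrm h) * (Kb * nrm h).
    by apply: ler_pM; rewrite ?nrm_ge0.
  have j4 : (Ka * nrm h) * (Kb * nrm h) <= e / Q * (Ka * Kb * nrm h).
    rewrite mulrACA mulrA mulrC; apply: ler_wpM2r; last exact: ltW.
    by rewrite mulr_ge0 // ltW.
  have -> : e * nrm h = e / Q * nrm h * nrm (b x) + nrm (a x) * (e / Q * nrm h) +
     e / Q * (Ka * Kb * nrm h) + e / Q * nrm h.
    by rewrite /Q; field; rewrite -/Q gt_eqF.
  have : 0 <= e / Q * nrm h by rewrite mulr_ge0 // ltW.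
  by lra.
Qed.

(** * Exponentials, growth exponents and inverses in the algebra *)

Section BanachAlgebra.
Variables (A : completeNormedModType C) (mul : A -> A -> A) (one : A).
Hypothesis hA : unital_banach_algebra mul one.

Lemma bmulA a b c : mul a (mul b c) = mul (mul a b) c. Proof. by case: hA. Qed.
Lemma bmul1 a : mul one a = a. Proof. by case: hA => _ /(_ a)[]. Qed.
Lemma bmulr1 a : mul a one = a. Proof. by case: hA => _ /(_ a)[]. Qed.
Lemma nrm_bmul a b : nrm (mul a b) <= nrm a * nrm b. Proof. by case: hA => _ _ _ _ []. Qed.
Lemma nrm_one : nrm one = 1. Proof. by case: hA => _ _ _ _ []. Qed.

Lemma blin_mul a : blin (mul a) (nrm a).
Proof.
case: hA => _ _ hD hZ _; split; [|exact: nrm_ge0|exact: nrm_bmul].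
by move=> k u v; rewrite (hD a (k *: u) v).2 (hZ k a u).2.
Qed.

Lemma blin_mulr b : blin (mul^~ b) (nrm b).
Proof.
case: hA => _ _ hD hZ _; split; [|exact: nrm_ge0|].
  by move=> k u v; rewrite (hD (k *: u) v b).1 (hZ k u b).1.
by move=> a; rewrite mulrC nrm_bmul.
Qed.

(** Through left multiplication the results on operator exponentials carry over to the algebra. *)
Lemma aexpE t a : aexp mul one t a = opexp (mul a) t one.
Proof.
rewrite /aexp /opexp (_ : (fun n => _ *: apow mul one (rC t *: a) n) =
  (fun n => (n`!%:R)^-1 *: iter n (fun y => rC t *: mul a y) one)) //.
apply/funext => n; congr (_ *: _); elim: n => [//|n IH] /=.
by rewrite IH (blinZ (blin_mulr _)).
Qed.

Lemma aexp_mul t a y : mul (aexp mul one t a) y = opexp (mul a) t y.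
Proof.
rewrite aexpE; have := @opexp_intertwine _ _ _ _ _ _ _ _ _ t one
  (blin_mul a) (blin_mul a) (blin_mulr y).
by rewrite bmul1; apply => x; rewrite bmulA.
Qed.

Lemma nrm_aexp t a : nrm (aexp mul one t a) <= expR (`|t| * nrm a).
Proof. by rewrite aexpE (le_trans (opexp_le (blin_mul a) _ _)) // nrm_one mulr1. Qed.

Lemma aexpK t a : mul (aexp mul one t a) (aexp mul one (- t) a) = one.
Proof. by rewrite aexp_mul aexpE (opexpK t one (blin_mul a)). Qed.

Lemma aexp_inverse t a :
  is_inverse mul one (aexp mul one (- t) a) (aexp mul one t a).
Proof. by split; [have := aexpK (- t) a; rewrite opprK|exact: aexpK]. Qed.

(** From e^(ta) e^(-ta) = 1. The lower bound keeps the logarithms bounded, so kappa_+ and kappa_-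
    are finite and [fine] loses nothing on them. *)
Lemma nrm_aexp_ge t a : expR (- (`|t| * nrm a)) <= nrm (aexp mul one t a).
Proof.
have : 1 <= nrm (aexp mul one t a) * nrm (aexp mul one (- t) a).
  by rewrite -nrm_one -{1}(aexpK t a) nrm_bmul.
have := nrm_aexp (- t) a; rewrite normrN => i1 i2.
rewrite expRN -[leLHS]mul1r ler_pdivrMr ?expR_gt0 //.
by apply: le_trans i2 _; rewrite ler_wpM2l ?nrm_ge0.
Qed.

Lemma log_growth_bound s a t : `|s| = 1 -> 0 < t ->
  `|t^-1 * ln (nrm (aexp mul one (s * t) a))| <= nrm a.
Proof.
move=> s1 t0; have := nrm_aexp (s * t) a; have := nrm_aexp_ge (s * t) a.
rewrite normrM s1 mul1r gtr0_norm // => i1 i2.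
have n0 : 0 < nrm (aexp mul one (s * t) a) by apply: lt_le_trans i1; exact: expR_gt0.
rewrite normrM gtr0_norm ?invr_gt0 // ler_pdivrMl // ler_norml; apply/andP; split.
  by rewrite -ler_expR lnK.
by rewrite -ler_expR lnK.
Qed.

Lemma kappa_plus_fin a : kappa_plus mul one a \is a fin_num.
Proof.
apply: (@limsup_pinfty_fin _ _ (nrm a)) => t t0.
by have := @log_growth_bound 1 a t (normr1 _) t0; rewrite mul1r.
Qed.

Lemma kappa_minus_fin a : kappa_minus mul one a \is a fin_num.
Proof.
rewrite /kappa_minus fin_numN; apply: (@limsup_pinfty_fin _ _ (nrm a)) => t t0.
by have := @log_growth_bound (-1) a t (normrN1 _) t0; rewrite mulN1r.
Qed.

Lemma is_inverse_mul a b a' b' : is_inverse mul one b a -> is_inverse mul one b' a' ->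
  is_inverse mul one (mul b' b) (mul a a').
Proof.
move=> [h1 h2] [h3 h4]; split.
  by rewrite -bmulA (bmulA b) h1 bmul1.
by rewrite -bmulA (bmulA a') h4 bmul1.
Qed.

(** The geometric series in c = 1 - a. A two-sided inverse needs b = 1 + c b and b = 1 + b c; the
    second uses that the powers of c commute with c. *)
Lemma neumann a : nrm (a - one) < 1 -> exists b, is_inverse mul one b a.
Proof.
move=> a1; pose c := one - a; pose q := nrm c.
have q0 : 0 <= q by exact: nrm_ge0.
have q1 : `|q| < 1 by rewrite ger0_norm // /q nrmB.
have cn n : nrm (apow mul one c n) <= 1 * q ^+ n.
  elim: n => [|n IH] /=; first by rewrite nrm_one expr0 mulr1.
  rewrite (le_trans (nrm_bmul _ _)) // exprS mulrCA ler_wpM2l //.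
have [b hb _] := normal_series_cvg cn (cvg_geometric_series (a := 1) q1).
have cC n : mul (apow mul one c n) c = mul c (apow mul one c n).
  elim: n => [|n IH] /=; first by rewrite bmul1 bmulr1.
  by rewrite -bmulA IH.
have hb1 : (fun n => series (apow mul one c) (n + 1)%N) @ \oo --> b.
  by rewrite (cvg_shiftn 1 (series (apow mul one c))).
have e1 : b = one + mul c b.
  apply: cvg_nrm_unique hb1 _.
  have -> : (fun n => series (apow mul one c) (n + 1)%N) =
      (fun n => one + mul c (series (apow mul one c) n)).
    apply/funext => n; rewrite addn1 /series /= big_nat_recl //=; congr (_ + _).
    elim: n => [|n IH]; first by rewrite !big_geq // (blin0 (blin_mul c)).
    by rewrite !big_nat_recr //= (blinD (blin_mul c)) IH.
  by apply: cvgD; [exact: cvg_cst|exact: (blin_cvg (blin_mul c))].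
have e2 : b = one + mul b c.
  apply: cvg_nrm_unique hb1 _.
  have -> : (fun n => series (apow mul one c) (n + 1)%N) =
      (fun n => one + mul (series (apow mul one c) n) c).
    apply/funext => n; rewrite addn1 /series /= big_nat_recl //=; congr (_ + _).
    elim: n => [|n IH]; first by rewrite !big_geq // (blin0 (blin_mulr c)).
    by rewrite !big_nat_recr //= (blinD (blin_mulr c)) IH cC.
  by apply: cvgD; [exact: cvg_cst|exact: (blin_cvg (blin_mulr c))].
exists b; have aE : a = one - c by rewrite /c opprB subrKC.
split; rewrite aE.
  by rewrite (blinB (blin_mul b)) bmulr1 {1}e2 addrK.
by rewrite (blinB (blin_mulr b)) bmul1 {1}e1 addrK.
Qed.

End BanachAlgebra.
End BanachSpaces.

(** * The semigroup near its fixed point *)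

Section Semigroup.
Variable R : realType.
Local Notation C := R[i].

Lemma near_at_right0 (P : set R) : (\forall h \near at_right (0 : R), P h) ->
  exists2 d : R, 0 < d & forall h, 0 < h -> h < d -> P h.
Proof.
move=> [d /= d0 hd]; exists d => // h h0 hhd; apply: hd => //=.
by rewrite sub0r normrN gtr0_norm.
Qed.

Lemma near_pinfty (P : set R) : (\forall t \near +oo%R, P t) ->
  exists2 N : R, 0 < N & forall t, N < t -> P t.
Proof.
move=> [N [_ hN]]; exists (Num.max N 1); first by rewrite lt_max ltr01 orbT.
by move=> t; rewrite gt_max => /andP[Nt _]; exact: hN.
Qed.

Variables (X : completeNormedModType C) (D : set X) (F : R -> X -> X).
Hypothesis oD : open D.

Lemma open_ball x : D x -> exists2 r : R, 0 < r & forall y, nrm (y - x) < r -> D y.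
Proof.
move=> Dx; have : nbhs x D by exact: open_nbhs_nbhs.
by move=> /nbhs_nrmP.
Qed.

Lemma strictly_inside_ball x (r : R) : 0 < r -> (forall y, nrm (y - x) < r -> D y) ->
  strictly_inside D [set y | nrm (y - x) < r / 2].
Proof.
move=> r0 hr; split; [|split].
- by move=> y /= yx; apply: hr; lra.
- exists (r / 2 + nrm x) => y /= yx; have := nrm_le_add y x; lra.
- exists (r / 2); split; first by rewrite divr_gt0.
  by move=> y z /= yx zy; apply: hr; have := nrm_mid y z x; lra.
Qed.

Lemma strictly_inside1 x : D x -> strictly_inside D [set x].
Proof.
move=> Dx; have [r r0 hr] := open_ball Dx; split; [|split].
- by move=> _ ->.
- by exists (nrm x) => _ ->.
- by exists r; split=> // _ y ->; exact: hr.
Qed.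

Hypothesis hF : hol_semigroup D F.

Lemma semigroup_diff t x : 0 <= t -> D x -> differentiable (F t) x.
Proof. by case: hF => h _ _ _ t0; apply: h. Qed.

Lemma semigroup_in t x : 0 <= t -> D x -> D (F t x).
Proof. by case: hF => _ h _ _; apply: h. Qed.

Lemma semigroupD t s x : 0 <= t -> 0 <= s -> D x -> F (t + s) x = F t (F s x).
Proof. by case: hF => _ _ h _; apply: h. Qed.

(** This is not among the axioms. As t decreases to 0, F_t(F_0 x) tends to F_0 x, yet it equals F_t
    x, which tends to x. *)
Lemma semigroup0 x : D x -> F 0 x = x.
Proof.
move=> Dx; have h y (Dy : D y) : F ^~ y @ at_right 0 --> y.
  by case: hF => _ _ _; apply.
have D0 := semigroup_in (lexx 0) Dx.
apply: cvg_nrm_unique (h _ D0) _.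
have /cvg_nrmP hx := h x Dx; apply/cvg_nrmP => e /hx he.
apply: filterS2 (nbhs_right_gt 0) he => t t0.
by rewrite -semigroupD // ?ltW // addr0.
Qed.

Variables (x0 : X) (f : X -> X).
Hypothesis hs : condition_star D F x0 f.
Hypothesis bD : dbounded D.

Lemma Dx0 : D x0. Proof. by case: hs. Qed.

Lemma semigroup_attract x (e : R) : D x -> 0 < e ->
  exists2 N, 0 < N & forall t, N < t -> nrm (F t x - x0) < e.
Proof.
move=> Dx e0; case: hs => _ /(_ _ (strictly_inside1 Dx)) /(_ e e0) h _ _ _.
by have [N N0 hN] := near_pinfty h; exists N => // t Nt; apply: hN.
Qed.

(** In F_t(F_s x0) = F_s(F_t x0) let s grow: the right side tends to x0, the left side to F_t x0 by
    continuity at x0. *)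
Lemma semigroup_fixed t : 0 <= t -> F t x0 = x0.
Proof.
move=> t0; apply/eqP; rewrite -subr_eq0; apply/eqP/nrm_small => e e0.
have [K K0 [d d0 hd]] := differentiable_lip (semigroup_diff t0 Dx0).
have e2 : 0 < e / 2 by rewrite divr_gt0.
have m0 : 0 < Num.min d (e / 2 / K) by rewrite lt_min d0 !divr_gt0.
have [N1 N10 h1] := semigroup_attract Dx0 m0.
have [N2 N20 h2] := semigroup_attract (semigroup_in t0 Dx0) e2.
pose s := N1 + N2; have s0 : 0 <= s by rewrite addr_ge0 // ltW.
have : nrm (F s x0 - x0) < Num.min d (e / 2 / K) by apply: h1; rewrite /s; lra.
rewrite lt_min ltr_pdivlMr // => /andP[/hd i1 i2].
have : nrm (F s (F t x0) - x0) < e / 2 by apply: h2; rewrite /s; lra.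
rewrite -(semigroupD s0 t0 Dx0) (addrC s t) (semigroupD t0 s0 Dx0) => i3.
have := nrm_mid (F t (F s x0)) (F t x0) x0; rewrite [nrm (F t x0 - F t (F s x0))]nrmB.
by move: i2; rewrite mulrC; lra.
Qed.

(** All F_t take values in the bounded set D, so the Cauchy estimate gives one constant for all
    t. *)
Lemma semigroup_lip : exists r L : R, [/\ 0 < r, 1 <= L,
  (forall x, nrm (x - x0) < r -> D x) &
  forall t x, 0 <= t -> nrm (x - x0) < r -> nrm (F t x - x0) <= L * nrm (x - x0)].
Proof.
have [r r0 hr] := open_ball Dx0; have [M hM] := bD.
exists (r / 2), (Num.max 1 (8 * M / r)); split; first by rewrite divr_gt0.
- by rewrite le_max lexx.
- by move=> x xr; apply: hr; lra.
- move=> t x t0 xr.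
  have hb : hol_bounded (F t) x0 r M.
    move=> y /hr Dy; split; first exact: semigroup_diff.
    by apply: hM; exact: semigroup_in.
  have := lipschitz_ball r0 hb xr; rewrite semigroup_fixed // => i1.
  by apply: le_trans i1 _; rewrite ler_wpM2r ?nrm_ge0 // le_max lexx orbT.
Qed.

Lemma generator_quotient (S : set X) (e : R) : strictly_inside D S -> 0 < e ->
  exists2 d : R, 0 < d & forall h y, 0 < h -> h < d -> S y ->
    nrm (F h y - y - rC h *: f y) <= e * h.
Proof.
move=> hS e0; case: hs => _ _ _ /(_ S hS e e0) /near_at_right0[d d0 hd] _.
exists d => // h y h0 hhd Sy; have := hd h h0 hhd y Sy => i1.
have -> : F h y - y - rC h *: f y = rC h *: (rC h^-1 *: (F h y - y) - f y).
  by rewrite scalerBr scalerA -rCM mulfV ?gt_eqF // scale1r.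
by rewrite nrmZR gtr0_norm // mulrC ler_wpM2r ?(ltW h0) // ltW.
Qed.

Lemma rder_semigroup t x : 0 <= t -> D x -> rder (F^~ x) t (f (F t x)).
Proof.
move=> t0 Dx e e0; have Dt := semigroup_in t0 Dx.
have [d d0 hd] := generator_quotient (strictly_inside1 Dt) e0.
exists d => // h h0 hhd; rewrite [t + h]addrC semigroupD // ?(ltW h0) //.
exact: hd.
Qed.

Lemma generator_fixed : f x0 = 0.
Proof.
apply: nrm_small => e e0.
have [d d0 hd] := generator_quotient (strictly_inside1 Dx0) e0.
have d2 : 0 < d / 2 by rewrite divr_gt0.
have d3 : d / 2 < d by lra.
have := hd (d / 2) x0 d2 d3 erefl.
by rewrite semigroup_fixed ?(ltW d2) // subrr sub0r nrmN nrmZR gtr0_norm // mulrC ler_pM2r.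
Qed.

(** F_t x - F_(t-h) x is F_h y - y at the moving point y = F_(t-h) x, so the generator limit is
    needed uniformly. The Lipschitz bound keeps these y in one ball strictly inside D. *)
Lemma semigroup_lcont : exists2 r, 0 < r & forall x t, nrm (x - x0) < r -> 0 < t ->
  lcont (F^~ x) t.
Proof.
have [r0 [L [r00 L1 hD hL]]] := semigroup_lip.
have fd : differentiable f x0 by case: hs => _ _ /(_ x0 Dx0).
have [K K0 [d1 d10 hf]] := differentiable_lip fd.
pose r' := Num.min (r0 / 2) d1.
have r'0 : 0 < r' by rewrite lt_min d10 divr_gt0.
have hS : strictly_inside D [set y | nrm (y - x0) < r0 / 2] by exact: strictly_inside_ball.
have [d2 d20 hq] := generator_quotient hS ltr01.
have L0 : 0 < L by lra.
exists (Num.min r' (r' / L)); first by rewrite lt_min r'0 divr_gt0.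
move=> x t; rewrite lt_min => /andP[]; rewrite {1}/r' lt_min => /andP[x1 x2].
rewrite ltr_pdivlMr // => xL t0 e e0.
pose Q := K * r' + 1; have Q0 : 0 < Q by rewrite ltr_wpDl // mulr_ge0 // ltW.
exists (Num.min (Num.min d2 t) (e / Q)); first by rewrite !lt_min d20 t0 divr_gt0.
move=> h h0; rewrite !lt_min ltr_pdivlMr // => /andP[/andP[h1 h2] h3].
have th0 : 0 <= t - h by lra.
have xr0 : nrm (x - x0) < r0 by lra.
have yr : nrm (F (t - h) x - x0) < r' by apply: le_lt_trans (hL _ _ th0 xr0) _; rewrite mulrC.
have : r' <= r' by []; rewrite {2}/r' le_min => /andP[rr1 rr2].
have Dx : D x by exact: hD.
have -> : F t x = F h (F (t - h) x) by rewrite -semigroupD ?(ltW h0) // subrKC.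
set y := F (t - h) x in yr *.
have := hq h y h0 h1; rewrite /= mul1r => /(_ (lt_le_trans yr rr1)) i1.
have := hf y (lt_le_trans yr rr2); rewrite generator_fixed subr0 => i2.
rewrite nrmB; have := nrm_le_add (F h y - y) (rC h *: f y).
rewrite nrmZR gtr0_norm // => i3.
have i4 : K * nrm (y - x0) <= K * r' by rewrite ler_wpM2l // ltW.
have i5 : h * nrm (f y) <= h * (K * r') by rewrite ler_wpM2l ?(ltW h0) //; lra.
by move: h3; rewrite /Q mulrDr; lra.
Qed.

Lemma semigroup_decay (lam lam1 : R) : 0 <= lam -> lam < lam1 ->
  (kappa_plus_op ('d f x0) < (- lam1)%:E)%E ->
  exists r K : R, [/\ 0 < r, 0 < K, (forall x, nrm (x - x0) < r -> D x) &
    forall t x, 0 <= t -> nrm (x - x0) < r ->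
      nrm (F t x - x0) <= K * expR (- lam * t) * nrm (x - x0)].
Proof.
move=> l0 ll hk; have [r0 [L [r00 L1 hD hL]]] := semigroup_lip.
have L0 : 0 < L by lra.
have fd : differentiable f x0 by case: hs => _ _ /(_ x0 Dx0).
have [[c c0 cb] hf] := differentiable_nrm fd.
pose A : X -> X := 'd f x0.
have hA : blin A c by split=> // k u v; rewrite /A linearP.
have [tau tau0 htau] : exists2 T, 0 < T & forall t, T <= t ->
    opnorm (opexp A t) <= expR (- lam1 * t).
  apply: limsup_log_growth hk => t; exact: opnorm_ge0 (opexp_blin hA t).
have [r1 r10 hc] := semigroup_lcont.
(* The room between the linear rate [lam1] and the required rate [lam] over one period; Duhamel's
   error has to fit into it. *)
pose gap := expR (- lam * tau) - expR (- lam1 * tau).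
have gap0 : 0 < gap by rewrite subr_gt0 ltr_expR ltr_pM2r // ltrN2.
(* The factor [L] is there because within a period the orbit may reach [L] times its initial
   distance. *)
pose Q := expR (tau * c) * tau * L.
have Q0 : 0 < Q by rewrite !mulr_gt0 // expR_gt0.
have [d1 d10 h1] := hf (gap / Q) (divr_gt0 gap0 Q0).
pose r := Num.min (Num.min r0 r1) (d1 / L).
have r'0 : 0 < r by rewrite !lt_min r00 r10 divr_gt0.
have step x : nrm (x - x0) < r ->
    nrm (F tau x - x0) <= expR (- lam * tau) * nrm (x - x0).
  rewrite !lt_min ltr_pdivlMr // => /andP[/andP[x1 x2] x3].
  have Dx := hD x x1; set n := nrm (x - x0).
  have := @duhamel R X A c (fun t => F t x - x0) (fun t => f (F t x)) tau
    (gap / Q * (L * n)) hA (ltW tau0).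
  rewrite semigroup0 // => i1.
  have -> : expR (- lam * tau) * n = expR (tau * c) * (gap / Q * (L * n)) * tau +
     expR (- lam1 * tau) * n.
    have -> : expR (tau * c) * (gap / Q * (L * n)) * tau = gap * n.
      by rewrite /Q; field; rewrite !gt_eqF // expR_gt0.
    by rewrite /gap mulrBl subrK.
  have i2 : nrm (opexp A tau (x - x0)) <= expR (- lam1 * tau) * n.
    apply: le_trans (opnorm_le (opexp_blin hA tau) _) _.
    by rewrite ler_wpM2r ?nrm_ge0 // htau.
  apply: le_trans (nrm_le_add _ (opexp A tau (x - x0))) _; rewrite addrC.
  apply: lerD => //; apply: i1.
  - move=> t t0 _ e e0; have [d d0 hd] := rder_semigroup t0 Dx e0.
    by exists d => // h h0 hhd; rewrite opprB addrA subrK; exact: hd.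
  - move=> t t0 _ e e0; have [d d0 hd] := hc x t x2 t0 e e0.
    by exists d => // h h0 hhd; rewrite opprB addrA subrK; exact: hd.
  - move=> t t0 _; have i3 := hL t x t0 x1.
    have := h1 (F t x - x0); rewrite subrKC generator_fixed subr0 => i4.
    apply: le_trans (i4 _) _; first by apply: le_lt_trans i3 _; rewrite mulrC.
    by rewrite ler_wpM2l // divr_ge0 // ltW.
pose E := expR (- lam * tau).
have E1 : E <= 1 by rewrite -expR0 ler_expR mulNr oppr_le0 mulr_ge0 // ltW.
have rr0 x : nrm (x - x0) < r -> nrm (x - x0) < r0.
  by rewrite !lt_min => /andP[/andP[]].
have iter n x : nrm (x - x0) < r ->
    nrm (F (n%:R * tau) x - x0) <= E ^+ n * nrm (x - x0).
  move=> xr; have Dx := hD x (rr0 x xr).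
  elim: n => [|n IH]; first by rewrite mul0r semigroup0 // expr0 mul1r.
  have -> : n.+1%:R * tau = tau + n%:R * tau by rewrite -(natr1 n); ring.
  have nt0 : 0 <= n%:R * tau by rewrite mulr_ge0 // ltW.
  rewrite (semigroupD (ltW tau0) nt0 Dx); apply: le_trans (step _ _) _.
    apply: le_lt_trans IH (le_lt_trans _ xr); rewrite ler_piMl ?nrm_ge0 //.
    by rewrite exprn_ile1 // expR_ge0.
  by rewrite exprS -mulrA ler_wpM2l ?expR_ge0.
(* [L] covers the incomplete last period, e^(lam tau) the decay not yet gained in it. *)
exists r, (L * expR (lam * tau)); split=> //.
- by rewrite mulr_gt0 ?expR_gt0.
- by move=> x /rr0; exact: hD.
move=> t x t0 xr; have Dx := hD x (rr0 x xr).
have /andP[n1 n2] := truncn_itv (divr_ge0 t0 (ltW tau0)).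
set n := Num.truncn (t / tau) in n1 n2.
rewrite ler_pdivlMr // in n1; rewrite ltr_pdivrMr // in n2.
have nt0 : 0 <= n%:R * tau by rewrite mulr_ge0 // ltW.
have s0 : 0 <= t - n%:R * tau by rewrite subr_ge0.
have -> : t = (t - n%:R * tau) + n%:R * tau by rewrite subrK.
rewrite (semigroupD s0 nt0 Dx) subrK.
have i1 := iter n x xr.
have i2 : nrm (F (n%:R * tau) x - x0) < r0.
  apply: le_lt_trans i1 (le_lt_trans _ (rr0 x xr)); rewrite ler_piMl ?nrm_ge0 //.
  by rewrite exprn_ile1 // expR_ge0.
apply: le_trans (hL _ _ s0 i2) _; rewrite -!mulrA; apply: ler_wpM2l; first exact: ltW.
apply: le_trans i1 _; rewrite mulrA; apply: ler_wpM2r; first exact: nrm_ge0.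
rewrite /E -expRM_natl -expRD ler_expR.
have : lam * t <= lam * (n.+1%:R * tau) by rewrite ler_wpM2l // ltW.
by rewrite -(natr1 n); lra.
Qed.

End Semigroup.

(** * The choice of the rates *)

Section Constants.
Variable R : realType.

(** For finite [kop], gap = (k+1)|a| - (kp - km) is positive because k + 1 exceeds the quotient.
    Lowering lam by [m] costs at most gap/4 and raising p and q costs gap/8 each, so half of the gap
    remains. For [kop] = -oo, [fine] gives 0 and the quotient is 0; any rate lam is then available,
    and k = 0 is enough. *)
Lemma exponent_choice (kop : \bar R) (kp km : R) : (kop < 0)%E ->
  exists (k : nat) (lam lam1 p q : R),
   [/\ 0 <= lam, lam < lam1, (kop < (- lam1)%:E)%E, kp < p & - km < q] /\
   p + q < lam * k.+1%:R /\ (k = 0%N \/ k%:R <= (kp - km) / `|fine kop|).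
Proof.
case: kop => [a||]; last first.
- move=> _; pose lam := `|kp + 1 + (- km + 1)| + 1.
  exists 0%N, lam, (lam + 1), (kp + 1), (- km + 1); split; [split|split].
  * by rewrite addr_ge0.
  * by lra.
  * exact: ltNyr.
  * by lra.
  * by lra.
  * by rewrite mulr1 /lam; have := ler_norm (kp + 1 + (- km + 1)); lra.
  * by left.
- by rewrite ltNge leey.
- rewrite lte_fin => a0 /=.
  pose l := (kp - km) / `|a|; pose k := if 0 <= l then Num.truncn l else 0%N.
  have al : `|a| = - a by rewrite ltr0_norm.
  have na0 : 0 < - a by lra.
  have lk : l < k.+1%:R.
    rewrite /k; have [l0|l0] := leP 0 l; first by have /andP[] := truncn_itv l0.
    by apply: lt_le_trans l0 _.
  pose K : R := k.+1%:R; have K0 : 0 < K by rewrite ltr0n.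
  have gap0 : 0 < K * - a - (kp - km).
    by move: lk; rewrite /l al ltr_pdivrMr // -/K; lra.
  set gap := K * - a - (kp - km) in gap0.
  pose m := Num.min (- a / 2) (gap / (4 * K)).
  have m0 : 0 < m by rewrite lt_min !divr_gt0 // mulr_gt0.
  have m1 : m <= - a / 2 by rewrite ge_min lexx.
  have m2 : m * (4 * K) <= gap by rewrite -ler_pdivlMr ?mulr_gt0 // ge_min lexx orbT.
  exists k, (- a - m), (- a - m / 2), (kp + gap / 8), (- km + gap / 8); split; [split|split].
  * by lra.
  * by lra.
  * by rewrite lte_fin; lra.
  * by lra.
  * by lra.
  * by move: gap0 m2; rewrite -/K /gap mulrBl; lra.
  * rewrite /k; have [l0|l0] := leP 0 l; last by left.
    by right; have /andP[] := truncn_itv l0.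
Qed.

Lemma powR_le_expr (x l : R) (k : nat) : 0 <= x -> x <= 1 -> (0 < k)%N -> k%:R <= l ->
  x `^ l <= x ^+ k.
Proof.
move=> x0 x1 k0 kl; have [->|xn] := eqVneq x 0.
  rewrite powR0 ?expr0n ?(gtn_eqF k0) // gt_eqF //.
  by apply: lt_le_trans kl; rewrite ltr0n.
have xp : 0 < x by rewrite lt_neqAle eq_sym xn.
rewrite -powR_mulrn // /powR (negbTE xn) ler_expR.
by apply: ler_wnM2r => //; rewrite -ln1 ler_ln ?posrE.
Qed.

(** From 1 + y <= e^y at y = K / e. *)
Lemma exp_decay_small (mu K e : R) : 0 < mu -> 0 <= K -> 0 < e ->
  exists2 s, 0 <= s & K * expR (- mu * s) < e.
Proof.
move=> mu0 K0 e0; exists (K / e / mu); first by rewrite !divr_ge0 // ltW.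
have -> : - mu * (K / e / mu) = - (K / e) by field; rewrite !gt_eqF.
rewrite expRN ltr_pdivrMr ?expR_gt0 //.
have := expR_ge1Dx (K / e) => h.
have : e * (1 + K / e) <= e * expR (K / e) by rewrite ler_wpM2l // ltW.
have -> : e * (1 + K / e) = e + K by field; rewrite gt_eqF.
by lra.
Qed.

End Constants.

(** * The limit M *)

Section Koenigs.
Variable R : realType.
Local Notation C := R[i].
Variables (X A : completeNormedModType C) (mul : A -> A -> A) (one : A).
Variables (D : set X) (rho : X -> X -> R) (F : R -> X -> X) (x0 : X) (f : X -> X).
Variables (Gamma : R -> X -> A) (B : X -> A).
Hypothesis hA : unital_banach_algebra mul one.
Hypothesis oD : open D.
Hypothesis bD : dbounded D.
Hypothesis hF : hol_semigroup D F.
Hypothesis hs : condition_star D F x0 f.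
Hypothesis hT : T_cont_semicocycle mul one D F Gamma.
Hypothesis hB : holomorphic_on D B.
Hypothesis hG : generated_by mul one D F Gamma B.

Let B0 := B x0.

Lemma cocycle0 x : D x -> Gamma 0 x = one.
Proof. by move=> /hG[]. Qed.

Lemma cocycleD t s x : 0 <= t -> 0 <= s -> D x ->
  mul (Gamma t (F s x)) (Gamma s x) = Gamma (t + s) x.
Proof. by case: hT => _ h _ _; apply: h. Qed.

Lemma cocycle_diff t x : 0 <= t -> D x -> differentiable (Gamma t) x.
Proof. by case: hT => h _ _ _ t0; apply: h. Qed.

Lemma cocycle_quotient t x (e : R) : 0 <= t -> D x -> 0 < e ->
  exists2 d : R, 0 < d & forall h, h != 0 -> 0 <= t + h -> `|h| < d ->
    nrm (Gamma (t + h) x - Gamma t x - rC h *: mul (B (F t x)) (Gamma t x)) <= e * `|h|.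
Proof.
move=> t0 Dx e0; have [_ /(_ t t0) /cvg_nrmP /(_ e e0) [d /= d0 hd]] := hG Dx.
exists d => // h h0 th hhd; have := hd h.
rewrite /= sub0r normrN => /(_ hhd (conj h0 th)) => i1.
have -> : Gamma (t + h) x - Gamma t x - rC h *: mul (B (F t x)) (Gamma t x) =
  rC h *: (rC h^-1 *: (Gamma (t + h) x - Gamma t x) - mul (B (F t x)) (Gamma t x)).
  by rewrite scalerBr scalerA -rCM mulfV // scale1r.
by rewrite nrmZR mulrC ler_wpM2r // ltW.
Qed.

Lemma rder_cocycle t x : 0 <= t -> D x ->
  rder (Gamma^~ x) t (mul (B (F t x)) (Gamma t x)).
Proof.
move=> t0 Dx e e0; have [d d0 hd] := cocycle_quotient t0 Dx e0.
exists d => // h h0 hhd; have := hd h; rewrite gtr0_norm // gt_eqF // addr_ge0 ?(ltW h0) //.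
exact.
Qed.

Lemma lcont_cocycle t x : 0 < t -> D x -> lcont (Gamma^~ x) t.
Proof.
move=> t0 Dx e e0; have [d d0 hd] := cocycle_quotient (ltW t0) Dx ltr01.
set w := mul (B (F t x)) (Gamma t x) in hd.
pose Q := nrm w + 1; have Q0 : 0 < Q by rewrite ltr_wpDl ?nrm_ge0.
exists (Num.min (Num.min d t) (e / Q)); first by rewrite !lt_min d0 t0 divr_gt0.
move=> h h0; rewrite !lt_min ltr_pdivlMr // => /andP[/andP[h1 h2] h3].
have := hd (- h); rewrite oppr_eq0 gt_eqF // subr_ge0 (ltW h2) normrN gtr0_norm //.
move=> /(_ isT isT h1) i1; apply: le_trans (nrm_le_add _ (rC (- h) *: w)) _.
by rewrite nrmZR normrN gtr0_norm //; move: h3; rewrite /Q mulrDr; lra.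
Qed.

Definition normalized t x : A := mul (aexp mul one (- t) B0) (Gamma t x).

(** The form to which [rder_opexp] and [lcont_opexp] apply, with shift 0; hence t + 0. *)
Lemma normalizedE t x : normalized t x = opexp (fun y => - mul B0 y) (t + 0) (Gamma t x).
Proof. by rewrite addr0 opexp_opp /normalized (aexp_mul hA). Qed.

Lemma unnormalize t x : Gamma t x = mul (aexp mul one t B0) (normalized t x).
Proof. by rewrite /normalized (bmulA hA) (aexpK hA) (bmul1 hA). Qed.

Lemma rder_normalized t x : 0 <= t -> D x -> rder (normalized^~ x) t
  (mul (aexp mul one (- t) B0) (mul (B (F t x) - B0) (mul (aexp mul one t B0) (normalized t x)))).
Proof.
move=> t0 Dx; have hN := blin_opp (blin_mul hA B0).
have := rder_opexp hN 0 (rder_cocycle t0 Dx).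
rewrite -unnormalize (aexp_mul hA) (blinB (blin_mulr hA _)) addr0 opexp_opp.
rewrite [_ - mul B0 _]addrC.
by under [X in rder X]eq_fun do rewrite -normalizedE.
Qed.

Lemma lcont_normalized t x : 0 < t -> D x -> lcont (normalized^~ x) t.
Proof.
move=> t0 Dx; have hN := blin_opp (blin_mul hA B0).
have := lcont_opexp hN 0 (lcont_cocycle t0 Dx).
by under [X in lcont X]eq_fun do rewrite -normalizedE.
Qed.

Lemma normalized0 x : D x -> normalized 0 x = one.
Proof. by move=> Dx; rewrite normalizedE addr0 (opexp0 (blin_opp (blin_mul hA B0))) cocycle0. Qed.

(** At the fixed point B(F_t x0) = B0, so the derivative vanishes. *)
Lemma normalized_x0 t : 0 <= t -> normalized t x0 = one.
Proof.
move=> t0; have D0 := Dx0 hs.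
apply/eqP; rewrite -subr_eq0; apply/eqP/nrm_small => e e0.
rewrite -(normalized0 D0).
have := @rder_mean_value R A (normalized^~ x0) (fun=> 0) (fun=> 0) (fun=> 0) 0 t t0.
rewrite subr0 => h; apply: le_trans (h _ _ _ _) (ltW e0).
- move=> s s0 _; have := rder_normalized s0 D0.
  rewrite (semigroup_fixed oD hF hs s0) subrr (blin0 (blin_mulr hA _)).
  by rewrite (blin0 (blin_mul hA _)).
- by move=> s s0 _; exact: lcont_normalized.
- by move=> s _ _; rewrite nrm0.
Qed.

(** Letting t tend to infinity here yields the functional equation [koenigsE]. *)
Lemma normalizedD t s x : 0 <= t -> 0 <= s -> D x ->
  normalized (t + s) x =
  mul (aexp mul one (- s) B0) (mul (normalized t (F s x)) (Gamma s x)).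
Proof.
move=> t0 s0 Dx; rewrite /normalized -cocycleD // -!(bmulA hA) [RHS](bmulA hA).
congr (mul _ _); rewrite !(aexpE hA) opprD addrC.
by rewrite -(opexpD (- s) (- t) one (blin_mul hA B0)) -(aexpE hA (- s) B0) (aexp_mul hA).
Qed.

Lemma normalized_diff t x : 0 <= t -> D x -> differentiable (normalized t) x.
Proof.
move=> t0 Dx; apply: differentiable_bilinear.
- by move=> u; exists (nrm u); exact: (blin_mul hA).
- by move=> v; exists (nrm v); exact: (blin_mulr hA).
- exact: nrm_bmul hA.
- exact: differentiable_cst.
- exact: cocycle_diff.
Qed.

Let ell := fine (kappa_plus mul one B0 - kappa_minus mul one B0)%E
             / `|fine (kappa_plus_op ('d f x0))|.
Hypothesis hl : (fun x => nrm (B x - B0) / nrm (x - x0) `^ ell) @ x0^' --> (0 : R).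

(* Holomorphy upgrades o(|x - x0|^k), k = floor ell, to O(|x - x0|^(k+1)); this extra
   power makes the integral defining M absolutely convergent. *)
Lemma generator_order (k : nat) : k = 0%N \/ k%:R <= ell ->
  exists C0 r : R, [/\ 0 <= C0, 0 < r & forall y, nrm (y - x0) < r ->
     nrm (B y - B0) <= C0 * nrm (y - x0) ^+ k.+1].
Proof.
move=> kell; have D0 := Dx0 hs.
have [K K0 [d d0 hd]] := differentiable_lip (hB D0).
have [r r0 hr] := open_ball oD D0.
pose s := Num.min d r; have s0 : 0 < s by rewrite lt_min d0.
have [C0 [s' [C00 s'0 H]]] := @order_ball R X A k s (K * s) s0.
exists C0, s'; split=> //; apply: (H (fun y => B y - B0) x0).
- move=> y; rewrite lt_min => /andP[y1 y2]; split.
    by apply: differentiableB; [exact: hB (hr y y2)|exact: differentiable_cst].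
  apply: le_trans (hd y y1) _; rewrite ler_wpM2l ?(ltW K0) // ltW // lt_min y1 y2 //.
- by rewrite /B0 subrr.
(* For k = 0 the required o(1) is the continuity of B at x0. *)
- move=> e e0; case: kell => [->|kell].
    exists (Num.min d (e / K)); first by rewrite lt_min d0 divr_gt0.
    move=> y; rewrite lt_min ltr_pdivlMr // => /andP[/hd i1 i2].
    by rewrite expr0 mulr1; apply: le_trans i1 _; rewrite mulrC ltW.
  have [k0|k0] := posnP k.
    exists (Num.min d (e / K)); first by rewrite lt_min d0 divr_gt0.
    move=> y; rewrite lt_min ltr_pdivlMr // => /andP[/hd i1 i2].
    by rewrite k0 expr0 mulr1; apply: le_trans i1 _; rewrite mulrC ltW.
  move/cvgrPdist_lt: hl => /(_ e e0); rewrite near_withinE => /nbhs_nrmP[d' d'0 hd'].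
  (* Within distance 1 the power ell is at most the power k, as k <= ell; the hypothesis thus
     becomes o(|y - x0|^k). *)
  exists (Num.min d' 1); first by rewrite lt_min d'0 ltr01.
  move=> y; rewrite lt_min => /andP[y1 y2].
  have [->|yx] := eqVneq y x0.
    by rewrite /B0 subrr nrm0 mulr_ge0 ?(ltW e0) // exprn_ge0 // nrm_ge0.
  have n0 : 0 < nrm (y - x0) by rewrite nrm_gt0 subr_eq0.
  have := hd' y y1 yx; rewrite sub0r normrN normrM normfV.
  rewrite [`|nrm _|]ger0_norm ?nrm_ge0 // [`|_ `^ _|]ger0_norm ?powR_ge0 //.
  rewrite ltr_pdivrMr ?powR_gt0 // => i1; apply: le_trans (ltW i1) _.
  by rewrite ler_wpM2l ?(ltW e0) // powR_le_expr // ltW.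
Qed.

(** Near x0 the operator in front of N is bounded by Kc e^(-mu t). Gronwall's inequality turns this
    into a bound uniform in time and place, as [weierstrass] requires; the derivative of N is then
    dominated by an integrable function, so N is Cauchy as t grows. *)
Lemma normalized_local : exists r K : R, [/\ 0 < r,
   (forall x, nrm (x - x0) < r -> D x),
   (forall t x, 0 <= t -> nrm (x - x0) < r -> nrm (normalized t x) <= K) &
   (forall x, nrm (x - x0) < r -> exists l : A, normalized^~ x @ +oo%R --> l)].
Proof.
have kpf := kappa_plus_fin hA B0; have kmf := kappa_minus_fin hA B0.
have kop0 : (kappa_plus_op ('d f x0) < 0)%E by case: hs.
have [k [lam [lam1 [p [q [[l0 ll hk hp hq] [pq kell]]]]]]] :=
  exponent_choice (fine (kappa_plus mul one B0)) (fine (kappa_minus mul one B0)) kop0.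
have [r1 [K1 [r10 K10 rD hdec]]] := semigroup_decay oD hF hs bD l0 ll hk.
have [C0 [r2 [C00 r20 hord]]] : exists C0 r : R, [/\ 0 <= C0, 0 < r &
    forall y, nrm (y - x0) < r -> nrm (B y - B0) <= C0 * nrm (y - x0) ^+ k.+1].
  by apply: generator_order; rewrite /ell fineB.
have [Kp Kp0 hKp] : exists2 K, 0 < K &
    forall t, 0 <= t -> nrm (aexp mul one t B0) <= K * expR (p * t).
  apply: (@limsup_log_bound R _ p (nrm B0)) => [t|t t0||]; try exact: nrm_ge0.
    by have := nrm_aexp hA t B0; rewrite ger0_norm.
  by rewrite -[limsup_pinfty _]/(kappa_plus mul one B0) -(fineK kpf) lte_fin.
have [Km Km0 hKm] : exists2 K, 0 < K &
    forall t, 0 <= t -> nrm (aexp mul one (- t) B0) <= K * expR (q * t).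
  apply: (@limsup_log_bound R _ q (nrm B0)) => [t|t t0||]; try exact: nrm_ge0.
    by have := nrm_aexp hA (- t) B0; rewrite normrN ger0_norm.
  by rewrite -[limsup_pinfty _]oppeK -/(kappa_minus mul one B0) -(fineK kmf) -EFinN lte_fin.
(* What remains of the decay of |F_t x - x0|^(k+1) after the growth p and q of the two
   exponentials. *)
pose mu := lam * k.+1%:R - (p + q); have mu0 : 0 < mu by rewrite subr_gt0.
pose r := Num.min r1 (r2 / K1); have r0 : 0 < r by rewrite lt_min r10 divr_gt0.
(* The added 1 keeps the rate positive, as [rder_gronwall] demands, even when C0 = 0. *)
pose Kc := Km * Kp * C0 * (K1 * r) ^+ k.+1 + 1.
have Kr0 : 0 <= K1 * r by rewrite mulr_ge0 // ltW.
have Kc0 : 0 < Kc.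
  by rewrite ltr_wpDl // mulr_ge0 ?exprn_ge0 // mulr_ge0 // mulr_ge0 // ltW.
pose v x t := mul (aexp mul one (- t) B0)
  (mul (B (F t x) - B0) (mul (aexp mul one t B0) (normalized t x))).
have rD' x : nrm (x - x0) < r -> D x.
  by rewrite lt_min => /andP[/rD].
have hv x t : nrm (x - x0) < r -> 0 <= t ->
    nrm (v x t) <= Kc * expR (- mu * t) * nrm (normalized t x).
  move=> xr t0; have : nrm (x - x0) < r by [].
  rewrite {1}/r lt_min ltr_pdivlMr // => /andP[x1 x2].
  have i1 := hdec t x t0 x1.
  have e1 : expR (- lam * t) <= 1.
    by rewrite -expR0 ler_expR mulNr oppr_le0 mulr_ge0.
  have i2 : K1 * expR (- lam * t) * nrm (x - x0) <= expR (- lam * t) * (K1 * r).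
    rewrite mulrAC mulrC; apply: ler_wpM2l; first exact: expR_ge0.
    by rewrite ler_wpM2l // ltW.
  have i3 : nrm (F t x - x0) < r2.
    apply: le_lt_trans i1 (le_lt_trans _ x2); rewrite mulrAC mulrC [nrm _ * K1]mulrC.
    by rewrite ler_piMl // mulr_ge0 ?nrm_ge0 // ltW.
  have i4 := hord _ i3.
  have i5 : nrm (B (F t x) - B0) <= C0 * (expR (- lam * t) * (K1 * r)) ^+ k.+1.
    apply: le_trans i4 _; apply: ler_wpM2l => //; apply: lerXn2r; rewrite ?nnegrE ?nrm_ge0 //.
      by rewrite mulr_ge0 ?expR_ge0.
    exact: le_trans i1 i2.
  rewrite /v; apply: le_trans (nrm_bmul hA _ _) _.
  apply: le_trans (ler_wpM2l (nrm_ge0 _) (nrm_bmul hA _ _)) _.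
  apply: le_trans (ler_wpM2l (nrm_ge0 _) (ler_wpM2l (nrm_ge0 _) (nrm_bmul hA _ _))) _.
  rewrite !mulrA; apply: ler_wpM2r; first exact: nrm_ge0.
  apply: le_trans (_ : (Km * expR (q * t)) * (C0 * (expR (- lam * t) * (K1 * r)) ^+ k.+1) *
     (Kp * expR (p * t)) <= _).
    apply: ler_pM; rewrite ?mulr_ge0 ?nrm_ge0 ?hKp //.
    by apply: ler_pM; rewrite ?nrm_ge0 ?hKm.
  have -> : - mu * t = q * t + k.+1%:R * (- lam * t) + p * t by rewrite /mu; ring.
  rewrite !expRD expRM_natl exprMn.
  have -> : Km * expR (q * t) * (C0 * (expR (- lam * t) ^+ k.+1 * (K1 * r) ^+ k.+1)) *
      (Kp * expR (p * t)) = (Km * Kp * C0 * (K1 * r) ^+ k.+1) *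
      (expR (q * t) * expR (- lam * t) ^+ k.+1 * expR (p * t)) by ring.
  apply: ler_wpM2r; last by rewrite /Kc lerDl.
  by rewrite mulr_ge0 ?expR_ge0 // mulr_ge0 ?exprn_ge0 ?expR_ge0.
(* An antiderivative of Kc e^(-mu t); after time s it increases by at most (Kc / mu) e^(-mu s). *)
pose Z t := - (Kc / mu) * expR (- mu * t).
have dZ t : is_derive t (1 : R) Z (Kc * expR (- mu * t)).
  by apply: is_derive_eq; rewrite /GRing.scale /=; field; rewrite gt_eqF.
have Zle s t : Z t - Z s <= Kc / mu * expR (- mu * s).
  rewrite /Z !mulNr opprK gerDr oppr_le0 mulr_ge0 ?expR_ge0 //.
  by rewrite divr_ge0 // ltW.
pose Mx := expR (2 * (Kc / mu)).
have bnd t x : 0 <= t -> nrm (x - x0) < r -> nrm (normalized t x) <= Mx.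
  move=> t0 xr; have Dx := rD' x xr.
  have kpos s : 0 < Kc * expR (- mu * s) by rewrite mulr_gt0 ?expR_gt0.
  have := @rder_gronwall R A (normalized^~ x) (v x) Z _ 0 t t0 dZ kpos.
  rewrite (normalized0 Dx) (nrm_one hA) mul1r => h; apply: le_trans (h _ _ _) _.
  - by move=> s s0 _; exact: rder_normalized.
  - by move=> s s0 _; exact: lcont_normalized.
  - by move=> s s0 _; exact: hv.
  - rewrite ler_expR ler_wpM2l //; have := Zle 0 t.
    by rewrite mulr0 expR0 mulr1.
have Mx0 : 0 <= Mx by exact: expR_ge0.
exists r, Mx; split=> // x xr; have Dx := rD' x xr.
apply: cauchy_cvg_nrm => e e0.
have K20 : 0 <= Mx * (Kc / mu) by rewrite mulr_ge0 // divr_ge0 // ltW.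
have [s s0 hse] := exp_decay_small mu0 K20 e0.
exists (normalized s x); exists s; split; first exact: num_real.
move=> t st /=; have st' := ltW st.
apply: le_lt_trans hse; rewrite -mulrA.
apply: le_trans (_ : Mx * (Z t - Z s) <= _); last by rewrite ler_wpM2l.
rewrite mulrBr.
apply: (@rder_mean_value R A (normalized^~ x) (v x) (fun t => Mx * Z t)
  (fun t => Mx * (Kc * expR (- mu * t))) s t st').
- by move=> w sw _; apply: rder_normalized => //; exact: le_trans sw.
- by move=> w sw _; apply: lcont_normalized => //; exact: le_lt_trans sw.
- move=> w sw _; have w0 := le_trans s0 sw.
  apply: le_trans (hv x w xr w0) _; rewrite mulrC; apply: ler_wpM2r; last exact: bnd.
  by rewrite mulr_ge0 ?expR_ge0 // ltW.
Qed.

(** The analogue of Koenigs' function, which linearizes a map near an attracting fixed point by the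
    same kind of limit. *)
Definition koenigs (x : X) : A := lim (normalized^~ x @ +oo%R).

(** Convergence spreads backwards along orbits: T is fixed, and multiplication by fixed elements is
    continuous. *)
Lemma koenigs_shift T x : 0 <= T -> D x ->
  normalized^~ (F T x) @ +oo%R --> koenigs (F T x) ->
  normalized^~ x @ +oo%R -->
    mul (aexp mul one (- T) B0) (mul (koenigs (F T x)) (Gamma T x)).
Proof.
move=> T0 Dx /cvg_nrm_pinftyP hc; apply/cvg_nrm_pinftyP => e e0.
pose a := aexp mul one (- T) B0; pose g := Gamma T x.
pose Q := nrm a * nrm g + 1.
have Q0 : 0 < Q by rewrite ltr_wpDl // mulr_ge0 ?nrm_ge0.
have [N hN] := hc (e / Q) (divr_gt0 e0 Q0).
exists (Num.max N 0 + T) => t; rewrite -ltrBrDr gt_max => /andP[tN tT].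
rewrite -{1}(subrK T t) (normalizedD (ltW tT) T0 Dx) -/a -/g.
rewrite -(blinB (blin_mul hA a)) -(blinB (blin_mulr hA g)).
apply: le_lt_trans (nrm_bmul hA _ _) _.
apply: le_lt_trans (ler_wpM2l (nrm_ge0 _) (nrm_bmul hA _ _)) _.
have := hN _ tN; rewrite ltr_pdivlMr // => i1.
rewrite mulrCA; apply: le_lt_trans i1; rewrite ler_wpM2l ?nrm_ge0 // /Q lerDl //.
Qed.

Lemma koenigs_local : exists r : R, [/\ 0 < r,
   (forall x, nrm (x - x0) < r -> D x),
   (forall x, nrm (x - x0) < r -> normalized^~ x @ +oo%R --> koenigs x) &
   (forall x, nrm (x - x0) < r -> differentiable koenigs x)].
Proof.
have [r [K [r0 rD rK rl]]] := normalized_local.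
have kl x : nrm (x - x0) < r -> normalized^~ x @ +oo%R --> koenigs x.
  by move=> /rl[l hl']; apply: cvgP hl'.
exists r; split=> // x xr.
pose s := r - nrm (x - x0); have s0 : 0 < s by rewrite subr_gt0.
have sr y : nrm (y - x) < s -> nrm (y - x0) < r.
  by rewrite /s; have := nrm_mid x y x0; lra.
(* Integer times supply the sequence that Weierstrass' theorem asks for. *)
apply: (@weierstrass R X A (fun n => normalized n%:R) koenigs x s K s0).
- move=> n y /sr yr; split; first by apply: normalized_diff; [exact: ler0n|exact: rD].
  by apply: rK yr.
- move=> y /sr /kl /cvg_nrm_pinftyP h; apply/cvg_nrm_seqP => e /h[N hN].
  have [m hm] : exists m : nat, N < m%:R.
    by exists (Num.bound `|N|); apply: le_lt_trans (ler_norm _) (archi_boundP (normr_ge0 _)).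
  by exists m => n mn; apply: hN; apply: lt_le_trans hm _; rewrite ler_nat.
Qed.

Lemma attract_ball x (r : R) : 0 < r -> D x -> exists2 T, 0 <= T & nrm (F T x - x0) < r.
Proof.
move=> r0 Dx; have [N N0 hN] := semigroup_attract oD hs Dx r0.
by exists (N + 1); [lra|apply: hN; lra].
Qed.

Lemma koenigs_cvg x : D x -> normalized^~ x @ +oo%R --> koenigs x.
Proof.
move=> Dx; have [r [r0 rD rl _]] := koenigs_local.
have [T T0 hT'] := attract_ball r0 Dx.
exact: cvgP (koenigs_shift T0 Dx (rl _ hT')).
Qed.

Lemma koenigsE T x : 0 <= T -> D x ->
  koenigs x = mul (aexp mul one (- T) B0) (mul (koenigs (F T x)) (Gamma T x)).
Proof.
move=> T0 Dx; apply: cvg_nrm_unique (koenigs_cvg Dx) _.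
by apply: koenigs_shift => //; apply: koenigs_cvg; exact: (semigroup_in hF).
Qed.

Lemma koenigs_x0 : koenigs x0 = one.
Proof.
apply: cvg_nrm_unique (koenigs_cvg (Dx0 hs)) _.
apply/cvg_nrm_pinftyP => e e0; exists 0 => t t0.
by rewrite normalized_x0 ?(ltW t0) // subrr nrm0.
Qed.

Lemma koenigs_holomorphic : holomorphic_on D koenigs.
Proof.
move=> x Dx; have [r [r0 rD _ rd]] := koenigs_local.
have [T T0 hT'] := attract_ball r0 Dx.
have [s s0 hsD] := open_ball oD Dx.
have FT := semigroup_diff hF T0 Dx.
have [K K0 [d d0 hd]] := differentiable_lip FT.
pose gap := r - nrm (F T x - x0); have gap0 : 0 < gap by rewrite subr_gt0.
have m0 : 0 < Num.min s (Num.min d (gap / K)) by rewrite !lt_min s0 d0 divr_gt0.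
(* With T chosen for x, the functional equation still holds at every point of D, and F_T x lies
   where the limit is already known to be differentiable. *)
apply: (@differentiable_locally R X A koenigs
  (fun y => mul (aexp mul one (- T) B0) (mul (koenigs (F T y)) (Gamma T y))) x _ m0).
  by move=> y; rewrite lt_min => /andP[/hsD Dy _]; exact: koenigsE.
have bl u : exists c, blin (mul u) c by exists (nrm u); exact: blin_mul hA u.
have br u : exists c, blin (mul^~ u) c by exists (nrm u); exact: blin_mulr hA u.
apply: (differentiable_bilinear bl br (nrm_bmul hA)); first exact: differentiable_cst.
apply: (differentiable_bilinear bl br (nrm_bmul hA)); last exact: cocycle_diff.
by apply: differentiable_comp => //; exact: rd.
Qed.

(** * Invertibility and the conjugation formula *)

Hypothesis hrho : hyperbolic_metric D rho.

(** Each F_t is nonexpansive and fixes x0, so the orbit never moves further from x0 than its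
    starting point; the 1 makes the inequality strict. *)
Lemma orbit_strictly_inside x : D x ->
  strictly_inside D [set y | exists2 t, 0 <= t & y = F t x].
Proof.
move=> Dx; case: hrho => _ _ _ hne hb.
have SD : [set y | exists2 t, 0 <= t & y = F t x] `<=` D.
  by move=> _ [t t0 ->]; exact: (semigroup_in hF).
apply/(hb _ SD); exists x0, (rho x0 x + 1); split; first exact: Dx0 hs.
move=> _ [t t0 ->].
have := hne (F t) (fun y Dy => semigroup_diff hF t0 Dy) (fun y Dy => semigroup_in hF t0 Dy)
  x0 x (Dx0 hs) Dx.
rewrite (semigroup_fixed oD hF hs t0); lra.
Qed.

(** By T-continuity at time 0, uniform on the orbit, one d makes all Gamma_h(F_s x) with h < d
    closer than 1 to the unit. Cutting [0, t] into n steps shorter than d writes Gamma_t(x) as a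
    product of such elements. *)
Lemma cocycle_inverse t x : 0 <= t -> D x -> exists b, is_inverse mul one b (Gamma t x).
Proof.
move=> t0 Dx; case: hT => _ _ _ /(_ 0 (lexx 0) _ (orbit_strictly_inside Dx) 1 ltr01).
rewrite near_withinE => -[d /= d0 hd].
have inv h s : 0 <= h -> h < d -> 0 <= s -> exists b, is_inverse mul one b (Gamma h (F s x)).
  move=> h0 hhd s0; apply: (neumann hA).
  have := hd h; rewrite /= sub0r normrN ger0_norm // => /(_ hhd h0 (F s x)).
  rewrite cocycle0; last exact: (semigroup_in hF s0 Dx).
  by apply; exists s.
have [n hn] : exists n : nat, t / d < n%:R.
  by exists (Num.bound `|t / d|); apply: le_lt_trans (ler_norm _) (archi_boundP (normr_ge0 _)).
have n0 : 0 < n%:R :> R by apply: le_lt_trans hn; rewrite divr_ge0 // ltW.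
pose h := t / n%:R; have h0 : 0 <= h by rewrite divr_ge0 // ltW.
have hhd : h < d.
  by rewrite /h ltr_pdivrMr // mulrC -ltr_pdivrMr.
have step j : exists b, is_inverse mul one b (Gamma (j%:R * h) x).
  elim: j => [|j [b hb]].
    by rewrite mul0r cocycle0 //; exists one; split; exact: (bmul1 hA).
  have jh0 : 0 <= j%:R * h by rewrite mulr_ge0.
  have [b' hb'] := inv h (j%:R * h) h0 hhd jh0.
  exists (mul b b'); have -> : j.+1%:R * h = h + j%:R * h by rewrite -(natr1 j); ring.
  by rewrite -cocycleD //; exact: is_inverse_mul hA _ _ _ _ hb' hb.
by have := step n; rewrite /h mulrC divfK // gt_eqF.
Qed.

Lemma koenigs_inverse x : D x -> exists b, is_inverse mul one b (koenigs x).
Proof.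
move=> Dx.
have [K K0 [d d0 hd]] := differentiable_lip (koenigs_holomorphic (Dx0 hs)).
(* Within 1/K of x0 the Lipschitz bound puts M within 1 of M(x0), where the Neumann series
   converges. *)
have m0 : 0 < Num.min d (1 / K) by rewrite lt_min d0 divr_gt0.
have [T T0] := attract_ball m0 Dx; rewrite lt_min ltr_pdivlMr // => /andP[/hd i1 i2].
rewrite koenigs_x0 in i1.
have [|b hb] := @neumann R A mul one hA (koenigs (F T x)).
  by apply: le_lt_trans i1 _; rewrite mulrC.
have [b' hb'] := cocycle_inverse T0 Dx.
rewrite (koenigsE T0 Dx); eexists.
apply: is_inverse_mul hA _ _ _ _ _ _; last exact: is_inverse_mul hA _ _ _ _ hb hb'.
exact: aexp_inverse hA _ _.
Qed.

Lemma koenigs_conjugation t x m : 0 <= t -> D x -> is_inverse mul one m (koenigs (F t x)) ->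
  Gamma t x = mul m (mul (aexp mul one t B0) (koenigs x)).
Proof.
move=> t0 Dx [hm _].
rewrite (koenigsE t0 Dx) (bmulA hA (aexp _ _ _ _)) (aexpK hA) (bmul1 hA).
by rewrite (bmulA hA) hm (bmul1 hA).
Qed.

End Koenigs.

Theorem theorem4p5 (R : realType) (X A : completeNormedModType R[i])
  (mul : A -> A -> A) (one : A) (D : set X) (rho : X -> X -> R)
  (F : R -> X -> X) (x0 : X) (f : X -> X) (Gamma : R -> X -> A) (B : X -> A) :
  unital_banach_algebra mul one ->
  open D -> connected D -> D !=set0 -> dbounded D ->
  hyperbolic_metric D rho ->
  hol_semigroup D F ->
  condition_star D F x0 f ->
  T_cont_semicocycle mul one D F Gamma ->
  holomorphic_on D B ->
  generated_by mul one D F Gamma B ->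
  let B0 := B x0 in
  let ell := fine (kappa_plus mul one B0 - kappa_minus mul one B0)%E
             / `|fine (kappa_plus_op ('d f x0))| in
  (fun x => nrm (B x - B0) / nrm (x - x0) `^ ell) @ x0^' --> (0 : R) ->
  exists M : X -> A,
    [/\ (forall x, D x ->
           (fun t => mul (aexp mul one (- t) B0) (Gamma t x)) @ +oo%R --> M x),
        holomorphic_on D M,
        (forall x, D x -> exists b, is_inverse mul one b (M x))
      & (forall t x, 0 <= t -> D x ->
           forall Minv, is_inverse mul one Minv (M (F t x)) ->
           Gamma t x = mul Minv (mul (aexp mul one t B0) (M x)))].
Proof.
move=> hA oD _ _ bD hrho hF hs hT hB hG B0 ell hl.
exists (koenigs mul one x0 Gamma B); split.
- by move=> x Dx; exact: koenigs_cvg hA oD bD hF hs hT hB hG hl x Dx.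
- exact: koenigs_holomorphic hA oD bD hF hs hT hB hG hl.
- by move=> x Dx; exact: koenigs_inverse hA oD bD hF hs hT hB hG hl hrho x Dx.
- by move=> t x t0 Dx m hm; exact: koenigs_conjugation hA oD bD hF hs hT hB hG hl _ _ _ t0 Dx hm.
Qed.
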